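(* Let $\pi\in\mathcal{P}(\mathbb{R}^d)$ be log-concave, i.e. $\pi(\mathrm{d}x)=e^{-V(x)}\mathrm{d}x$ for some convex $V\in C^2(\mathbb{R}^d)$, and let $\mu_0\in\mathcal{P}(\mathbb{R}^d)$ be arbitrary. Consider the Langevin dynamics with target $\pi$ and initialization $\mu_0$, with mixing times $\mathrm{t}_{\mathrm{mix}}(\mu_0,\cdot)$ and mixing window $\mathrm{w}_{\mathrm{mix}}(\mu_0,\cdot)$. Then for every $\varepsilon\in(0,\tfrac12)$, $$\mathrm{w}_{\mathrm{mix}}(\mu_0,\varepsilon)\ \le\ \frac{3}{\varepsilon}\left(C_{\mathrm P}(\pi)+\sqrt{C_{\mathrm P}(\pi)\,C_{\mathrm P}(\mu_0)}+\sqrt{C_{\mathrm P}(\pi)\,\mathrm{t}_{\mathrm{mix}}(\mu_0,1-\varepsilon)}\right).$$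
   Context: $\mathcal{P}(\mathbb{R}^d)$ is the set of Borel probability measures on $\mathbb{R}^d$. The Langevin dynamics with target $\pi(\mathrm{d}x)=e^{-V(x)}\mathrm{d}x$ and initialization $\mu_0$ is the solution $(X_t)_{t\ge0}$ of the stochastic differential equation $X_0\sim\mu_0$, $\mathrm{d}X_t=-\nabla V(X_t)\,\mathrm{d}t+\sqrt2\,\mathrm{d}B_t$, where $(B_t)_{t\ge0}$ is a standard $d$-dimensional Brownian motion (independent of $X_0$). Write $\mu_t=\mathrm{law}(X_t)$. Total variation: $\mathrm{TV}(\mu,\pi)=\sup_{A\in\mathcal{B}(\mathbb{R}^d)}|\mu(A)-\pi(A)|$. Mixing time: for $\varepsilon\in(0,1)$, $\mathrm{t}_{\mathrm{mix}}(\mu_0,\varepsilon)=\min\{t\ge0:\mathrm{TV}(\mu_t,\pi)\le\varepsilon\}$. Width of the mixing window: for $\varepsilon\in(0,\frac12)$, $\mathrm{w}_{\mathrm{mix}}(\mu_0,\varepsilon)=\mathrm{t}_{\mathrm{mix}}(\mu_0,\varepsilon)-\mathrm{t}_{\mathrm{mix}}(\mu_0,1-\varepsilon)$. Poincaré constant: for $\mu\in\mathcal{P}(\mathbb{R}^d)$, $C_{\mathrm P}(\mu)\in[0,\infty]$ is the smallest number such that $\mathrm{Var}_\mu(f)\le C_{\mathrm P}(\mu)\int|\nabla f|^2\,\mathrm{d}\mu$ for all smooth $f:\mathbb{R}^d\to\mathbb{R}$ (equal to $+\infty$ if there is no such finite number). *)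

(* Defs.v *)
From HB Require Import structures.
From mathcomp Require Import all_boot all_order all_algebra.
From mathcomp Require Import all_classical all_reals all_analysis.
From mathcomp Require Import measurable_realfun.

Set Implicit Arguments.
Unset Strict Implicit.
Unset Printing Implicit Defensive.

Import Order.TTheory GRing.Theory Num.Theory.
Import numFieldNormedType.Exports.

Local Open Scope classical_set_scope.
Local Open Scope ring_scope.

(* R^d with its Borel sigma-algebra; convertible to 'rV[R]_d *)
Notation Rd R d := (g_sigma_algebraType (@open 'rV[R]_d)).

Section lebesgue_Rd.
Context {R : realType}.

Definition Rd_cons d (p : measurableTypeR R * Rd R d) : Rd R d.+1 :=
  \row_i (if unlift ord0 i is Some j then (p.2 : 'rV[R]_d) 0 j else p.1).

Definition Rd_uncons d (v : Rd R d.+1) : measurableTypeR R * Rd R d :=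
  ((v : 'rV[R]_d.+1) 0 ord0, \row_j (v : 'rV[R]_d.+1) 0 (lift ord0 j)).

Lemma Rd_cons0 d p : (@Rd_cons d p : 'rV[R]_d.+1) 0 ord0 = p.1.
Proof. by rewrite mxE unlift_none. Qed.

Lemma Rd_consS d p j :
  (@Rd_cons d p : 'rV[R]_d.+1) 0 (lift ord0 j) = (p.2 : 'rV[R]_d) 0 j.
Proof. by rewrite mxE liftK. Qed.

Lemma Rd_uncons_cons d (p : measurableTypeR R * Rd R d) :
  Rd_uncons (Rd_cons p) = p.
Proof.
case: p => x v; rewrite /Rd_uncons Rd_cons0; congr pair.
by apply/rowP => j; rewrite mxE Rd_consS.
Qed.

Lemma open_Rd_measurable d (A : set 'rV[R]_d) :
  open A -> measurable (A : set (Rd R d)).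
Proof. by move=> oA; exact: sub_sigma_algebra. Qed.

Lemma measurable_Rd_cons d : measurable_fun setT (@Rd_cons d).
Proof.
apply: (@measurability _ _ _ (Rd R d.+1) setT _ (@open 'rV[R]_d.+1)) => //.
move=> _ [U oU <-]; rewrite setTI.
pose c (q : 'rV[rat]_d.+1 * nat) : 'rV[R]_d.+1 := map_mx ratr q.1.
pose r (q : 'rV[rat]_d.+1 * nat) : R := q.2.+1%:R^-1.
pose D := [set q | ball (c q) (r q) `<=` U].
have UE : U = \bigcup_(q in D) ball (c q) (r q).
  apply/seteqP; split => [x Ux|x [q + xq]]; last exact.
  have /nbhs_ballP[e /= e0 eU] : nbhs x U.
    by rewrite nbhsE /=; exists U.
  pose k := Num.truncn (2 / e).
  have kr : k.+1%:R^-1 <= e / 2 :> R.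
    rewrite invf_ple ?posrE ?divr_gt0// invf_div.
    by apply: ltW; exact: truncnS_gt.
  have /all_sig[q xq] : forall i, {q : rat | `|x 0 i - ratr q| < k.+1%:R^-1}.
    move=> i; apply: cid.
    have : x 0 i - k.+1%:R^-1 < x 0 i + k.+1%:R^-1.
      by rewrite ltrD2l gt0_cp// invr_gt0.
    move=> /rat_in_itvoo[q]; rewrite in_itv/= => /andP[q1 q2].
    by exists q; rewrite distrC ltr_distl q1 q2.
  have cx : ball (c (\row_i q i, k)) (r (\row_i q i, k)) x.
    split => [|i j]; first by rewrite /r invr_gt0.
    by rewrite /c/= !mxE /ball/= (ord1 i) distrC; exact: xq.
  exists (\row_i q i, k) => //= y cy; apply: eU.
  have := ball_triangle (ball_sym cx) cy.
  apply: le_ball; rewrite /r/= (le_trans (lerD kr kr))//.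
  by rewrite -splitr.
have ballE q : @Rd_cons d @^-1` (ball (c q) (r q)) =
    ball (c q 0 ord0) (r q) `*`
    (ball (\row_j c q 0 (lift ord0 j)) (r q) : set 'rV[R]_d).
  apply/seteqP; split => -[x v]/=.
    move=> [r0 bxv]; split; first by have := bxv 0 ord0; rewrite Rd_cons0.
    split => // i j; rewrite (ord1 i).
    by rewrite mxE; have := bxv 0 (lift ord0 j); rewrite Rd_consS.
  move=> [bx [r0 bv]]; split => // i j; rewrite (ord1 i).
  case: (unliftP ord0 j) => [j' ->|->]; last by rewrite Rd_cons0.
  by rewrite Rd_consS; have := bv 0 j'; rewrite mxE.
rewrite UE preimage_bigcup bigcup_mkcond.
apply: countable_bigcupT_measurable; first exact: countableP.
move=> q; case: ifPn => // _; rewrite ballE.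
apply: measurableX.
  by exact: measurable_ball.
by apply: open_Rd_measurable; apply: ball_open; rewrite /r invr_gt0.
Qed.

Lemma measurable_Rd_uncons d : measurable_fun setT (@Rd_uncons d).
Proof.
apply/measurable_fun_pairP; split.
  apply: (measurability _ (RGenOpens.measurableE R)).
  move=> _ [_ [a [b ->] <-]]; rewrite setTI.
  apply: open_Rd_measurable.
  apply: (@open_comp 'rV[R]_d.+1 R (fun v => v 0 ord0)).
    by move=> v _; exact: coord_continuous.
  exact: interval_open.
apply: (@measurability _ _ _ (Rd R d) setT _ (@open 'rV[R]_d)) => //.
move=> _ [U oU <-]; rewrite setTI.
apply: open_Rd_measurable.
apply: (@open_comp 'rV[R]_d.+1 'rV[R]_d (fun v => \row_j v 0 (lift ord0 j))) => //.
move=> v _ /= W /nbhs_ballP[e /= e0 eW]; apply/nbhs_ballP; exists e => //= w vw.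
by apply: eW; case: vw => _ vw; split => // i j; rewrite !mxE.
Qed.

(* Tonelli: the image of lambda_1 \x lambda_d under R * R^d ~ R^(d+1) *)
Definition lebesgue_Rd_succ d (mu : set (Rd R d) -> \bar R) :
    set (Rd R d.+1) -> \bar R :=
  pushforward (@lebesgue_measure R \x mu)%E (@Rd_cons d).

Section lebesgue_Rd_succ.
Context d (mu : {sigma_finite_measure set (Rd R d) -> \bar R}).

Let preimage_measurable A :
  measurable A -> measurable (@Rd_cons d @^-1` A).
Proof.
by move=> mA; rewrite -[X in measurable X]setTI; exact: measurable_Rd_cons.
Qed.

Let lebesgue_Rd_succ0 : lebesgue_Rd_succ mu set0 = 0%E.
Proof. by rewrite /lebesgue_Rd_succ /pushforward preimage_set0 measure0. Qed.

Let lebesgue_Rd_succ_ge0 A : (0 <= lebesgue_Rd_succ mu A)%E.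
Proof. by rewrite /lebesgue_Rd_succ /pushforward measure_ge0. Qed.

Let lebesgue_Rd_succ_sigma_additive : semi_sigma_additive (lebesgue_Rd_succ mu).
Proof.
move=> F mF tF mUF; rewrite /lebesgue_Rd_succ /pushforward preimage_bigcup.
apply: measure_semi_sigma_additive.
- by move=> n; exact: preimage_measurable.
- apply/trivIsetP => /= i j _ _ ij; rewrite -preimage_setI.
  by move/trivIsetP : tF => /(_ _ _ _ _ ij) ->//; rewrite preimage_set0.
- by rewrite -preimage_bigcup; exact: preimage_measurable.
Qed.

HB.instance Definition _ := isMeasure.Build _ _ _ (lebesgue_Rd_succ mu)
  lebesgue_Rd_succ0 lebesgue_Rd_succ_ge0 lebesgue_Rd_succ_sigma_additive.

Let lebesgue_Rd_succ_sigma_finite : sigma_finite setT (lebesgue_Rd_succ mu).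
Proof.
have /sigma_finiteP[F [TF ndF Foo]] := sigma_finiteT (@lebesgue_measure R).
have /sigma_finiteP[G [TG ndG Goo]] := sigma_finiteT mu.
exists (fun n => @Rd_uncons d @^-1` (F n `*` G n)).
  rewrite -preimage_bigcup; apply/esym/seteqP; split => // v _.
  have [n _ Fn] : (\bigcup_n F n) (Rd_uncons v).1 by rewrite -TF.
  have [m _ Gm] : (\bigcup_n G n) (Rd_uncons v).2 by rewrite -TG.
  exists (maxn n m) => //; split.
    by apply: (subsetPset _ _ (ndF _ _ (leq_maxl n m))).
  by apply: (subsetPset _ _ (ndG _ _ (leq_maxr n m))).
move=> n; have [mFn Fnoo] := Foo n; have [mGn Gnoo] := Goo n; split.
  rewrite -[X in measurable X]setTI; apply: measurable_Rd_uncons => //.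
  exact: measurableX.
rewrite /lebesgue_Rd_succ /pushforward [X in (_ X < _)%E](_ : _ = F n `*` G n).
  by rewrite product_measure1E// lte_mul_pinfty// ge0_fin_numE.
by apply/funext => p; rewrite /preimage/= -[in RHS](Rd_uncons_cons p).
Qed.

HB.instance Definition _ := Measure_isSigmaFinite.Build _ _ _
  (lebesgue_Rd_succ mu) lebesgue_Rd_succ_sigma_finite.

End lebesgue_Rd_succ.

Fixpoint lebesgue_Rd d : {sigma_finite_measure set (Rd R d) -> \bar R} :=
  match d with
  | 0%N => [the {sigma_finite_measure set (Rd R 0) -> \bar R} of \d_((0 : 'rV[R]_0) : Rd R 0)]
  | d'.+1 => [the {sigma_finite_measure set (Rd R d'.+1) -> \bar R}
              of lebesgue_Rd_succ (lebesgue_Rd d')]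
  end.

Lemma measurable_Rd_box d (A : 'I_d -> set R) :
  (forall i, measurable (A i)) ->
  measurable ([set v | forall i, A i ((v : 'rV[R]_d) 0 i)] : set (Rd R d)).
Proof.
elim: d A => [|d IH] A mA.
  by rewrite [X in measurable X](_ : _ = setT)//; apply/seteqP; split => // v _ [].
rewrite [X in measurable X](_ : _ = @Rd_uncons d @^-1` (A ord0 `*`
    [set v | forall i, A (lift ord0 i) ((v : 'rV[R]_d) 0 i)])).
  rewrite -[X in measurable X]setTI; apply: measurable_Rd_uncons => //.
  apply: measurableX; first exact: mA.
  by apply: (IH (fun i => A (lift ord0 i))) => i; exact: mA.
apply/seteqP; split => [v Av|v [A0 AS] i] /=.
  by split => [|i] /=; [exact: Av|rewrite mxE; exact: Av].
case: (unliftP ord0 i) => [j ->|-> //].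
by have := AS j; rewrite mxE.
Qed.

Lemma lebesgue_Rd_box d (A : 'I_d -> set R) :
  (forall i, measurable (A i)) ->
  lebesgue_Rd d [set v | forall i, A i ((v : 'rV[R]_d) 0 i)] =
  (\prod_i lebesgue_measure (A i))%E.
Proof.
elim: d A => [|d IH] A mA.
  by rewrite big_ord0 /= diracE mem_set// => -[].
rewrite big_ord_recl -IH//= /lebesgue_Rd_succ /pushforward.
rewrite [X in (_ X = _)%E](_ : _ = A ord0 `*`
    [set v | forall i, A (lift ord0 i) ((v : 'rV[R]_d) 0 i)]).
  rewrite product_measure1E//; first exact: mA.
  by apply: (@measurable_Rd_box _ (fun i => A (lift ord0 i))) => i; exact: mA.
apply/seteqP; split => [p Ap|p [A0 AS] i] /=.
  by split => [|i] /=; [have := Ap ord0; rewrite Rd_cons0|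
    have := Ap (lift ord0 i); rewrite Rd_consS].
by case: (unliftP ord0 i) => [j ->|->]; rewrite (Rd_cons0, Rd_consS)//; exact: AS.
Qed.

End lebesgue_Rd.

Section calculus.
Context {R : realType} {d : nat}.

Definition partial (i : 'I_d) (f : 'rV[R]_d -> R) : 'rV[R]_d -> R :=
  fun x => 'D_(delta_mx 0 i) f x.

Definition gradient (f : 'rV[R]_d -> R) (x : 'rV[R]_d) : 'rV[R]_d :=
  \row_i partial i f x.

(* squared Euclidean norm; `|v| on 'rV is the sup norm *)
Definition sqnorm (v : 'rV[R]_d) : R := \sum_i v 0 i ^+ 2.

Fixpoint Ck (k : nat) (f : 'rV[R]_d -> R) : Prop :=
  continuous f /\
  if k is k'.+1 then
    (forall x i, derivable f x (delta_mx 0 i)) /\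
    (forall i, Ck k' (partial i f))
  else True.

Definition smooth (f : 'rV[R]_d -> R) : Prop := forall k, Ck k f.

End calculus.

Section measures.
Context {R : realType} {d : nat}.
Local Open Scope ereal_scope.

Definition log_concave_with_potential (pi : probability (Rd R d) R)
    (V : 'rV[R]_d -> R) : Prop :=
  [/\ Ck 2 V,
      convex_function [set: convex_lmodType 'rV[R]_d] V &
      forall A : set (Rd R d), measurable A ->
        pi A = \int[lebesgue_Rd d]_(x in A) (expR (- V x))%:E].

Definition total_variation (mu nu : set (Rd R d) -> \bar R) : \bar R :=
  ereal_sup [set `|mu A - nu A| | A in [set A : set (Rd R d) | measurable A]].

(* 'V_mu[f] is +oo when f is not square-integrable: the mean is then finite,
   or set to 0 by fine, and f minus a constant has infinite second moment. *)
Definition poincare_constant (mu : probability (Rd R d) R) : \bar R :=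
  ereal_inf [set C%:E | C in [set C : R | (0 <= C)%R /\
    forall f : 'rV[R]_d -> R, smooth f ->
      'V_mu[f : Rd R d -> R] <=
        C%:E * \int[mu]_x (sqnorm (gradient f x))%:E]].

End measures.

Section langevin.
Context {R : realType} {d : nat}.
Context {dO : measure_display} {Omega : measurableType dO}.
Variable P : probability Omega R.
Implicit Types B X : R -> Omega -> 'rV[R]_d.

Definition standard_brownian_motion B : Prop :=
  [/\ forall t, 0 <= t -> measurable_fun setT (B t : Omega -> Rd R d),
      {ae P, forall w, B 0 w = 0},
      {ae P, forall w, {within `[0, +oo[, continuous (fun t => B t w)}},
      forall s t, 0 <= s < t -> forall A : 'I_d -> set R,
        (forall i, measurable (A i)) ->
        P [set w | forall i, A i ((B t w - B s w) 0 i)] =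
        (\prod_(i < d) normal_prob 0 (Num.sqrt (t - s)) (A i))%E &
      forall (n : nat) (t : nat -> R), 0 <= t 0%N ->
        {homo t : i j / (i <= j)%N >-> i <= j} ->
        forall A : 'I_n -> set (Rd R d), (forall i, measurable (A i)) ->
        P [set w | forall i : 'I_n, A i (B (t i.+1) w - B (t i) w)] =
        (\prod_(i < n) P [set w | A i (B (t i.+1) w - B (t i) w)%R])%E].

(* the sigma-algebras of X0 and of (B t), t >= 0, are independent; the latter is
   generated by the pi-system of finite-dimensional cylinders *)
Definition independent_of_process (X0 : Omega -> 'rV[R]_d) B : Prop :=
  forall (n : nat) (t : 'I_n -> R), (forall i, 0 <= t i) ->
  forall (A0 : set (Rd R d)) (A : 'I_n -> set (Rd R d)),
    measurable A0 -> (forall i, measurable (A i)) ->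
  P [set w | A0 (X0 w) /\ forall i, A i (B (t i) w)] =
  (P [set w | A0 (X0 w)] * P [set w | forall i, A i (B (t i) w)])%E.

(* The noise is additive, so the SDE is a pathwise integral equation and
   involves no stochastic integral. *)
Definition langevin_path (V : 'rV[R]_d -> R) (b x : R -> 'rV[R]_d) : Prop :=
  {within `[0, +oo[, continuous x} /\
  forall t, 0 <= t ->
    x t = x 0
      - \row_i (\int[lebesgue_measure]_(s in `[0, t]) gradient V (x s) 0 i)
      + Num.sqrt 2 *: b t.

Definition langevin_dynamics (V : 'rV[R]_d -> R) (mu0 : probability (Rd R d) R)
    B X : Prop :=
  [/\ standard_brownian_motion B,
      independent_of_process (X 0) B,
      forall t, 0 <= t -> measurable_fun setT (X t : Omega -> Rd R d),
      forall A : set (Rd R d), measurable A ->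
        pushforward P (X 0 : Omega -> Rd R d) A = mu0 A &
      {ae P, forall w, langevin_path V (B ^~ w) (X ^~ w)}].

End langevin.

Section mixing.
Context {R : realType} {d : nat}.
Local Open Scope ereal_scope.
Variables (mu : R -> set (Rd R d) -> \bar R) (pi : set (Rd R d) -> \bar R).

Definition mixing_time (e : R) : \bar R :=
  ereal_inf [set t%:E | t in
    [set t : R | (0 <= t)%R /\ total_variation (mu t) pi <= e%:E]].

Definition mixing_window (e : R) : \bar R :=
  mixing_time e - mixing_time (1 - e)%R.

End mixing.

(* Main.v *)
(** Everything is done for the implicit Euler (proximal) discretisation of the
  Langevin equation, with one-step kernel [Q_h f x = E f (prox_h (x + sqrt 2 B_h))],
  tested on Lipschitz functions with values in [[0, 1]], a class which [Q_h]
  preserves because the proximal map of a convex potential is a contraction.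

  Pathwise, the scheme converges to the process by monotonicity of [grad V].
  The kernel satisfies, up to errors vanishing with [h]: a dimension-free
  Harnack inequality [(Q_s f x)^2 <= Q_s f y * exp (|x - y|^2 / 2s)]
  (Cameron-Martin shifts absorbed gradually by the contraction); the local
  variance bound [Q_t (f^2) - (Q_t f)^2 <= 2 t L^2] for [L]-Lipschitz [f]; the
  invariance of [pi]; and the decay [exp (-2r/C)] of the variance under [pi],
  where [C] is the Poincare constant of [pi].

  Suppose [TV (mu_t0, pi) <= 1 - e] but [E phi (X_(t0+s+r)) > pi phi + e].
  Relaxing [phi] over time [r] and cutting off at [pi phi + e/4] gives a function
  whose further relaxation [v] over time [s] has a tiny mean under [pi], yet mean
  at least [3e/4] under [mu_t0].  By the Harnack inequality [{v >= e/4}] and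
  [{v < tau}] are at distance at least [rho].  Both sets have [mu_t0]-mass of order [e]:
  the first by the mean of [v], the second because it has nearly full [pi]-mass
  and [TV (mu_t0, pi) <= 1 - e].  Hence a [1/rho]-Lipschitz function has
  [mu_t0]-variance of order [e], against the Poincare bound
  [(C_P(mu_0) + 2 t0) / rho^2]. *)

Require Import Defs.
From HB Require Import structures.
From mathcomp Require Import all_boot all_order all_algebra.
From mathcomp Require Import all_classical all_reals all_analysis.
From mathcomp Require Import measurable_realfun ring lra.

Import Order.TTheory GRing.Theory Num.Theory.
Import numFieldNormedType.Exports.

Set Implicit Arguments.
Unset Strict Implicit.
Unset Printing Implicit Defensive.

Local Open Scope classical_set_scope.
Local Open Scope ring_scope.

(** * Euclidean geometry of row vectors *)

(** [V] comes with no bound on its Hessian and no growth condition, so neither an explicit Euler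
    step nor a global expansion of the generator is under control. The implicit step is a
    contraction for every convex [V]; this one fact carries regularity, the Harnack inequality, the
    variance bounds and the pathwise convergence. Every error estimate is uniform over [BL L], so
    the step size can be fixed from [L] and the time horizon and the estimate reused at each step.
    Where the gradient of [V] must be bounded, estimates are confined to a ball, and tightness of
    [pi] pays for the rest. With [A = sqrt (C K0) + sqrt (C t0)] the two relaxation times are
    [s = (C + A) / e] and [r = 2 s], whence the factor 3. The separation [rho^2 = 8 (K0 + 2 t0) / e]
    makes the Poincare bound on the variance [e / 8], below the [3 e / 16] forced by the two sets.
    The relaxation gains [exp (- 4 / e - 4 A / (C e))]: the second term absorbs the Harnack
    exponent, the first one the powers of [e]. *)

Section euclid.
Context {R : realType} {d : nat}.
Implicit Types (u v w x y : 'rV[R]_d) (a : R).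

Definition dot u v : R := \sum_i u 0 i * v 0 i.
Definition enorm v : R := Num.sqrt (sqnorm v).

Lemma dotC u v : dot u v = dot v u.
Proof. by apply: eq_bigr => i _; rewrite mulrC. Qed.

Lemma dotDl u v w : dot (u + v) w = dot u w + dot v w.
Proof. by rewrite -big_split; apply: eq_bigr => i _; rewrite mxE mulrDl. Qed.

Lemma dotZl a u v : dot (a *: u) v = a * dot u v.
Proof. by rewrite mulr_sumr; apply: eq_bigr => i _; rewrite mxE mulrA. Qed.

Lemma dotNl u v : dot (- u) v = - dot u v.
Proof. by rewrite -scaleN1r dotZl mulN1r. Qed.

Lemma dotBl u v w : dot (u - v) w = dot u w - dot v w.
Proof. by rewrite dotDl dotNl. Qed.

Lemma dotDr u v w : dot w (u + v) = dot w u + dot w v.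
Proof. by rewrite dotC dotDl !(dotC w). Qed.

Lemma dotZr a u v : dot u (a *: v) = a * dot u v.
Proof. by rewrite dotC dotZl dotC. Qed.

Lemma dotNr u v : dot u (- v) = - dot u v.
Proof. by rewrite dotC dotNl dotC. Qed.

Lemma dotBr u v w : dot w (u - v) = dot w u - dot w v.
Proof. by rewrite dotDr dotNr. Qed.

Lemma dot0l v : dot 0 v = 0.
Proof. by rewrite /dot big1// => i _; rewrite mxE mul0r. Qed.

Lemma dot_delta v i : dot v (delta_mx 0 i) = v 0 i.
Proof.
rewrite /dot (bigD1 i)//= mxE !eqxx mulr1 big1 ?addr0// => j ji.
by rewrite mxE (negbTE ji) andbF mulr0.
Qed.

Lemma dotvv v : dot v v = sqnorm v.
Proof. by apply: eq_bigr => i _; rewrite expr2. Qed.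

Lemma sqnorm_ge0 v : 0 <= sqnorm v.
Proof. by apply: sumr_ge0 => i _; rewrite sqr_ge0. Qed.

Lemma enorm_ge0 v : 0 <= enorm v.
Proof. exact: sqrtr_ge0. Qed.

Lemma enorm_sqr v : enorm v ^+ 2 = sqnorm v.
Proof. by rewrite sqr_sqrtr// sqnorm_ge0. Qed.

Lemma enorm0 : enorm 0 = 0.
Proof. by rewrite /enorm -dotvv dot0l sqrtr0. Qed.

Lemma sqnormZ a v : sqnorm (a *: v) = a ^+ 2 * sqnorm v.
Proof. by rewrite -!dotvv dotZl dotZr mulrA expr2. Qed.

Lemma enormZ a v : enorm (a *: v) = `|a| * enorm v.
Proof. by rewrite /enorm sqnormZ sqrtrM ?sqr_ge0// sqrtr_sqr. Qed.

Lemma enormN v : enorm (- v) = enorm v.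
Proof. by rewrite -scaleN1r enormZ normrN normr1 mul1r. Qed.

Lemma enormC u v : enorm (u - v) = enorm (v - u).
Proof. by rewrite -opprB enormN. Qed.

Lemma sqnormD u v : sqnorm (u + v) = sqnorm u + 2 * dot u v + sqnorm v.
Proof. by rewrite -!dotvv dotDl !dotDr (dotC v u); ring. Qed.

Lemma sqnormB u v : sqnorm (u - v) = sqnorm u - 2 * dot u v + sqnorm v.
Proof. by rewrite -!dotvv dotBl !dotBr (dotC v u); ring. Qed.

Lemma coord_le_enorm v i : `|v 0 i| <= enorm v.
Proof.
rewrite -sqrtr_sqr ler_wsqrtr// /sqnorm (bigD1 i)//= lerDl.
by apply: sumr_ge0 => j _; rewrite sqr_ge0.
Qed.

Lemma enorm_eq0 v : enorm v = 0 -> v = 0.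
Proof.
move=> v0; apply/rowP => i; rewrite mxE; apply/eqP; rewrite -normr_le0.
by rewrite (le_trans (coord_le_enorm v i))// v0.
Qed.

(** Cauchy-Schwarz, by expanding the square of [enorm v *: u - enorm u *: v], from which the factor
    [2 |u| |v|] can be cancelled when both norms are nonzero. *)
Lemma dot_le u v : dot u v <= enorm u * enorm v.
Proof.
have [u0|u0] := eqVneq (enorm u) 0; first by rewrite (enorm_eq0 u0) dot0l enorm0 mul0r.
have [v0|v0] := eqVneq (enorm v) 0.
  by rewrite (enorm_eq0 v0) dotC dot0l enorm0 mulr0.
have up : 0 < enorm u by rewrite lt_def u0 enorm_ge0.
have vp : 0 < enorm v by rewrite lt_def v0 enorm_ge0.
have := sqnorm_ge0 (enorm v *: u - enorm u *: v).
rewrite sqnormB !sqnormZ dotZl dotZr -!enorm_sqr.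
rewrite (_ : _ + _ = 2 * (enorm v * enorm u) * (enorm u * enorm v - dot u v)); last by ring.
by rewrite pmulr_rge0 ?subr_ge0// !mulr_gt0.
Qed.

Lemma normr_dot_le u v : `|dot u v| <= enorm u * enorm v.
Proof. by rewrite ler_norml -lerNl -dotNl dot_le andbT -(enormN u) dot_le. Qed.

Lemma enormD u v : enorm (u + v) <= enorm u + enorm v.
Proof.
rewrite -ler_sqr ?nnegrE ?addr_ge0 ?enorm_ge0// sqrrD !enorm_sqr sqnormD.
by rewrite lerD2r lerD2l -[leRHS]mulr_natl ler_pM2l// dot_le.
Qed.

Lemma enormB u v : enorm (u - v) <= enorm u + enorm v.
Proof. by rewrite -(enormN v) enormD. Qed.

Lemma enorm_tri w u v : enorm (u - v) <= enorm (u - w) + enorm (w - v).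
Proof. by rewrite (le_trans _ (enormD _ _))// addrA subrK. Qed.

Lemma enormBB u v : `|enorm u - enorm v| <= enorm (u - v).
Proof.
have h x y : enorm x - enorm y <= enorm (x - y).
  by rewrite lerBlDr (le_trans _ (enormD _ _))// subrK.
by rewrite ler_norml h andbT lerNl opprB enormC h.
Qed.


(** The crude constant [d] is enough, since the sup norm only enters through topology, integrability
    and error terms that vanish with the step. *)
Lemma enorm_le_mx_norm v : enorm v <= d%:R * `|v|.
Proof.
rewrite -(ger0_norm (mulr_ge0 (ler0n _ _) (normr_ge0 v))) -sqrtr_sqr ler_wsqrtr//.
rewrite exprMn; apply: (@le_trans _ _ (d%:R * `|v| ^+ 2)).
  rewrite [leRHS](_ : _ = \sum_(i < d) `|v| ^+ 2); last first.
    by rewrite sumr_const card_ord mulr_natl.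
  apply: ler_sum => i _; rewrite -(real_normK (num_real (v 0 i))).
  by rewrite lerXn2r ?nnegrE// [leRHS]mx_normrE (le_trans _ (le_bigmax _ _ (ord0, i))).
rewrite ler_wpM2r ?sqr_ge0// -natrX ler_nat.
by case: d => // n; rewrite leq_pmulr.
Qed.

Lemma enorm_ball x y e : enorm (x - y) < e -> ball x e y.
Proof.
move=> xy; rewrite -ball_normE /=; apply: le_lt_trans xy.
have -> : `|x - y| = mx_norm (x - y) by [].
have [->|v0] := eqVneq (mx_norm (x - y)) 0; first exact: enorm_ge0.
by have [[j i] /= ->] := mx_norm_neq0 v0; rewrite (ord1 j) coord_le_enorm.
Qed.

Lemma ball_enorm x e : 0 < e -> exists2 r, 0 < r &
  forall y, ball x r y -> enorm (x - y) < e.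
Proof.
move=> e0; exists (e / d.+1%:R); first by rewrite divr_gt0.
move=> y; rewrite -ball_normE /= => xy.
apply: (le_lt_trans (enorm_le_mx_norm _)).
apply: (@le_lt_trans _ _ (d.+1%:R * `|x - y|)).
  by rewrite ler_wpM2r// ler_nat.
by rewrite mulrC -ltr_pdivlMr.
Qed.

(** Lipschitz for the Euclidean norm, not for the sup norm of ['rV]: the contraction of the proximal
    map and the gradient bounds are Euclidean, which keeps the final constants free of the
    dimension. *)
Definition elip (L : R) (f : 'rV[R]_d -> R) :=
  forall x y, `|f x - f y| <= L * enorm (x - y).

Lemma elip_continuous L f : elip L f -> continuous f.
Proof.
move=> fL x A /nbhs_ballP[e /= e0 eA].
have L0 : 0 < `|L| + 1 by rewrite ltr_pwDr.
have [r r0 xr] := ball_enorm x (divr_gt0 e0 L0).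
apply/nbhs_ballP; exists r => //= y /xr; rewrite ltr_pdivlMr// mulrC => xy.
apply: eA; rewrite -ball_normE /=; apply: le_lt_trans xy.
rewrite (le_trans (fL _ _))// ler_wpM2r ?enorm_ge0//.
by rewrite (le_trans (ler_norm _))// lerDl.
Qed.

Lemma enorm_elip : elip 1 enorm.
Proof. by move=> x y; rewrite mul1r enormBB. Qed.

Lemma dot_elip p : elip (enorm p) (dot p).
Proof. by move=> x y; rewrite -dotBr normr_dot_le. Qed.

End euclid.

(** * Expectations *)

Section Rd_measurability.
Context {R : realType}.

Lemma continuous_measurable_Rd d (f : 'rV[R]_d -> R) : continuous f ->
  measurable_fun setT (f : Rd R d -> R).
Proof.
move=> cf; apply: (measurability _ (RGenOpens.measurableE R)).
move=> _ [_ [a [b ->] <-]]; rewrite setTI.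
by apply: open_Rd_measurable; apply: open_comp => [x _|]; [exact: cf|exact: interval_open].
Qed.

Lemma measurable_coord d (i : 'I_d) :
  measurable_fun setT ((fun v => v 0 i) : Rd R d -> R).
Proof. by apply: continuous_measurable_Rd => v; exact: coord_continuous. Qed.

(** Coordinates suffice because [Rd_cons] is measurable: the Borel structure in dimension [d + 1] is
    rebuilt from a product, by induction. *)
Lemma measurable_fun_Rd dT (T : measurableType dT) d (f : T -> Rd R d) :
  (forall i, measurable_fun setT (fun t => (f t : 'rV[R]_d) 0 i)) ->
  measurable_fun setT f.
Proof.
elim: d f => [|d IH] f mf.
  rewrite (_ : f = cst (0 : 'rV[R]_0))//.
  by apply/funext => t; apply/rowP => -[].
rewrite (_ : f = @Rd_cons R d \o (fun t => (f t 0 ord0, \row_j f t 0 (lift ord0 j)))).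
  apply: measurableT_comp; first exact: measurable_Rd_cons.
  apply/measurable_fun_pairP; split; first exact: mf.
  apply: IH => i; apply: eq_measurable_fun (mf (lift ord0 i)).
  by move=> t _; rewrite /= mxE.
apply/funext => t; apply/rowP => i; rewrite /= /Rd_cons mxE.
by case: unliftP => [j ->|->//]; rewrite mxE.
Qed.

Lemma measurable_fun_coord dT (T : measurableType dT) d (f : T -> Rd R d) i :
  measurable_fun setT f -> measurable_fun setT (fun t => (f t : 'rV[R]_d) 0 i).
Proof. by move=> mf; apply: (measurableT_comp (measurable_coord i) mf). Qed.

Lemma measurable_RdD dT (T : measurableType dT) d (f g : T -> Rd R d) :
  measurable_fun setT f -> measurable_fun setT g ->
  measurable_fun setT (fun t => ((f t : 'rV[R]_d) + g t : 'rV[R]_d) : Rd R d).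
Proof.
move=> mf mg; apply: measurable_fun_Rd => i.
under eq_fun do rewrite mxE.
by apply: measurable_funD; exact: measurable_fun_coord.
Qed.

Lemma measurable_RdZ dT (T : measurableType dT) d (k : R) (f : T -> Rd R d) :
  measurable_fun setT f ->
  measurable_fun setT (fun t => (k *: (f t : 'rV[R]_d) : 'rV[R]_d) : Rd R d).
Proof.
move=> mf; apply: measurable_fun_Rd => i.
under eq_fun do rewrite mxE.
by apply: measurable_funM => //; exact: measurable_fun_coord.
Qed.

Lemma measurable_RdB dT (T : measurableType dT) d (f g : T -> Rd R d) :
  measurable_fun setT f -> measurable_fun setT g ->
  measurable_fun setT (fun t => ((f t : 'rV[R]_d) - g t : 'rV[R]_d) : Rd R d).
Proof.
move=> mf mg; apply: measurable_fun_Rd => i.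
under eq_fun do rewrite !mxE.
by apply: measurable_funB; exact: measurable_fun_coord.
Qed.

End Rd_measurability.

(** * Change of measure by a density *)

Section density.
Context dT {T : measurableType dT} {R : realType}.
Variables (nu : {finite_measure set T -> \bar R})
  (mu : {sigma_finite_measure set T -> \bar R}) (p : T -> R).
Hypothesis mp : measurable_fun setT p.
Hypothesis nuE : forall A, measurable A -> nu A = (\int[mu]_(x in A) (p x)%:E)%E.
Local Open Scope ereal_scope.

Let nu_dom : nu `<< mu.
Proof.
apply/null_content_dominatesP => A mA A0; rewrite nuE//.
apply: null_set_integral => //; apply/measurable_EFinP.
exact: measurable_funTS.
Qed.

(** The density [p] agrees almost everywhere with the Radon-Nikodym derivative, because both
    integrate to [nu] over every measurable set; the change of variables for the latter then
    transfers. *)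
Lemma ge0_integral_density (f : T -> \bar R) : measurable_fun setT f ->
  (forall x, 0 <= f x) -> \int[nu]_x f x = \int[mu]_x (f x * (p x)%:E).
Proof.
move=> mf f0; rewrite -(@Radon_Nikodym_SigmaFinite.change_of_variables _ _ _ nu mu nu_dom)//.
have pae : ae_eq mu setT (Radon_Nikodym_SigmaFinite.f nu mu) (EFin \o p).
  apply: integral_ae_eq => //.
  - exact: Radon_Nikodym_SigmaFinite.f_integrable.
  - exact/measurable_EFinP.
  - move=> E _ mE; rewrite -Radon_Nikodym_SigmaFinite.f_integral//.
    exact: nuE.
have mRN : measurable_fun setT (Radon_Nikodym_SigmaFinite.f nu mu).
  exact: measurable_int (Radon_Nikodym_SigmaFinite.f_integrable nu_dom).
apply: ae_eq_integral => //.
- exact: emeasurable_funM.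
- by apply: emeasurable_funM => //; exact/measurable_EFinP.
- by apply: filterS pae => x + _; move=> /(_ I) /= ->.
Qed.

End density.

Section expectation_toolbox.
Context dT {T : measurableType dT} {R : realType}.
Variable m : {measure set T -> \bar R}.
Implicit Types f g : T -> R.

Definition itg f := m.-integrable setT (EFin \o f).

Lemma itg_meas f : itg f -> measurable_fun setT f.
Proof. by move=> /measurable_int/measurable_EFinP. Qed.

Lemma itgD f g : itg f -> itg g -> itg (fun x => f x + g x).
Proof. by move=> fi gi; have := integrableD measurableT fi gi. Qed.

Lemma itgB f g : itg f -> itg g -> itg (fun x => f x - g x).
Proof. by move=> fi gi; have := integrableB measurableT fi gi. Qed.

Lemma itgZ k f : itg f -> itg (fun x => k * f x).
Proof. by move=> fi; have := integrableZl measurableT k fi. Qed.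

Lemma itg_le g f : measurable_fun setT f -> itg g ->
  (forall x, `|f x| <= g x) -> itg f.
Proof.
move=> mf gi fg; apply: le_integrable gi => //; first exact/measurable_EFinP.
by move=> x _ /=; rewrite lee_fin (le_trans (fg x))// ler_norm.
Qed.

Lemma itg_sum (I : finType) (F : I -> T -> R) :
  (forall i, itg (F i)) -> itg (fun x => \sum_i F i x).
Proof.
move=> Fi; rewrite /itg (_ : _ \o _ = (fun x => \sum_i (F i x)%:E)%E).
  by apply: integrable_sum => // i _; exact: Fi.
by apply/funext => x; rewrite /= sumEFin.
Qed.

Definition Ex f : R := \int[m]_x f x.

Lemma ExD f g : itg f -> itg g -> Ex (fun x => f x + g x) = Ex f + Ex g.
Proof. exact: RintegralD. Qed.

Lemma ExB f g : itg f -> itg g -> Ex (fun x => f x - g x) = Ex f - Ex g.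
Proof. exact: RintegralB. Qed.

Lemma ExZ k f : itg f -> Ex (fun x => k * f x) = k * Ex f.
Proof. exact: RintegralZl. Qed.

Lemma Ex_le f g : itg f -> itg g -> (forall x, f x <= g x) -> Ex f <= Ex g.
Proof. by move=> fi gi fg; apply: le_Rintegral => // x _. Qed.

Lemma Ex_ge0 f : (forall x, 0 <= f x) -> 0 <= Ex f.
Proof. by move=> f0; apply: Rintegral_ge0 => x _. Qed.

Lemma Ex_norm f : itg f -> `|Ex f| <= Ex (fun x => `|f x|).
Proof. exact: le_normr_Rintegral. Qed.

Lemma Ex_eq f g : f =1 g -> Ex f = Ex g.
Proof. by move=> /funext ->. Qed.

Lemma Ex_EFin f : itg f -> (\int[m]_x (f x)%:E)%E = (Ex f)%:E.
Proof. by move=> fi; rewrite /Ex /Rintegral fineK//; exact: integrable_fin_num fi. Qed.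

Lemma Ex_sum (I : finType) (F : I -> T -> R) : (forall i, itg (F i)) ->
  Ex (fun x => \sum_i F i x) = \sum_i Ex (F i).
Proof.
move=> Fi; apply: EFin_inj; rewrite -Ex_EFin; last exact: itg_sum.
under eq_integral do rewrite -sumEFin.
rewrite integral_sum//; first by rewrite -sumEFin; apply: eq_bigr => i _; rewrite Ex_EFin.
Qed.

Lemma Ex_CS f g : measurable_fun setT f -> measurable_fun setT g ->
  itg (fun x => f x ^+ 2) -> itg (fun x => g x ^+ 2) ->
  itg (fun x => f x * g x) /\
  Ex (fun x => f x * g x) ^+ 2 <= Ex (fun x => f x ^+ 2) * Ex (fun x => g x ^+ 2).
Proof.
move=> mf mg f2 g2.
have fgi : itg (fun x => f x * g x).
  apply: (itg_le (g := fun x => f x ^+ 2 + g x ^+ 2)); last 1 first.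
  - move=> x; rewrite ler_norml; apply/andP; split; nra.
  - exact: measurable_funM.
  - exact: itgD.
split=> //.
set A := Ex (fun x => f x ^+ 2); set B := Ex (fun x => g x ^+ 2); set C := Ex _.
(* The polynomial [E (f - t g)^2] in [t] is nonnegative; its value at the minimum [C / B] gives the
   inequality. *)
have q t : 0 <= A - 2 * t * C + t ^+ 2 * B.
  rewrite /A /B /C -!ExZ// -ExB ?(itgZ _ fgi)// -ExD ?(itgB _ (itgZ _ fgi))//; last first.
    exact: itgZ.
  by apply: Ex_ge0 => x; rewrite (_ : _ + _ = (f x - t * g x) ^+ 2) ?sqr_ge0//; ring.
have B0 : 0 <= B by apply: Ex_ge0 => x; rewrite sqr_ge0.
have [B00|Bn0] := eqVneq B 0.
  have [->|C0] := eqVneq C 0; first by rewrite B00 expr0n mulr0.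
  (* For [B = 0] the polynomial is affine in [t], and at this [t] it would equal -1. *)
  have := q ((A + 1) / (2 * C)); rewrite B00 mulr0 addr0.
  rewrite (_ : 2 * _ * C = A + 1); last by field.
  by rewrite opprD addrA subrr add0r oppr_ge0 ler10.
have Bp : 0 < B by rewrite lt_def Bn0.
have := q (C / B).
rewrite (_ : _ + _ = (A * B - C ^+ 2) / B); last by field.
by rewrite pmulr_lge0 ?invr_gt0// subr_ge0.
Qed.

End expectation_toolbox.

Section density_expectation.
Context dT {T : measurableType dT} {R : realType}.
Variables (nu : {finite_measure set T -> \bar R})
  (mu : {sigma_finite_measure set T -> \bar R}) (p : T -> R).
Hypothesis mp : measurable_fun setT p.
Hypothesis p0 : forall x, 0 <= p x.
Hypothesis nuE : forall A, measurable A -> nu A = (\int[mu]_(x in A) (p x)%:E)%E.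

Lemma itg_density f : measurable_fun setT f ->
  itg nu f <-> itg mu (fun x => f x * p x).
Proof.
move=> mf; have mfp := measurable_funM mf mp.
have e : (\int[nu]_x `|(f x)%:E| = \int[mu]_x `|(f x * p x)%:E|)%E.
  rewrite (ge0_integral_density mp nuE)//; last first.
    by apply: (@measurableT_comp _ _ _ _ _ _ abse _ (EFin \o f)) => //; exact/measurable_EFinP.
  by apply: eq_integral => x _; rewrite EFinM abseM (gee0_abs (p0 x : (0 <= (p x)%:E)%E)).
split=> /integrableP[_ H]; apply/integrableP; split.
- exact/measurable_EFinP.
- by rewrite -e.
- exact/measurable_EFinP.
- by rewrite e.
Qed.

Lemma Ex_density f : itg nu f -> Ex nu f = Ex mu (fun x => f x * p x).
Proof.
move=> fi; have mf := itg_meas fi; congr fine.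
rewrite [LHS]integralE [RHS]integralE.
have mE : measurable_fun setT (EFin \o f) by exact/measurable_EFinP.
congr (_ - _)%E; rewrite (ge0_integral_density mp nuE)//.
- by apply: eq_integral => x _; rewrite !funeposE /= EFinM maxe_pMl ?lee_fin// mul0e.
- exact: measurable_funepos.
- apply: eq_integral => x _.
  by rewrite !funenegE /= -mulNr EFinM maxe_pMl ?lee_fin// mul0e.
- exact: measurable_funeneg.
Qed.

End density_expectation.

Section probability_toolbox.
Context dT {T : measurableType dT} {R : realType}.
Variable m : probability T R.
Implicit Types f g : T -> R.

Definition bdm f := measurable_fun setT f /\ exists M : R, forall x, `|f x| <= M.

Lemma itg_cst (k : R) : itg m (cst k).
Proof. exact: finite_measure_integrable_cst. Qed.

Lemma bdm_itg f : bdm f -> itg m f.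
Proof. by move=> [mf [M fM]]; apply: (itg_le mf (itg_cst M)). Qed.

Lemma Ex_cst (k : R) : Ex m (fun=> k) = k.
Proof. by rewrite /Ex Rintegral_cst// [X in fine X](_ : _ = 1%E) ?mulr1//; exact: probability_setT. Qed.

Lemma Ex_indic (A : set T) : measurable A -> itg m (\1_A) /\ Ex m (\1_A) = fine (m A).
Proof.
move=> mA; split; last by rewrite /Ex /Rintegral integral_indic// setIT.
apply: bdm_itg; split; first exact: measurable_indic.
by exists 1 => x; rewrite ger0_norm ?ler1n//= indicE; case: (_ \in _).
Qed.

Lemma Ex_bnd f M : measurable_fun setT f -> (forall x, `|f x| <= M) -> `|Ex m f| <= M.
Proof.
move=> mf fM; have fi : itg m f by apply: bdm_itg; split=> //; exists M.
apply: (le_trans (Ex_norm fi)); rewrite -[leRHS]Ex_cst.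
by apply: Ex_le => //; [exact: integrable_norm|exact: itg_cst].
Qed.

Definition Var f := Ex m (fun x => f x ^+ 2) - Ex m f ^+ 2.

Lemma VarE f k : itg m f -> itg m (fun x => f x ^+ 2) ->
  Ex m (fun x => (f x - k) ^+ 2) = Var f + (Ex m f - k) ^+ 2.
Proof.
move=> f1 f2; rewrite /Var.
rewrite (@Ex_eq _ _ _ _ _ (fun x => f x ^+ 2 - (2 * k) * f x + k ^+ 2)); last first.
  by move=> x; ring.
have i1 : itg m (fun x => 2 * k * f x) by exact: itgZ.
have i2 := itgB f2 i1.
have i3 : itg m (fun=> k ^+ 2) by exact: itg_cst.
by rewrite (ExD i2 i3) (ExB f2 i1) (ExZ _ f1) Ex_cst; ring.
Qed.

Lemma Var_ge0 f : itg m f -> itg m (fun x => f x ^+ 2) -> 0 <= Var f.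
Proof.
move=> f1 f2; have := VarE (Ex m f) f1 f2; rewrite subrr expr0n addr0 => <-.
by apply: Ex_ge0 => x; rewrite sqr_ge0.
Qed.

Lemma Var_le f k : itg m f -> itg m (fun x => f x ^+ 2) ->
  Var f <= Ex m (fun x => (f x - k) ^+ 2).
Proof. by move=> f1 f2; rewrite VarE// lerDl sqr_ge0. Qed.

End probability_toolbox.

Section image_measures.
Context d1 d2 (T1 : measurableType d1) (T2 : measurableType d2) (R : realType).
Variables (f : T1 -> T2) (mf : measurable_fun setT f).

Definition image_measure (m : {measure set T1 -> \bar R}) : {measure set T2 -> \bar R} :=
  measure_function_pushforward__canonical__measure_function_Measure m mf.

Lemma ge0_integral_image (m : {measure set T1 -> \bar R}) (g : T2 -> \bar R) :
  measurable_fun setT g -> (forall y, 0 <= g y)%E ->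
  (\int[image_measure m]_y g y = \int[m]_x g (f x))%E.
Proof. by move=> mg g0; rewrite [LHS](ge0_integral_pushforward mf). Qed.

Variable m : probability T1 R.

Let image_setT : image_measure m setT = 1%E.
Proof. by rewrite /= /pushforward preimage_setT probability_setT. Qed.

Definition image_prob : set T2 -> \bar R := image_measure m.
HB.instance Definition _ := Measure.on image_prob.
HB.instance Definition _ := @Measure_isProbability.Build _ _ R image_prob image_setT.

Lemma image_itg g : measurable_fun setT g -> itg image_prob g -> itg m (g \o f).
Proof.
move=> mg /integrableP[_]; rewrite [ltLHS](ge0_integral_pushforward mf)//; last first.
  by apply: (@measurableT_comp _ _ _ _ _ _ abse _ (EFin \o g)) => //; exact/measurable_EFinP.
move=> H; apply/integrableP; split => //; apply/measurable_EFinP.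
exact: measurableT_comp.
Qed.

Lemma Ex_image g : measurable_fun setT g -> itg m (g \o f) ->
  Ex image_prob g = Ex m (g \o f).
Proof.
move=> mg gf; congr fine; rewrite [LHS](integral_pushforward mf)//.
exact/measurable_EFinP.
Qed.

End image_measures.

Lemma Ex_eq_measure dT (T : measurableType dT) (R : realType)
    (m1 m2 : {measure set T -> \bar R}) f :
  (forall A, measurable A -> m1 A = m2 A) -> Ex m1 f = Ex m2 f.
Proof. by move=> m12; congr fine; apply: eq_measure_integral => A mA _; exact: m12. Qed.

Lemma itg_eq_measure dT (T : measurableType dT) (R : realType)
    (m1 m2 : {measure set T -> \bar R}) f :
  (forall A, measurable A -> m1 A = m2 A) -> itg m1 f -> itg m2 f.
Proof.
move=> m12 /integrableP[mf H]; apply/integrableP; split => //.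
rewrite (_ : (\int[m2]_x _)%E = (\int[m1]_x `|(f x)%:E|)%E)//.
by apply: eq_measure_integral => A mA _; exact/esym/m12.
Qed.

(** * Gaussian measures *)

Section lebesgue_isometries.
Context {R : realType}.
Local Open Scope ereal_scope.
Notation lam := (@lebesgue_measure R).

(** Two measures that agree on half-open intervals coincide, so only lengths are compared; a
    reflection exchanges the closed end and the open one. *)
Lemma lebesgue_measure_reflect_translate (s a : R) (A : set (measurableTypeR R)) :
  (s = 1 \/ s = -1)%R -> measurable A ->
  lam [set x | A (s * x + a)%R] = lam A.
Proof.
move=> s1 mA.
have mf : measurable_fun setT (fun x : measurableTypeR R => (s * x + a)%R : measurableTypeR R).
  by apply: measurable_funD => //; exact: measurable_funM.
suff : forall X, ocitv X -> lam X = image_measure mf lam X.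
  by move=> /lebesgue_measure_unique/(_ _ mA) ->.
move=> _ [[b c] /= _ <-]; rewrite /pushforward.
case: s1 => {mf} ->.
  rewrite (_ : _ @^-1` _ = `](b - a)%R, (c - a)%R]%classic); last first.
    by apply/seteqP; split => x /=; rewrite !in_itv /= mul1r => /andP[? ?]; apply/andP; split; lra.
  rewrite !lebesgue_measure_itv /= !lte_fin ltrD2r.
  by case: ifP => // _; rewrite -!EFinB; congr EFin; ring.
rewrite (_ : _ @^-1` _ = `[(a - c)%R, (a - b)%R[%classic); last first.
  by apply/seteqP; split => x /=; rewrite !in_itv /= mulN1r => /andP[? ?]; apply/andP; split; lra.
rewrite !lebesgue_measure_itv /= !lte_fin ltrD2l ltrN2.
by case: ifP => // _; rewrite -!EFinB; congr EFin; ring.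
Qed.

(** The map acts on each coordinate separately, so its effect on a product measure is determined on
    rectangles and the coordinates are peeled off by induction. *)
Lemma lebesgue_Rd_reflect_translate d (s : R) (a : 'rV[R]_d) (A : set (Rd R d)) :
  (s = 1 \/ s = -1)%R -> measurable A ->
  lebesgue_Rd d [set x | A (s *: (x : 'rV[R]_d) + a)%R] = lebesgue_Rd d A.
Proof.
move=> s1; elim: d a A => [|d IH] a A mA.
  by congr (_ _); apply/funext => x /=; congr (A _); apply/rowP => -[].
pose a0 := a 0%R ord0; pose a' : 'rV[R]_d := (\row_j a 0 (lift ord0 j))%R.
pose h (p : measurableTypeR R * Rd R d) : measurableTypeR R * Rd R d :=
  ((s * p.1 + a0)%R, (s *: (p.2 : 'rV[R]_d) + a')%R : Rd R d).
have mh1 : measurable_fun setT (fun x : measurableTypeR R => (s * x + a0)%R : measurableTypeR R).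
  by apply: measurable_funD => //; exact: measurable_funM.
have mh2 : measurable_fun setT (fun v : Rd R d => (s *: (v : 'rV[R]_d) + a')%R : Rd R d).
  by apply: measurable_RdD => //; apply: measurable_RdZ.
have mh : measurable_fun setT h.
  by apply/measurable_fun_pairP; split; [exact: (measurableT_comp mh1 measurable_fst)|
    exact: (measurableT_comp mh2 measurable_snd)].
rewrite /= /lebesgue_Rd_succ /pushforward.
have mA' : measurable (@Rd_cons R d @^-1` A).
  by rewrite -[X in measurable X]setTI; exact: measurable_Rd_cons.
have hE p : Rd_cons (h p) = (s *: (Rd_cons p : 'rV[R]_d.+1) + a)%R.
  apply/rowP => i; rewrite /Rd_cons !mxE.
  by case: unliftP => [j ->|->]; rewrite /= ?mxE.
transitivity (image_measure mh (lam \x lebesgue_Rd d) (@Rd_cons R d @^-1` A)).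
  by rewrite /= /pushforward; congr (_ _); apply/funext => p; rewrite /preimage /= hE.
suff pE : forall B C, measurable B -> measurable C ->
    image_measure mh (lam \x lebesgue_Rd d) (B `*` C) = lam B * lebesgue_Rd d C.
  by rewrite -(product_measure_unique (m1 := lam) (m2 := lebesgue_Rd d) pE).
move=> B C mB mC /=.
rewrite /pushforward.
rewrite [X in _ X = _](_ : _ = [set x : measurableTypeR R | B (s * x + a0)%R] `*`
   [set v : Rd R d | C (s *: (v : 'rV[R]_d) + a')%R]); last by [].
rewrite product_measure1E//; last 2 first.
- by rewrite -[X in measurable X]setTI; exact: mh1.
- by rewrite -[X in measurable X]setTI; exact: mh2.
congr (_ * _); first exact: (lebesgue_measure_reflect_translate a0 s1 mB).
exact: IH.
Qed.

Lemma ge0_integral_Rd_isometry d (s : R) (a : 'rV[R]_d) (f : Rd R d -> \bar R) :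
  (s = 1 \/ s = -1)%R -> measurable_fun setT f -> (forall x, 0 <= f x) ->
  \int[lebesgue_Rd d]_x f (s *: (x : 'rV[R]_d) + a)%R = \int[lebesgue_Rd d]_x f x.
Proof.
move=> s1 mf f0; pose h (v : Rd R d) : Rd R d := (s *: (v : 'rV[R]_d) + a)%R.
have mh : measurable_fun setT h by apply: measurable_RdD => //; apply: measurable_RdZ.
rewrite -(ge0_integral_image mh)//.
by apply: eq_measure_integral => A mA _; exact: lebesgue_Rd_reflect_translate.
Qed.

Lemma ge0_integral_Rd_cons d (f : Rd R d.+1 -> \bar R) :
  measurable_fun setT f -> (forall x, 0 <= f x) ->
  \int[lebesgue_Rd d.+1]_x f x = \int[lam]_x \int[lebesgue_Rd d]_v f (Rd_cons (x, v)).
Proof.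
move=> mf f0; rewrite [LHS](ge0_integral_pushforward (phi := @Rd_cons R d))//.
  rewrite fubini_tonelli1// => [|x]; last exact: f0.
  by apply: measurableT_comp => //; exact: measurable_Rd_cons.
exact: measurable_Rd_cons.
Qed.

End lebesgue_isometries.

Section gauss.
Context {R : realType}.
Local Notation lam := (@lebesgue_measure R).

Definition gpdf d (h : R) (v : 'rV[R]_d) : R := \prod_i normal_pdf 0 (Num.sqrt h) (v 0 i).

Lemma gpdf_ge0 d h (v : 'rV[R]_d) : 0 <= gpdf h v.
Proof. by apply: prodr_ge0 => i _; exact: normal_pdf_ge0. Qed.

Lemma measurable_gpdf d h : measurable_fun setT (@gpdf d h : Rd R d -> R).
Proof.
apply: measurable_prod => i _.
apply: measurableT_comp; [exact: measurable_normal_pdf|exact: measurable_coord].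
Qed.

Lemma gpdf_cons d h (x : R) (v : 'rV[R]_d) :
  gpdf h (Rd_cons (x, v)) = normal_pdf 0 (Num.sqrt h) x * gpdf h v.
Proof.
rewrite /gpdf big_ord_recl Rd_cons0; congr (_ * _).
by apply: eq_bigr => i _; rewrite Rd_consS.
Qed.

Definition gauss d (h : R) (A : set (Rd R d)) : \bar R :=
  (\int[lebesgue_Rd d]_(x in A) (gpdf h (x : 'rV[R]_d))%:E)%E.

(** Boxes are the sets on which the definition of Brownian motion prescribes the law of an
    increment, so this formula is what identifies that law with [gauss]. One coordinate is
    integrated out at a time. *)
Lemma gauss_box d h (A : 'I_d -> set R) : (forall i, measurable (A i)) ->
  gauss h ([set v | forall i, A i ((v : 'rV[R]_d) 0 i)] : set (Rd R d)) =
  (\prod_i normal_prob 0 (Num.sqrt h) (A i))%E.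
Proof.
rewrite /gauss; elim: d A => [|d IH] A mA.
  have -> : ([set v | forall i, A i ((v : 'rV[R]_0) 0 i)] : set (Rd R 0)) = setT.
    by apply/seteqP; split => // v _ i; have := ltn_ord i; rewrite ltn0.
  have mE : measurable_fun setT (EFin \o (@gpdf 0 h : Rd R 0 -> R)).
    by apply/measurable_EFinP; exact: measurable_gpdf.
  by rewrite big_ord0 /= integral_dirac// diracE in_setT mul1e /gpdf big_ord0.
rewrite big_ord_recl -IH; last by move=> i; exact: mA.
have mB := @measurable_Rd_box R d.+1 A mA.
have mB' := @measurable_Rd_box R d (fun i => A (lift ord0 i)) (fun i => mA (lift ord0 i)).
rewrite integral_mkcond ge0_integral_Rd_cons; last 2 first.
- apply: (measurable_restrictT _ mB).1.
  by apply/measurable_EFinP; apply: measurable_funTS; exact: measurable_gpdf.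
- by move=> x; apply: erestrict_ge0 => y _; rewrite lee_fin gpdf_ge0.
set B' := [set v | _] in mB' *.
set I' := (\int[lebesgue_Rd d]_(x in B') _)%E.
transitivity (\int[lam]_(x in A ord0) ((normal_pdf 0 (Num.sqrt h) x)%:E * I'))%E.
  rewrite [RHS]integral_mkcond; apply: eq_integral => x _.
  rewrite patchE; case: ifPn => [/set_mem xA|xA].
    rewrite /I' -ge0_integralZl//; last 3 first.
    - by apply/measurable_EFinP; apply: measurable_funTS; exact: measurable_gpdf.
    - by move=> y _; rewrite lee_fin gpdf_ge0.
    - by rewrite lee_fin normal_pdf_ge0.
    rewrite [RHS]integral_mkcond; apply: eq_integral => v _; rewrite !patchE.
    rewrite (_ : (Rd_cons (x, v) \in _) = (v \in B')).
      by case: ifP => // _; rewrite gpdf_cons EFinM.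
    apply/idP/idP => /set_mem H; apply/mem_set => i /=.
      by have := H (lift ord0 i); rewrite Rd_consS.
    by case: (unliftP ord0 i) => [j|] ->; rewrite ?Rd_cons0 ?Rd_consS//; exact: H.
  apply: integral0_eq => v _; rewrite patchE ifF//; apply/negbTE; apply: contra xA.
  by move=> /set_mem /(_ ord0); rewrite Rd_cons0 => ?; exact/mem_set.
rewrite ge0_integralZr//.
- exact: mA.
- by apply/measurable_EFinP; apply: measurable_funTS; exact: measurable_normal_pdf.
- by move=> x _; rewrite lee_fin normal_pdf_ge0.
- by apply: integral_ge0 => x _; rewrite lee_fin gpdf_ge0.
Qed.

Lemma gauss_setT d h : @gauss d h setT = 1%E.
Proof.
have := @gauss_box d h (fun=> setT) (fun=> measurableT).
rewrite [X in gauss _ X](_ : _ = setT); last by apply/seteqP.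
by move=> ->; rewrite big1// => i _; exact: (@probability_setT _ _ _ (normal_prob 0 (Num.sqrt h))).
Qed.

Let gauss0 d h : @gauss d h set0 = 0%E.
Proof. by rewrite /gauss integral_set0. Qed.

Let gauss_ge0 d h A : (0 <= @gauss d h A)%E.
Proof. by apply: integral_ge0 => x _; rewrite lee_fin gpdf_ge0. Qed.

Let gauss_sigma_additive d h : semi_sigma_additive (@gauss d h).
Proof.
move=> /= A mA tA mUA; rewrite /gauss ge0_integral_bigcup//=.
- apply: is_cvg_ereal_nneg_natsum_cond => n _ _.
  by apply: integral_ge0 => /= x _; rewrite lee_fin gpdf_ge0.
- have mE : measurable_fun setT (EFin \o (@gpdf d h : Rd R d -> R)).
    by apply/measurable_EFinP; exact: measurable_gpdf.
  exact: measurable_funTS mE.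
- by move=> x _; rewrite lee_fin gpdf_ge0.
Qed.

HB.instance Definition _ d h := isMeasure.Build _ _ _
  (@gauss d h) (@gauss0 d h) (@gauss_ge0 d h) (@gauss_sigma_additive d h).

HB.instance Definition _ d h :=
  @Measure_isProbability.Build _ _ R (@gauss d h) (gauss_setT d h).

End gauss.

Section gpdf_theory.
Context {R : realType} {d : nat}.
Implicit Types (h : R) (v b y z : 'rV[R]_d).

Lemma gpdfE h v : 0 < h ->
  gpdf h v = normal_peak (Num.sqrt h) ^+ d * expR (- sqnorm v / (2 * h)).
Proof.
move=> h0; rewrite /gpdf.
under eq_bigr do rewrite normal_pdfE ?gt_eqF ?sqrtr_gt0//.
rewrite big_split /= prodr_const card_ord; congr (_ * _).
rewrite -expR_sum; congr expR.
rewrite /sqnorm mulNr mulr_suml -sumrN.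
apply: eq_bigr => i _.
by rewrite subr0 sqr_sqrtr ?ltW// -mulr_natl mulNr.
Qed.

Lemma gpdf_shift h v b : 0 < h ->
  gpdf h (v - b) = expR (dot b v / h - sqnorm b / (2 * h)) * gpdf h v.
Proof.
move=> h0; rewrite !gpdfE// mulrCA; congr (_ * _); rewrite -expRD; congr expR.
by rewrite sqnormB (dotC b); field; rewrite gt_eqF.
Qed.

Lemma gpdfN h v : 0 < h -> gpdf h (- v) = gpdf h v.
Proof. by move=> h0; rewrite !gpdfE// /sqnorm; under eq_bigr do rewrite mxE sqrrN. Qed.

(** Completing the square: [|z - y|^2 + |y|^2 = |z|^2 / 2 + 2 |y - z / 2|^2]. The second factor
    integrates to one in [y], which yields the convolution rule. *)
Lemma gpdf_conv h z y : 0 < h ->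
  gpdf h (z - y) * gpdf h y = gpdf (2 * h) z * gpdf (h / 2) (y - 2^-1 *: z).
Proof.
move=> h0; have h20 : 0 < 2 * h by lra.
have h21 : 0 < h / 2 by lra.
rewrite !gpdfE// mulrACA [RHS]mulrACA -!exprMn -!expRD; congr (_ ^+ _ * expR _).
  rewrite /normal_peak -!invfM !sqr_sqrtr ?ltW//.
  rewrite -!sqrtrM; last 2 first.
  - by rewrite mulrn_wge0// mulr_ge0 ?pi_ge0// ltW.
  - by rewrite mulrn_wge0// mulr_ge0 ?pi_ge0// ltW.
  by congr (Num.sqrt _)^-1; field.
by rewrite !sqnormB sqnormZ dotZr (dotC y); field; rewrite gt_eqF.
Qed.

End gpdf_theory.

(** * One-step Gaussian noise: shifts, symmetry and convolution *)

Section noise.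
Context {R : realType}.

Lemma gaussE d h (A : set (Rd R d)) :
  gauss h A = (\int[lebesgue_Rd d]_(x in A) (gpdf h (x : 'rV[R]_d))%:E)%E.
Proof. by []. Qed.

Lemma measurable_scale d (k : R) :
  measurable_fun setT (fun v : Rd R d => (k *: (v : 'rV[R]_d)) : Rd R d).
Proof. exact: measurable_RdZ. Qed.

Lemma measurable_translate d (a : 'rV[R]_d) :
  measurable_fun setT (fun v : Rd R d => ((v : 'rV[R]_d) + a) : Rd R d).
Proof. by apply: measurable_RdD. Qed.

(* the law of sqrt 2 (B_{s+h} - B_s) *)
Definition noise d (h : R) : probability (Rd R d) R :=
  image_prob (@measurable_scale d (Num.sqrt 2)) (@gauss R d h).
Arguments noise : clear implicits.

Variable (d : nat).
Implicit Types (h : R) (a y : 'rV[R]_d).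

Lemma ge0_integral_noise h (f : Rd R d -> \bar R) : measurable_fun setT f ->
  (forall y, 0 <= f y)%E ->
  (\int[noise d h]_y f y =
   \int[lebesgue_Rd d]_y (f (Num.sqrt 2 *: (y : 'rV[R]_d)) * (gpdf h (y : 'rV[R]_d))%:E))%E.
Proof.
move=> mf f0; rewrite [LHS]ge0_integral_image//.
rewrite (ge0_integral_density (@measurable_gpdf R d h) (fun A _ => gaussE h A))//.
  by apply: (measurableT_comp mf); exact: measurable_scale.
exact: measurable_scale.
Qed.

(** Cameron-Martin density: the law of [Y + a] against that of [Y], where [Y] is the noise, of
    covariance [2 h] times the identity. *)
Definition cmw h a y : R := expR (dot a y / (2 * h) - sqnorm a / (4 * h)).

Lemma measurable_cmw h a : measurable_fun setT (cmw h a : Rd R d -> R).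
Proof.
apply: measurableT_comp => //; apply: measurable_funB => //; apply: measurable_funM => //.
apply: continuous_measurable_Rd; exact: elip_continuous (dot_elip a).
Qed.

Lemma ge0_integral_noise_translate h a (f : Rd R d -> \bar R) : 0 < h ->
  measurable_fun setT f -> (forall y, 0 <= f y)%E ->
  (\int[noise d h]_y f ((y : 'rV[R]_d) + a)%R = \int[noise d h]_y (f y * (cmw h a y)%:E))%E.
Proof.
move=> h0 mf f0.
have mfa : measurable_fun setT (fun y : Rd R d => f ((y : 'rV[R]_d) + a)).
  by apply: (measurableT_comp mf); exact: measurable_translate.
have mw : measurable_fun setT (fun y : Rd R d => (cmw h a y)%:E).
  by apply/measurable_EFinP; exact: measurable_cmw.
rewrite !ge0_integral_noise//; last 2 first.
- exact: emeasurable_funM.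
- by move=> y; rewrite mule_ge0// lee_fin expR_ge0.
pose b := (Num.sqrt 2)^-1 *: a.
have s2 : Num.sqrt 2 != 0 :> R by rewrite gt_eqF// sqrtr_gt0.
have s22 : Num.sqrt 2 ^+ 2 = 2 :> R by rewrite sqr_sqrtr.
rewrite -(ge0_integral_Rd_isometry (s := 1) (- b)); last 3 first.
- by left.
- apply: emeasurable_funM.
    by apply: (measurableT_comp mfa); exact: measurable_scale.
  by apply/measurable_EFinP; exact: measurable_gpdf.
- by move=> y; rewrite mule_ge0// lee_fin gpdf_ge0.
apply: eq_integral => y _.
rewrite scale1r scalerBr /b !scalerA (mulfV s2) scale1r subrK -muleA -EFinM; congr (_ * (_)%:E)%E.
rewrite gpdf_shift//; congr (expR _ * _).
rewrite dotZl dotZr sqnormZ exprVn s22.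
have -> : (Num.sqrt 2)^-1 = Num.sqrt 2 / 2 :> R.
  by apply: (mulfI s2); rewrite mulfV// mulrA -expr2 s22 divff.
by field; rewrite gt_eqF.
Qed.

(** By the nonnegative case applied to indicators, the translated law has density [cmw h a]; signed
    integrands follow from the general change of density. *)
Lemma noise_translate h a (f : Rd R d -> R) : 0 < h -> measurable_fun setT f ->
  itg (noise d h) (fun y => f y * cmw h a y) ->
  itg (noise d h) (fun y => f ((y : 'rV[R]_d) + a)) /\
  Ex (noise d h) (fun y => f ((y : 'rV[R]_d) + a)) = Ex (noise d h) (fun y => f y * cmw h a y).
Proof.
move=> h0 mf fi.
pose nu := image_prob (measurable_translate a) (noise d h).
have nuE A : measurable A -> nu A = (\int[noise d h]_(x in A) (cmw h a x)%:E)%E.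
  move=> mA.
  have m1 : measurable_fun setT (EFin \o \1_A : Rd R d -> \bar R).
    exact/measurable_EFinP/measurable_indic.
  have i0 y : (0 <= (EFin \o \1_A : Rd R d -> \bar R) y)%E by rewrite lee_fin.
  transitivity (\int[nu]_y (\1_A y)%:E)%E; first by rewrite integral_indic// setIT.
  transitivity (\int[noise d h]_y ((EFin \o \1_A) ((y : 'rV[R]_d) + a)%R))%E.
    exact: (ge0_integral_image (measurable_translate a) (noise d h) m1 i0).
  rewrite ge0_integral_noise_translate//.
  rewrite [RHS]integral_mkcond; apply: eq_integral => y _.
  by rewrite patchE /= indicE; case: (y \in A); rewrite ?mul1e ?mul0e.
have nuf : itg nu f by apply: (itg_density (measurable_cmw h a) (fun x => expR_ge0 _) nuE mf).2 fi.
split; first exact: (image_itg (f := fun v : Rd R d => ((v : 'rV[R]_d) + a) : Rd R d) mf nuf).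
rewrite -(Ex_density (measurable_cmw h a) (fun x => expR_ge0 _) nuE nuf) [RHS]Ex_image//.
exact: image_itg mf nuf.
Qed.

Lemma measurable_opp : measurable_fun setT (fun v : Rd R d => (- (v : 'rV[R]_d)) : Rd R d).
Proof.
by under eq_fun do rewrite -scaleN1r; exact: measurable_RdZ.
Qed.

Lemma noise_opp_measure h (A : set (Rd R d)) : 0 < h -> measurable A ->
  noise d h A = image_prob measurable_opp (noise d h) A.
Proof.
move=> h0 mA.
have m1 : measurable_fun setT (EFin \o \1_A : Rd R d -> \bar R).
  exact/measurable_EFinP/measurable_indic.
have i0 y : (0 <= (EFin \o \1_A : Rd R d -> \bar R) y)%E by rewrite lee_fin.
have m2 : measurable_fun setT (fun y : Rd R d => (\1_A (- (y : 'rV[R]_d) : Rd R d))%:E : \bar R).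
  by apply: (measurableT_comp m1); exact: measurable_opp.
transitivity (\int[noise d h]_y (\1_A y)%:E)%E; first by rewrite integral_indic// setIT.
transitivity (\int[noise d h]_y (\1_A (- (y : 'rV[R]_d) : Rd R d))%:E)%E; last first.
  transitivity (\int[image_prob measurable_opp (noise d h)]_y (\1_A y)%:E)%E; last first.
    by rewrite integral_indic// setIT.
  exact/esym/(ge0_integral_image measurable_opp (noise d h) m1 i0).
rewrite !ge0_integral_noise//.
rewrite -(ge0_integral_Rd_isometry (s := -1) (0)); last 3 first.
- by right.
- apply: emeasurable_funM; last by apply/measurable_EFinP; exact: measurable_gpdf.
  by apply: (measurableT_comp m1); exact: measurable_scale.
- by move=> y; rewrite mule_ge0// lee_fin// gpdf_ge0.
apply: eq_integral => y _.
by rewrite addr0 scaleN1r gpdfN// scalerN.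
Qed.

Lemma noise_opp h (f : Rd R d -> R) : 0 < h -> measurable_fun setT f ->
  itg (noise d h) f ->
  itg (noise d h) (fun y => f (- (y : 'rV[R]_d))) /\
  Ex (noise d h) (fun y => f (- (y : 'rV[R]_d))) = Ex (noise d h) f.
Proof.
move=> h0 mf fi.
have nuE A (mA : measurable A) := noise_opp_measure h0 mA.
have fi' := itg_eq_measure nuE fi.
have fo := image_itg (f := fun v : Rd R d => (- (v : 'rV[R]_d)) : Rd R d) mf fi'.
split => //.
by rewrite [RHS](Ex_eq_measure f nuE) (Ex_image measurable_opp mf fo).
Qed.

(** Equal variances are what the later halving of time steps calls for. Once the inner variable is
    translated, [gpdf_conv] separates the integrand. *)
Lemma noise_conv h (f : Rd R d -> R) : 0 < h -> measurable_fun setT f ->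
  (forall x, 0 <= f x) ->
  (\int[noise d h]_y \int[noise d h]_z (f ((y : 'rV[R]_d) + z))%:E =
   \int[noise d (2 * h)]_y (f y)%:E)%E.
Proof.
move=> h0 mf f0.
have mE : measurable_fun setT (EFin \o f) by exact/measurable_EFinP.
have mE2 : measurable_fun setT (fun p : Rd R d * Rd R d => (f ((p.1 : 'rV[R]_d) + (p.2 : 'rV[R]_d)))%:E).
  apply: (measurableT_comp mE); apply: measurable_RdD; [exact: measurable_fst|exact: measurable_snd].
have mp := @measurable_gpdf R d.
have mpE k : measurable_fun setT (EFin \o (@gpdf R d k : Rd R d -> R)) by exact/measurable_EFinP.
pose s := Num.sqrt 2 : R.
pose G (x z : 'rV[R]_d) : \bar R := (f (s *: z) * gpdf h (z - x) * gpdf h x)%:E.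
have mG : measurable_fun setT (fun p : Rd R d * Rd R d => G p.1 p.2).
  apply/measurable_EFinP; apply: measurable_funM; first apply: measurable_funM.
  - apply: (measurableT_comp mf); apply: measurable_RdZ; exact: measurable_snd.
  - apply: (measurableT_comp (mp h)); apply: measurable_RdB; [exact: measurable_snd|exact: measurable_fst].
  - by apply: (measurableT_comp (mp h)); exact: measurable_fst.
transitivity (\int[lebesgue_Rd d]_x \int[lebesgue_Rd d]_z G x z)%E.
  rewrite ge0_integral_noise//; last 2 first.
  - have fE0 (p : Rd R d * Rd R d) : (0 <= (f ((p.1 : 'rV[R]_d) + (p.2 : 'rV[R]_d)))%:E)%E.
      by rewrite lee_fin.
    exact: (measurable_fun_fubini_tonelli_F (m2 := noise d h) _ mE2 fE0).
  - by move=> y; apply: integral_ge0 => z _; rewrite lee_fin.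
  apply: eq_integral => x _.
  have mx : measurable_fun setT (fun z : Rd R d => (f (s *: (x : 'rV[R]_d) + (z : 'rV[R]_d)))%:E).
    by apply: (measurableT_comp mE); apply: measurable_RdD.
  have mx2 := measurableT_comp mx (@measurable_scale d s).
  rewrite ge0_integral_noise//; last by move=> z; rewrite lee_fin.
  rewrite -ge0_integralZr//; last 3 first.
  - by apply: emeasurable_funM; [exact: mx2|exact: mpE].
  - by move=> z _; rewrite mule_ge0// lee_fin// gpdf_ge0.
  - by rewrite lee_fin gpdf_ge0.
  rewrite -[LHS](ge0_integral_Rd_isometry (s := 1) (- x)); last 3 first.
  - by left.
  - apply: emeasurable_funM; last exact: measurable_cst.
    by apply: emeasurable_funM; [exact: mx2|exact: mpE].
  - by move=> y; rewrite !mule_ge0// lee_fin// gpdf_ge0.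
  apply: eq_integral => z _.
  by rewrite scale1r -!EFinM /G -/s scalerBr addrC subrK.
have G0 (p : Rd R d * Rd R d) : (0 <= G p.1 p.2)%E.
  by rewrite lee_fin !mulr_ge0// gpdf_ge0.
rewrite (fubini_tonelli _ mG G0).
rewrite [RHS]ge0_integral_noise//.
apply: eq_integral => z _ /=.
transitivity (\int[lebesgue_Rd d]_x ((f (s *: (z : 'rV[R]_d)) * gpdf (2 * h) (z : 'rV[R]_d))%:E *
   (gpdf (h / 2) (1 *: (x : 'rV[R]_d) + - (2^-1 *: (z : 'rV[R]_d))))%:E))%E.
  by apply: eq_integral => x _; rewrite /G -mulrA gpdf_conv// mulrA EFinM scale1r.
rewrite ge0_integralZl//; last 3 first.
- apply: (measurableT_comp (mpE (h / 2))); apply: measurable_RdD => //.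
  exact: measurable_RdZ.
- by move=> x _; rewrite lee_fin gpdf_ge0.
- by rewrite lee_fin mulr_ge0// gpdf_ge0.
rewrite (ge0_integral_Rd_isometry (s := 1) (- (2^-1 *: (z : 'rV[R]_d)))
  (f := EFin \o @gpdf R d (h / 2))); last 3 first.
- by left.
- exact: mpE.
- by move=> x; rewrite lee_fin gpdf_ge0.
by rewrite [X in (_ * X)%E](_ : _ = 1%E) ?mule1 -?EFinM//; exact: (gauss_setT d (h / 2)).
Qed.

End noise.

(** * Exponential inequalities and moments of the noise *)

Section exp_inequalities.
Context {R : realType}.
Implicit Types x : R.

Lemma expR_ge_quadratic x : 0 <= x -> 1 + x + x ^+ 2 / 2 <= expR x.
Proof.
move=> x0; have nd : nondecreasing_seq (series (exp_coeff x)).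
  apply: nondecreasing_series => n _ _.
  by rewrite /exp_coeff /= divr_ge0// exprn_ge0.
have := nondecreasing_cvgn_le nd (is_cvg_series_exp_coeff x) 3%N.
rewrite /series /exp_coeff /= !big_nat_recr//= big_geq// add0r.
by rewrite expr0 expr1 !divr1 (_ : 2`!%:R = 2).
Qed.

(** With [u = x / 2] the right-hand side is the square of [exp u - exp (- u)], a difference that
    exceeds [2 u] by the quadratic lower bound on [exp u]. It turns exponential moments into second
    moments. *)
Lemma sqr_le_expRDexpRN x : x ^+ 2 <= expR x + expR (- x) - 2.
Proof.
wlog x0 : x / 0 <= x => [H|].
  have [/H//|x0] := leP 0 x.
  by have := H (- x); rewrite oppr_ge0 sqrrN opprK (addrC (expR (- x))); apply; exact: ltW.
pose u := x / 2; have u0 : 0 <= u by rewrite /u divr_ge0.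
pose A := 1 + u + u ^+ 2 / 2; have A1 : 1 <= A by rewrite /A; nra.
have Au : A <= expR u by exact: expR_ge_quadratic.
have e0 := expR_gt0 u.
have H : 2 * u <= expR u - (expR u)^-1.
  apply: (@le_trans _ _ (A - A^-1)).
    rewrite -(@ler_pM2r _ A) ?(lt_le_trans _ A1)// mulrBl mulVf ?gt_eqF ?(lt_le_trans _ A1)//.
    by rewrite /A; nra.
  by rewrite lerB// lef_pV2// posrE (lt_le_trans _ A1).
rewrite expRN (_ : x = u + u); last by rewrite /u; field.
rewrite expRD (_ : _ + _ - 2 = (expR u - (expR u)^-1) ^+ 2); last by field; rewrite gt_eqF.
by rewrite -mulr2n -mulr_natl lerXn2r ?nnegrE//; [rewrite mulr_ge0|rewrite (le_trans _ H)// mulr_ge0].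
Qed.

Lemma expR_sub1_le x : `|expR x - 1| <= `|x| * expR `|x|.
Proof.
have [x0|x0] := leP 0 x.
  rewrite ger0_norm ?(ger0_norm x0) ?subr_ge0; last by rewrite -expR0 ler_expR.
  have := expR_ge1Dx (- x); rewrite expRN => H.
  have e0 := expR_gt0 x.
  have : (1 - x) * expR x <= 1 by rewrite -[leRHS](mulVf (lt0r_neq0 e0)) ler_pM2r.
  lra.
rewrite (ltr0_norm x0) ler0_norm; last by rewrite subr_le0 expR_le1 ltW.
have := expR_ge1Dx x.
have e1 : 1 <= expR (- x) by rewrite -expR0 ler_expR oppr_ge0 ltW.
have : 0 <= - x * (expR (- x) - 1) by rewrite mulr_ge0// ?subr_ge0// oppr_ge0 ltW.
lra.
Qed.

Lemma expR_taylor1_le x : `|expR x - 1 - x| <= x ^+ 2 * expR `|x|.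
Proof.
rewrite ger0_norm; last by have := expR_ge1Dx x; lra.
apply: (@le_trans _ _ (x * (expR x - 1))).
  have := expR_ge1Dx (- x); rewrite expRN => H.
  have e0 := expR_gt0 x.
  have : (1 - x) * expR x <= 1 by rewrite -[leRHS](mulVf (lt0r_neq0 e0)) ler_pM2r.
  lra.
rewrite (le_trans (ler_norm _))// normrM -real_normK ?num_real// expr2 -mulrA.
by rewrite ler_wpM2l// expR_sub1_le.
Qed.

End exp_inequalities.

Section exponential_domination.
Context {R : realType} {d : nat}.
Implicit Types (h : R) (a b p : 'rV[R]_d) (w : 'rV[R]_d -> R).
Local Notation N h := (noise d h).

Lemma noise_cmw h a : 0 < h -> itg (N h) (cmw h a) /\ Ex (N h) (cmw h a) = 1.
Proof.
move=> h0.
have E : (\int[N h]_y (cmw h a y)%:E)%E = 1%E.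
  have := @ge0_integral_noise_translate R d h a (fun=> 1%E) h0 (measurable_cst _) (fun=> lee01).
  under [X in _ = X -> _]eq_integral do rewrite mul1e.
  rewrite integral_cst// mul1e => <-.
  by have H := @probability_setT _ _ _ (N h); apply: H.
have i : itg (N h) (cmw h a).
  apply/integrableP; split; first by apply/measurable_EFinP; exact: measurable_cmw.
  under eq_integral do rewrite gee0_abs ?lee_fin ?expR_ge0//.
  by rewrite E ltry.
by split=> //; rewrite /Ex /Rintegral E.
Qed.

(** For the shift [2 h b] the density [cmw] is [exp (b . y)] up to a constant, and a density has
    mass one. *)
Lemma noise_mgf h b : 0 < h -> itg (N h) (fun y => expR (dot b y)) /\
  Ex (N h) (fun y => expR (dot b y)) = expR (h * sqnorm b).
Proof.
move=> h0; have [i e] := noise_cmw (2 * h *: b) h0.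
have E : (fun y => expR (dot b y)) = (fun y => expR (h * sqnorm b) * cmw h (2 * h *: b) y).
  apply/funext => y; rewrite /cmw -expRD; congr expR.
  by rewrite dotZl sqnormZ; field; rewrite gt_eqF.
by rewrite E; split; [exact: itgZ|rewrite ExZ// e mulr1].
Qed.

(** [|y|] is at most [d] times its largest coordinate, whose absolute value is reached by one of the
    two signs. The bound is a sum of exponentials of linear forms, whose means are explicit. *)
Lemma expR_enorm_le (c : R) (y : 'rV[R]_d) : 0 <= c ->
  expR (c * enorm y) <= 1 + \sum_i (expR (dot ((c * d%:R) *: delta_mx 0 i) y) +
                                     expR (dot (- (c * d%:R) *: delta_mx 0 i) y)).
Proof.
move=> c0.
have [y0|y0] := eqVneq (mx_norm y) 0.
  rewrite {1}(mx_norm_eq0 y0) enorm0 mulr0 expR0 lerDl.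
  by apply: sumr_ge0 => i _; apply: addr_ge0; exact: expR_ge0.
have [[j i] /= yi] := mx_norm_neq0 y0; rewrite (ord1 j) in yi.
have yn : enorm y <= d%:R * `|y 0 i| by rewrite -yi; exact: enorm_le_mx_norm.
rewrite (bigD1 i)//=.
set S := (\sum_(_ | _) _).
have S0 : 0 <= S by apply: sumr_ge0 => k _; apply: addr_ge0; exact: expR_ge0.
rewrite !dotZl (dotC (delta_mx _ _)) dot_delta.
apply: (@le_trans _ _ (expR (c * d%:R * `|y 0 i|))).
  by rewrite ler_expR -mulrA ler_wpM2l.
have e1 := expR_ge0 (c * d%:R * y 0 i); have e2 := expR_ge0 (- (c * d%:R) * y 0 i).
have [yi0|yi0] := leP 0 (y 0 i); first by rewrite ger0_norm//; lra.
by rewrite ltr0_norm// mulrN -mulNr; lra.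
Qed.

Lemma measurable_enorm : measurable_fun setT (@enorm R d : Rd R d -> R).
Proof. by apply: continuous_measurable_Rd; exact: elip_continuous enorm_elip. Qed.

Lemma measurable_dot p : measurable_fun setT (dot p : Rd R d -> R).
Proof. by apply: continuous_measurable_Rd; exact: elip_continuous (dot_elip p). Qed.

Lemma itg_expR_enorm h (c : R) : 0 < h -> 0 <= c ->
  itg (N h) (fun y => expR (c * enorm y)).
Proof.
move=> h0 c0; apply: (@itg_le _ (Rd R d) R (N h) (fun y => 1 + \sum_i (expR (dot ((c * d%:R) *: delta_mx 0 i) y) +
                                     expR (dot (- (c * d%:R) *: delta_mx 0 i) y)))).
- apply: measurableT_comp => //; apply: measurable_funM => //; exact: measurable_enorm.
- apply: itgD; first exact: itg_cst.
  by apply: itg_sum => i; apply: itgD; exact: (noise_mgf _ h0).1.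
- by move=> y; rewrite ger0_norm ?expR_ge0// expR_enorm_le.
Qed.

(** At most exponential growth: a class stable under sums and products and integrable against every
    noise, so that integrability follows the syntax of the integrand. *)
Definition expdom w := measurable_fun setT (w : Rd R d -> R) /\
  exists C c : R, [/\ 0 <= C, 0 <= c & forall y, `|w y| <= C * expR (c * enorm y)].

Lemma expdom_itg h w : 0 < h -> expdom w -> itg (N h) w.
Proof.
move=> h0 [mw [C [c [C0 c0 H]]]].
by apply: (@itg_le _ (Rd R d) R (N h) (fun y => C * expR (c * enorm y))) => //; apply: itgZ; exact: itg_expR_enorm.
Qed.

Lemma expdomM w1 w2 : expdom w1 -> expdom w2 -> expdom (fun y => w1 y * w2 y).
Proof.
move=> [m1 [C1 [c1 [C10 c10 H1]]]] [m2 [C2 [c2 [C20 c20 H2]]]]; split.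
  exact: measurable_funM.
exists (C1 * C2), (c1 + c2); split; [exact: mulr_ge0|exact: addr_ge0|move=> y].
by rewrite normrM mulrDl expRD mulrACA ler_pM.
Qed.

Lemma expdomD w1 w2 : expdom w1 -> expdom w2 -> expdom (fun y => w1 y + w2 y).
Proof.
move=> [m1 [C1 [c1 [C10 c10 H1]]]] [m2 [C2 [c2 [C20 c20 H2]]]]; split.
  exact: measurable_funD.
exists (C1 + C2), (c1 + c2); split; [exact: addr_ge0|exact: addr_ge0|move=> y].
rewrite (le_trans (ler_normD _ _))// mulrDl lerD//.
  rewrite (le_trans (H1 y))// ler_wpM2l// ler_expR mulrDl lerDl mulr_ge0 ?enorm_ge0//.
rewrite (le_trans (H2 y))// ler_wpM2l// ler_expR mulrDl lerDr mulr_ge0 ?enorm_ge0//.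
Qed.

Lemma expdom_bounded w (C : R) : measurable_fun setT (w : Rd R d -> R) ->
  (forall y, `|w y| <= C) -> expdom w.
Proof.
move=> mw wC; split => //; exists `|C|, 0; split => // y.
by rewrite mul0r expR0 mulr1 (le_trans (wC y))// ler_norm.
Qed.

Lemma expdom_cst (k : R) : expdom (fun=> k).
Proof. by apply: (@expdom_bounded _ `|k|). Qed.

Lemma expdom_enorm : expdom enorm.
Proof.
split; first exact: measurable_enorm.
exists 1, 1; split => // y; rewrite !mul1r ger0_norm ?enorm_ge0//.
by rewrite (le_trans _ (expR_ge1Dx _))// lerDr.
Qed.

Lemma expdom_le w1 w2 : measurable_fun setT (w1 : Rd R d -> R) -> expdom w2 ->
  (forall y, `|w1 y| <= w2 y) -> expdom w1.
Proof.
move=> m1 [m2 [C [c [C0 c0 H]]]] w12; split => //; exists C, c; split => // y.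
by rewrite (le_trans (w12 y))// (le_trans (ler_norm _)).
Qed.

Lemma expdom_dot p : expdom (dot p).
Proof.
apply: (@expdom_le _ (fun y => enorm p * enorm y)); first exact: measurable_dot.
  by apply: expdomM; [exact: expdom_cst|exact: expdom_enorm].
by move=> y; exact: normr_dot_le.
Qed.

Lemma expdom_coord i : expdom (fun y => y 0 i).
Proof.
apply: (@expdom_le _ enorm); [exact: measurable_coord|exact: expdom_enorm|].
by move=> y; exact: coord_le_enorm.
Qed.

Lemma expdom_expR_enorm (c : R) : 0 <= c -> expdom (fun y => expR (c * enorm y)).
Proof.
move=> c0; split.
  by apply: measurableT_comp => //; apply: measurable_funM => //; exact: measurable_enorm.
by exists 1, c; split => // y; rewrite mul1r ger0_norm// expR_ge0.
Qed.

Lemma expdom_expR_dot p : expdom (fun y => expR (dot p y)).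
Proof.
apply: (@expdom_le _ (fun y => expR (enorm p * enorm y))).
- by apply: measurableT_comp => //; exact: measurable_dot.
- exact/expdom_expR_enorm/enorm_ge0.
- by move=> y; rewrite ger0_norm ?expR_ge0// ler_expR dot_le.
Qed.

Lemma expdomX w n : expdom w -> expdom (fun y => w y ^+ n).
Proof.
move=> ew; elim: n => [|n IH].
  by under eq_fun do rewrite expr0; exact: expdom_cst.
by under eq_fun do rewrite exprS; exact: expdomM.
Qed.

End exponential_domination.

Section noise_moments.
Context {R : realType} {d : nat}.
Implicit Types (h : R) (a b p : 'rV[R]_d).
Local Notation N h := (noise d h).

(** Lets [t] tend to zero. Most limits below are taken in this elementary form, with an error of
    first order in an auxiliary parameter. *)
Lemma le_small_slope (a b c : R) :
  (forall t, 0 < t -> t <= 1 -> a <= b + c * t) -> a <= b.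
Proof.
move=> H; rewrite leNgt; apply/negP => ba.
pose K := 2 * (`|c| + 1) + (a - b).
have c0 := normr_ge0 c; have cc := ler_norm c.
have K0 : 0 < K by rewrite /K; lra.
have t0 : 0 < (a - b) / K by rewrite divr_gt0// subr_gt0.
have t1 : (a - b) / K <= 1 by rewrite ler_pdivrMr// mul1r /K; lra.
have := H _ t0 t1; have e : (a - b) / K * K = a - b by field; rewrite gt_eqF.
move: t0 t1 e; set t := (a - b) / K => t0 t1 e.
have : c * t <= `|c| * t by rewrite ler_pM2r.
by rewrite /K in e; nra.
Qed.

Lemma noise_mean p h : 0 < h -> Ex (N h) (dot p) = 0.
Proof.
move=> h0; have := noise_opp h0 (@measurable_dot R d p) (expdom_itg h0 (expdom_dot p)).
move=> [_]; rewrite (@Ex_eq _ (Rd R d) R _ _ (fun y => -1 * dot p y)); last first.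
  by move=> y; rewrite dotNr mulN1r.
rewrite ExZ; last exact: expdom_itg (expdom_dot p).
lra.
Qed.

(** A second difference of the moment generating function at step [sqrt t]: the mean of
    [exp (l p . y) + exp (- l p . y) - 2] is [2 (exp (t K) - 1)], and dividing by [t] before letting
    it vanish leaves [2 K]. *)
Lemma noise_var_le p h : 0 < h -> Ex (N h) (fun y => dot p y ^+ 2) <= 2 * h * sqnorm p.
Proof.
move=> h0; set E := Ex _ _; set K := h * sqnorm p.
have K0 : 0 <= K by rewrite mulr_ge0 ?sqnorm_ge0// ltW.
apply: (@le_small_slope _ _ (2 * K * (K * expR K))) => t t0 t1.
pose l := Num.sqrt t; have l2 : l ^+ 2 = t by rewrite sqr_sqrtr// ltW.
have iN b := expdom_itg h0 (@expdom_expR_dot R d b).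
have : Ex (N h) (fun y => t * dot p y ^+ 2) <=
       Ex (N h) (fun y => expR (dot (l *: p) y) + expR (dot (- (l *: p)) y) - 2).
  apply: Ex_le.
  - by apply: itgZ; apply: expdom_itg => //; apply: expdomX; exact: expdom_dot.
  - by apply: itgB; [apply: itgD; exact: iN|exact: itg_cst].
  by move=> y; rewrite -l2 -exprMn -dotZl dotNl sqr_le_expRDexpRN.
rewrite ExZ; last by apply: expdom_itg => //; apply: expdomX; exact: expdom_dot.
rewrite ExB; [|by apply: itgD; exact: iN|exact: itg_cst].
rewrite ExD; [|exact: iN|exact: iN].
rewrite Ex_cst !(noise_mgf _ h0).2 -!dotvv dotNl dotNr opprK !dotvv sqnormZ l2 mulrCA -/K => H.
have H2 := expR_sub1_le (t * K).
have tK0 : 0 <= t * K by rewrite mulr_ge0// ltW.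
rewrite (ger0_norm tK0) in H2.
have H3 := le_trans (ler_norm _) H2.
have H4 : t * E <= t * (2 * K * expR (t * K)) by rewrite -/E in H; lra.
rewrite ler_pM2l// in H4.
have H5 : expR (t * K) <= expR K by rewrite ler_expR ler_piMl.
have H6 : expR (t * K) <= 1 + t * K * expR K.
  have : t * K * expR (t * K) <= t * K * expR K by rewrite ler_wpM2l.
  lra.
apply: (le_trans H4); have : 2 * K * expR (t * K) <= 2 * K * (1 + t * K * expR K).
  by rewrite ler_wpM2l// mulr_ge0.
by rewrite /K; lra.
Qed.

(** Scaling by [l = h^(-1/2)] makes the exponential moments of the coordinates independent of [h];
    undoing it on a fourth power produces [h^2]. *)
Lemma noise_moment4 : exists2 c : R, 0 < c &
  forall h, 0 < h -> Ex (N h) (fun y => enorm y ^+ 4) <= c * h ^+ 2.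
Proof.
exists (d%:R ^+ 4 * (48 * expR 1) * d%:R + 1).
  by rewrite ltr_wpDl// !mulr_ge0// expR_ge0.
move=> h h0; pose l := (Num.sqrt h)^-1.
have l0 : 0 < l by rewrite invr_gt0 sqrtr_gt0.
have l2 : l ^+ 2 = h^-1 by rewrite exprVn sqr_sqrtr// ltW.
pose e i : 'rV[R]_d := l *: delta_mx 0 i.
(* The term of order four in the exponential series, symmetrised in the sign of [x]. *)
have key (x : R) : x ^+ 4 <= 24 * (expR x + expR (- x)).
  have [x0|x0] := leP 0 x.
    have := @expR_ge1Dxn R x 3 x0; rewrite (_ : 4`!%:R = 24) //.
    by have := expR_ge0 (- x); lra.
  have := @expR_ge1Dxn R (- x) 3; rewrite oppr_ge0 (_ : 4`!%:R = 24) // => /(_ (ltW x0)).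
  rewrite (_ : (- x) ^+ 4 = x ^+ 4); last by ring.
  by have := expR_ge0 x; lra.
have iN b := expdom_itg h0 (@expdom_expR_dot R d b).
apply: (@le_trans _ _ (Ex (N h) (fun y => (d%:R ^+ 4 * 24 * h ^+ 2) *
    \sum_i (expR (dot (e i) y) + expR (dot (- e i) y))))).
  apply: Ex_le.
  - by apply: expdom_itg => //; apply: expdomX; exact: expdom_enorm.
  - by apply: itgZ; apply: itg_sum => i; apply: itgD; exact: iN.
  move=> y; have [y0|y0] := eqVneq (mx_norm y) 0.
    rewrite (_ : enorm y = 0) ?expr0n; last by rewrite (mx_norm_eq0 y0) enorm0.
    apply: mulr_ge0; first by rewrite !mulr_ge0// ?exprn_ge0// ltW.
    by apply: sumr_ge0 => i _; apply: addr_ge0; exact: expR_ge0.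
  have [[j i] /= yi] := mx_norm_neq0 y0; rewrite (ord1 j) in yi.
  have yn : enorm y <= d%:R * `|y 0 i| by rewrite -yi; exact: enorm_le_mx_norm.
  have := @lerXn2r R 4 _ _ (enorm_ge0 y) (mulr_ge0 (ler0n _ d) (normr_ge0 (y 0 i))) yn.
  move=> H; apply: (le_trans H); rewrite exprMn.
  rewrite (bigD1 i)//=; set S := (\sum_(_ | _) _).
  have S0 : 0 <= S by apply: sumr_ge0 => k _; apply: addr_ge0; exact: expR_ge0.
  have := key (dot (e i) y); rewrite -dotNl => H1.
  have Ee : dot (e i) y = l * y 0 i by rewrite dotZl dotC dot_delta.
  have -> : `|y 0 i| ^+ 4 = h ^+ 2 * dot (e i) y ^+ 4.
    rewrite Ee exprMn (_ : l ^+ 4 = (l ^+ 2) ^+ 2); last by ring.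
    rewrite l2 mulrA -exprMn mulfV ?gt_eqF// expr1n mul1r.
    by rewrite -[LHS]normrX ger0_norm// (_ : _ ^+ 4 = (y 0 i ^+ 2) ^+ 2) ?sqr_ge0//; ring.
  set A := (X in X + S) in H1 *.
  rewrite (_ : d%:R ^+ 4 * 24 * h ^+ 2 * (A + S) = d%:R ^+ 4 * (h ^+ 2 * (24 * (A + S)))); last by ring.
  apply: ler_wpM2l; first by rewrite exprn_ge0.
  apply: ler_wpM2l; first by rewrite exprn_ge0// ltW.
  by rewrite (le_trans H1)//; apply: ler_wpM2l => //; rewrite lerDl.
rewrite ExZ; last by apply: itg_sum => i; apply: itgD; exact: iN.
rewrite Ex_sum; last by move=> i; apply: itgD; exact: iN.
rewrite (eq_bigr (fun=> 2 * expR 1)); last first.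
  move=> i _; rewrite ExD ?(noise_mgf _ h0).2; [|exact: iN|exact: iN].
  rewrite -!dotvv dotNl dotNr opprK dotvv /e sqnormZ l2 -dotvv dot_delta mxE !eqxx mulr1.
  by rewrite mulfV ?gt_eqF//; ring.
rewrite sumr_const card_ord -[X in _ * X]mulr_natl.
rewrite [leLHS](_ : _ = d%:R ^+ 4 * (48 * expR 1) * d%:R * h ^+ 2); last by ring.
by rewrite ler_pM2r ?exprn_gt0// lerDl.
Qed.

(** Bessel's inequality for the linear functions of the noise. For [q = E (f Y)], centring gives
    [|q|^2 = E ((f - E f) (q . Y))]; Cauchy-Schwarz and the variance of [q . Y] conclude. *)
Lemma noise_bessel h (f : 'rV[R]_d -> R) (M : R) : 0 < h ->
  measurable_fun setT (f : Rd R d -> R) -> (forall y, `|f y| <= M) ->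
  sqnorm (\row_i Ex (N h) (fun y => f y * y 0 i)) <= 2 * h * Var (N h) f.
Proof.
move=> h0 mf fM; set q := (\row_i _).
have ef : expdom f by exact: expdom_bounded fM.
have fi := expdom_itg h0 ef.
have f2 : itg (N h) (fun x => f x ^+ 2) by apply: expdom_itg => //; exact: expdomX.
have dq : expdom (dot q) by exact: expdom_dot.
have qE : sqnorm q = Ex (N h) (fun y => (f y - Ex (N h) f) * dot q y).
  rewrite (@Ex_eq _ (Rd R d) R _ _ (fun y => f y * dot q y - Ex (N h) f * dot q y)); last first.
    by move=> y; rewrite mulrBl.
  rewrite ExB; last 2 first.
  - by apply: expdom_itg => //; exact: expdomM.
  - by apply: itgZ; exact: expdom_itg.
  rewrite ExZ ?noise_mean// ?mulr0 ?subr0; last exact: expdom_itg.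
  rewrite (@Ex_eq _ (Rd R d) R _ _ (fun y => \sum_i q 0 i * (f y * y 0 i))); last first.
    by move=> y; rewrite /dot mulr_sumr; apply: eq_bigr => i _; ring.
  have fy i : itg (N h) (fun y => f y * y 0 i).
    by apply: expdom_itg => //; apply: expdomM => //; exact: expdom_coord.
  rewrite Ex_sum; last by move=> i; exact: itgZ.
  by apply: eq_bigr => i _; rewrite ExZ// expr2; congr (_ * _); rewrite mxE.
have mq := @measurable_dot R d q.
have mfc : measurable_fun setT (fun y : Rd R d => f y - Ex (N h) f) by exact: measurable_funB.
have efc : expdom (fun y => f y - Ex (N h) f).
  by apply: expdomD => //; exact: expdom_cst.
have [_] := Ex_CS mfc mq (expdom_itg h0 (expdomX 2 efc)) (expdom_itg h0 (expdomX 2 dq)).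
rewrite -qE VarE// subrr expr0n addr0 => H.
have V0 := Var_ge0 fi f2.
have [q0|q0] := eqVneq (sqnorm q) 0; first by rewrite q0 !mulr_ge0// ltW.
have qp : 0 < sqnorm q by rewrite lt_def q0 sqnorm_ge0.
rewrite -(ler_pM2r qp) -expr2 (le_trans H)// mulrC mulrAC.
rewrite mulrC [leRHS]mulrC ler_wpM2l//.
exact: noise_var_le.
Qed.

End noise_moments.

(** * The heat semigroup *)

Section bounded_fubini.
Context d1 d2 {T1 : measurableType d1} {T2 : measurableType d2} {R : realType}.
Variables (m1 : probability T1 R) (m2 : probability T2 R) (F : T1 * T2 -> R) (M : R).
Hypothesis mF : measurable_fun setT F.
Hypothesis FM : forall p, `|F p| <= M.

Lemma bounded_slice1 x : measurable_fun setT (fun y => F (x, y)).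
Proof. by apply: (measurableT_comp mF); exact: measurable_pair1. Qed.

Lemma bounded_slice2 y : measurable_fun setT (fun x => F (x, y)).
Proof. by apply: (measurableT_comp mF); exact: measurable_pair2. Qed.

Let iF : (m1 \x m2)%E.-integrable setT (EFin \o F).
Proof.
have fin : ((m1 \x m2)%E setT < +oo)%E.
  rewrite -setXTT product_measure1E//.
  have H1 := @probability_setT _ _ _ m1; have H2 := @probability_setT _ _ _ m2.
  by rewrite [X in (X * _)%E](_ : _ = 1%E)// mul1e [X in (X < _)%E](_ : _ = 1%E)// ltry.
apply: measurable_bounded_integrable => //.
exists M; split; first exact: num_real.
by move=> x Mx p _ /=; rewrite (le_trans (FM p))// ltW.
Qed.

Let i1 x : itg m2 (fun y => F (x, y)).
Proof. by apply: bdm_itg; split; [exact: bounded_slice1|exists M]. Qed.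

Let i2 y : itg m1 (fun x => F (x, y)).
Proof. by apply: bdm_itg; split; [exact: bounded_slice2|exists M]. Qed.

Lemma Ex_fubini : Ex m1 (fun x => Ex m2 (fun y => F (x, y))) =
                  Ex m2 (fun y => Ex m1 (fun x => F (x, y))).
Proof.
congr fine; under eq_integral do rewrite -Ex_EFin//.
under [RHS]eq_integral do rewrite -Ex_EFin//.
exact: (Fubini iF).
Qed.

Lemma Ex_prod : Ex (m1 \x m2)%E F = Ex m1 (fun x => Ex m2 (fun y => F (x, y))).
Proof.
congr fine; under [RHS]eq_integral do rewrite -Ex_EFin//.
by rewrite -(integral12_prod_meas1 iF).
Qed.

End bounded_fubini.

Section heat.
Context {R : realType} {d : nat}.
Implicit Types (h L : R) (a b p x : 'rV[R]_d) (u f g : 'rV[R]_d -> R).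
Local Notation N h := (noise d h).

Definition BL L f := (forall x, 0 <= f x <= 1) /\ elip L f.

Lemma BL_meas L f : BL L f -> measurable_fun setT (f : Rd R d -> R).
Proof. by move=> [_ /elip_continuous]; exact: continuous_measurable_Rd. Qed.

Lemma BL_norm L f x : BL L f -> `|f x| <= 1.
Proof. by move=> [/(_ x)/andP[f0 f1] _]; rewrite ger0_norm. Qed.

Lemma BL_shift L f a : BL L f -> BL L (fun y => f (a + y)).
Proof.
move=> [f01 fL]; split => [x//|x y].
by rewrite (le_trans (fL _ _))// (_ : a + x - (a + y) = x - y)// opprD addrACA subrr add0r.
Qed.

Lemma BL_itg L f (m : probability (Rd R d) R) : BL L f -> itg m f.
Proof. by move=> fL; apply: bdm_itg; split; [exact: BL_meas fL|exists 1 => x; exact: BL_norm fL]. Qed.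

Lemma BL_cst L (k : R) : 0 <= L -> 0 <= k <= 1 -> BL L (fun=> k).
Proof. by move=> L0 k01; split => // x y; rewrite subrr normr0 mulr_ge0// enorm_ge0. Qed.

Lemma BL_M L1 L2 f g : BL L1 f -> BL L2 g -> BL (L1 + L2) (fun x => f x * g x).
Proof.
move=> [f01 fL] [g01 gL]; split => [x|x y].
  have /andP[f0 f1] := f01 x; have /andP[g0 g1] := g01 x.
  by rewrite mulr_ge0//= mulr_ile1.
rewrite (_ : _ - _ = f x * (g x - g y) + g y * (f x - f y)); last by ring.
have /andP[f0 f1] := f01 x; have /andP[g0 g1] := g01 y.
rewrite (le_trans (ler_normD _ _))// !normrM (ger0_norm f0) (ger0_norm g0) mulrDl addrC.
have := fL x y; have := gL x y.
have n1 := normr_ge0 (f x - f y); have n2 := normr_ge0 (g x - g y).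
nra.
Qed.

Lemma BL_sqr L f : BL L f -> BL (2 * L) (fun x => f x ^+ 2).
Proof. by move=> fL; rewrite (_ : 2 * L = L + L); [exact: BL_M|ring]. Qed.

Lemma BL_le L1 L2 f : L1 <= L2 -> BL L1 f -> BL L2 f.
Proof.
move=> L12 [f01 fL]; split => // x y.
by rewrite (le_trans (fL x y))// ler_wpM2r// enorm_ge0.
Qed.

Lemma BL_compl L f : BL L f -> BL L (fun x => 1 - f x).
Proof.
move=> [f01 fL]; split => [x|x y]; first by have := f01 x; lra.
by rewrite (_ : _ - _ = f y - f x) 1?enormC//; ring.
Qed.

Lemma BL_itg_sqr L f (m : probability (Rd R d) R) : BL L f -> itg m (fun x => f x ^+ 2).
Proof. by move=> /BL_sqr/BL_itg; exact. Qed.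

Lemma BL_comp L f (J : 'rV[R]_d -> 'rV[R]_d) : 0 <= L ->
  (forall x y, enorm (J x - J y) <= enorm (x - y)) -> BL L f -> BL L (f \o J).
Proof.
move=> L0 HJ [f01 fL]; split => [x|x y] /=; first exact: f01.
by rewrite (le_trans (fL _ _))// ler_wpM2l.
Qed.

Definition heat h u x := Ex (N h) (fun y => u (x + y)).
(** Gaussian integration by parts: the gradient of [heat h u] written without a derivative of [u],
    which is merely Lipschitz. *)
Definition grad_heat h u x : 'rV[R]_d :=
  \row_i ((2 * h)^-1 * Ex (N h) (fun y => u (x + y) * y 0 i)).

Lemma heat_BL h L u : BL L u -> BL L (heat h u).
Proof.
move=> uL; have H x := BL_shift x uL; split => [x|x y].
  apply/andP; split.
    by apply: Ex_ge0 => y; case: uL => + _ => /(_ (x + y))/andP[].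
  rewrite -(Ex_cst (N h) 1); apply: Ex_le; [exact: BL_itg (H x)|exact: itg_cst|].
  by move=> y; case: uL => + _ => /(_ (x + y))/andP[].
rewrite /heat -ExB; [|exact: BL_itg (H x)|exact: BL_itg (H y)].
apply: Ex_bnd => [|z].
  by apply: measurable_funB; [exact: BL_meas (H x)|exact: BL_meas (H y)].
have [_ /(_ (x + z) (y + z))] := uL.
by rewrite (_ : x + z - (y + z) = x - y)// opprD addrACA subrr addr0.
Qed.

Lemma expdom_BL L u : BL L u -> expdom u.
Proof. by move=> uL; apply: (@expdom_bounded _ _ _ 1) => [|y]; [exact: BL_meas uL|exact: BL_norm uL]. Qed.

Lemma dot_grad_heat h L u x a : 0 < h -> BL L u ->
  dot (grad_heat h u x) a = Ex (N h) (fun y => u (x + y) * (dot a y / (2 * h))).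
Proof.
move=> h0 uL; have ux := expdom_BL (BL_shift x uL).
have i1 i : itg (N h) (fun y => u (x + y) * y 0 i).
  by apply: expdom_itg => //; apply: expdomM => //; exact: expdom_coord.
rewrite (@Ex_eq _ (Rd R d) R _ _ (fun y => \sum_i (a 0 i / (2 * h)) * (u (x + y) * y 0 i))); last first.
  move=> y; rewrite /dot mulr_suml mulr_sumr; apply: eq_bigr => i _.
  by field; rewrite gt_eqF.
rewrite Ex_sum; last by move=> i; exact: itgZ.
by apply: eq_bigr => i _; rewrite mxE ExZ//; ring.
Qed.

(** Mean of a bound on the second-order remainder in [a] of the density [cmw h a], valid for
    [|a| <= 1] and divided by [|a|^2]. *)
Definition heat_rem h : R := Ex (N h) (fun y =>
  ((4 * h)^-1 + enorm y ^+ 2 / (4 * h ^+ 2)) * expR ((2 * h)^-1 * enorm y)).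

Let rem_expdom h : 0 < h -> expdom (fun y : 'rV[R]_d =>
  ((4 * h)^-1 + enorm y ^+ 2 / (4 * h ^+ 2)) * expR ((2 * h)^-1 * enorm y)).
Proof.
move=> h0; apply: expdomM; last first.
  by apply: expdom_expR_enorm; rewrite invr_ge0 mulr_ge0// ltW.
apply: expdomD; first exact: expdom_cst.
apply: expdomM; last exact: expdom_cst.
exact: expdomX expdom_enorm.
Qed.

(** The increment [a] is moved from [u], which need not be differentiable, to the Gaussian density,
    which is then expanded at [a = 0]. *)
Lemma heat_taylor1 h L u x a : 0 < h -> BL L u -> enorm a <= 1 ->
  `|heat h u (x + a) - heat h u x - dot (grad_heat h u x) a| <= heat_rem h * sqnorm a.
Proof.
move=> h0 uL a1; have ux := expdom_BL (BL_shift x uL).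
have mux := BL_meas (BL_shift x uL).
have cmwE y : cmw h a y = expR (- (sqnorm a / (4 * h))) * expR (dot ((2 * h)^-1 *: a) y).
  by rewrite /cmw -expRD dotZl; congr expR; ring.
have ecmw : expdom (cmw h a).
  rewrite (_ : cmw h a = (fun y => expR (- (sqnorm a / (4 * h))) * expR (dot ((2 * h)^-1 *: a) y))).
    by apply: expdomM; [exact: expdom_cst|exact: expdom_expR_dot].
  by apply/funext => y; exact: cmwE.
have i1 : itg (N h) (fun y => u (x + y) * cmw h a y).
  by apply: expdom_itg => //; exact: expdomM.
have [_ e1] := noise_translate h0 mux i1.
have -> : heat h u (x + a) = Ex (N h) (fun y => u (x + y) * cmw h a y).
  by rewrite -e1; apply: (@Ex_eq _ (Rd R d) R) => y; rewrite addrA addrAC.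
have ed : expdom (fun y => u (x + y) * (dot a y / (2 * h))).
  apply: expdomM => //; apply: expdomM; [exact: expdom_dot|exact: expdom_cst].
rewrite (dot_grad_heat _ _ h0 uL) -ExB//; last exact: expdom_itg.
rewrite -ExB; [|exact: itgB i1 (expdom_itg h0 ux)|exact: expdom_itg].
have rhs : itg (N h) (fun y => sqnorm a * (((4 * h)^-1 + enorm y ^+ 2 / (4 * h ^+ 2)) * expR ((2 * h)^-1 * enorm y))).
  by apply: itgZ; apply: expdom_itg => //; exact: rem_expdom.
have lhs : itg (N h) (fun y => u (x + y) * cmw h a y - u (x + y) - u (x + y) * (dot a y / (2 * h))).
  by apply: itgB; [exact: itgB i1 (expdom_itg h0 ux)|exact: expdom_itg].
rewrite (le_trans (Ex_norm lhs))// [leRHS]mulrC /heat_rem -ExZ; last by apply: expdom_itg => //; exact: rem_expdom.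
apply: Ex_le => //; first exact: integrable_norm.
move=> y; rewrite (_ : _ - _ - _ = u (x + y) * (cmw h a y - 1 - dot a y / (2 * h))); last by ring.
rewrite normrM (le_trans (ler_piMl _ (BL_norm _ uL)))//.
set s := dot a y / (2 * h); set c := sqnorm a / (4 * h).
have c0 : 0 <= c by rewrite divr_ge0 ?sqnorm_ge0// mulr_ge0// ltW.
have cmwE2 : cmw h a y = expR s * expR (- c) by rewrite -expRD.
have es0 := expR_ge0 s; have ec := expR_ge1Dx (- c).
have ec1 : expR (- c) <= 1 by rewrite expR_le1 oppr_le0.
have ss : `|s| <= (2 * h)^-1 * enorm y.
  have hi : 0 <= (2 * h)^-1 by rewrite invr_ge0 mulr_ge0// ltW.
  rewrite /s normrM (ger0_norm hi) [leLHS]mulrC.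
  apply: ler_wpM2l; first by rewrite invr_ge0 mulr_ge0// ltW.
  by rewrite (le_trans (normr_dot_le _ _))// ler_piMl// enorm_ge0.
have s2 : s ^+ 2 <= sqnorm a * (enorm y ^+ 2 / (4 * h ^+ 2)).
  rewrite /s exprMn exprVn (_ : (2 * h) ^+ 2 = 4 * h ^+ 2); last by ring.
  rewrite mulrA ler_pM2r ?invr_gt0 ?mulr_gt0 ?exprn_gt0//.
  rewrite -enorm_sqr -exprMn -[leLHS]real_normK ?num_real// lerXn2r ?nnegrE ?mulr_ge0 ?enorm_ge0//.
  exact: normr_dot_le.
have ee : expR `|s| <= expR ((2 * h)^-1 * enorm y) by rewrite ler_expR.
have es : expR s <= expR `|s| by rewrite ler_expR ler_norm.
have T := expR_taylor1_le s.
rewrite cmwE2 (_ : _ - 1 - s = (expR s - 1 - s) + expR s * (expR (- c) - 1)); last by ring.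
rewrite (le_trans (ler_normD _ _))// normrM (ger0_norm es0) (ler0_norm (x := expR (- c) - 1)) ?subr_le0//.
set E := expR (_ * enorm y) in ee *.
rewrite (_ : sqnorm a * _ = sqnorm a * (enorm y ^+ 2 / (4 * h ^+ 2)) * E + c * E); last first.
  by rewrite /c; ring.
apply: lerD.
  by rewrite (le_trans T)// ler_pM ?sqr_ge0// expR_ge0.
rewrite mulrC ler_pM//; [lra|lra|exact: le_trans es ee].
Qed.

(** Expanding along the gradient [p] itself, with an increment of length [t], compares [t |p|] with
    the Lipschitz bound [t L] up to order [t^2]. *)
Lemma enorm_grad_heat h L u x : 0 <= L -> 0 < h -> BL L u -> enorm (grad_heat h u x) <= L.
Proof.
move=> L0 h0 uL; set p := grad_heat h u x.
have [p0|p0] := eqVneq (enorm p) 0; first by rewrite p0.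
have pp : 0 < enorm p by rewrite lt_def p0 enorm_ge0.
apply: (@le_small_slope _ _ _ (heat_rem h)) => t t0 t1.
pose a := (t / enorm p) *: p.
have a1 : enorm a = t by rewrite enormZ normrM normfV !ger0_norm ?enorm_ge0 ?ltW// divfK.
have := @heat_taylor1 h L u x a h0 uL; rewrite a1 => /(_ t1).
have dp : dot p a = t * enorm p by rewrite dotZr dotvv -enorm_sqr; field.
rewrite -/p dp -enorm_sqr a1.
have [_ /(_ (x + a) x)] := heat_BL h uL; rewrite addrAC subrr add0r a1 => H1 H2.
have := ler_normB (heat h u (x + a) - heat h u x) (heat h u (x + a) - heat h u x - t * enorm p).
rewrite opprD addrA subrr add0r opprK (ger0_norm (mulr_ge0 (ltW t0) (ltW pp))) => H3.
have : t * enorm p <= t * (L + heat_rem h * t) by lra.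
by rewrite ler_pM2l.
Qed.

Lemma heat_rem_ge0 h : 0 < h -> 0 <= heat_rem h.
Proof.
move=> h0; apply: Ex_ge0 => y; rewrite mulr_ge0 ?expR_ge0// addr_ge0//.
  by rewrite invr_ge0 mulr_ge0// ltW.
by rewrite divr_ge0 ?sqr_ge0// mulr_ge0// sqr_ge0.
Qed.

(** Beyond [|a| = 1] the Lipschitz bounds already give [2 L |a|], hence the additional [2 L] in
    front of [|a|^2]. *)
Lemma heat_taylor h L u x a : 0 <= L -> 0 < h -> BL L u ->
  `|heat h u (x + a) - heat h u x - dot (grad_heat h u x) a| <= (heat_rem h + 2 * L) * sqnorm a.
Proof.
move=> L0 h0 uL; have r0 := heat_rem_ge0 h0.
have [a1|a1] := leP (enorm a) 1.
  rewrite (le_trans (heat_taylor1 x h0 uL a1))// ler_wpM2r ?sqnorm_ge0//.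
  by rewrite lerDl mulr_ge0.
have [_ /(_ (x + a) x)] := heat_BL h uL; rewrite addrAC subrr add0r => H1.
have H2 := normr_dot_le (grad_heat h u x) a.
have H3 := enorm_grad_heat x L0 h0 uL.
rewrite (le_trans (ler_normB _ _))//.
have e0 := enorm_ge0 a.
have H4 : enorm (grad_heat h u x) * enorm a <= L * enorm a by rewrite ler_wpM2r.
have H5 : enorm a <= sqnorm a by rewrite -enorm_sqr expr2 ler_peMl// ltW.
have H6 : L * enorm a <= L * sqnorm a by rewrite ler_wpM2l.
have H7 : 0 <= heat_rem h * sqnorm a by rewrite mulr_ge0 ?sqnorm_ge0.
lra.
Qed.

End heat.

(** * Local Poincare inequality for the Gaussian noise *)

Section gaussian_poincare.
Context {R : realType} {d : nat}.
Implicit Types (h L : R) (a b p x : 'rV[R]_d) (u f g : 'rV[R]_d -> R).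
Local Notation N h := (noise d h).

(** Truncation at the typical size [t = sqrt h]: above it, [|y|] is at most [t^-3 |y|^4]. *)
Lemma noise_moment1 : exists2 c : R, 0 < c &
  forall h, 0 < h -> Ex (N h) enorm <= c * Num.sqrt h.
Proof.
have [c c0 H] := @noise_moment4 R d; exists (1 + c) => [|h h0]; first lra.
pose t := Num.sqrt h; have t0 : 0 < t by rewrite sqrtr_gt0.
have t2 : t ^+ 2 = h by rewrite sqr_sqrtr// ltW.
have i4 : itg (N h) (fun y => t ^- 3 * enorm y ^+ 4).
  by apply: itgZ; apply: expdom_itg => //; apply: expdomX; exact: expdom_enorm.
apply: (@le_trans _ _ (Ex (N h) (fun y => t + t ^- 3 * enorm y ^+ 4))).
  apply: Ex_le.
  - exact: expdom_itg expdom_enorm.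
  - by apply: itgD => //; exact: itg_cst.
  move=> y; have e0 := enorm_ge0 y; have [yt|yt] := leP (enorm y) t.
    by rewrite ler_wpDr// mulr_ge0 ?exprn_ge0// invr_ge0 exprn_ge0// ltW.
  rewrite ler_wpDl ?(ltW t0)// mulrC ler_pdivlMr ?exprn_gt0// [leRHS]exprS ler_pM2l ?(lt_trans t0)//.
  by rewrite lerXn2r ?nnegrE// ltW.
rewrite ExD; [|exact: itg_cst|exact: i4].
rewrite Ex_cst ExZ; last first.
  by apply: expdom_itg => //; apply: expdomX; exact: expdom_enorm.
rewrite mulrDl mul1r lerD2l mulrC ler_pdivrMr ?exprn_gt0//.
rewrite (le_trans (H _ h0))// -/t -t2.
by rewrite [leRHS](_ : _ = c * (t ^+ 2) ^+ 2)//; ring.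
Qed.

Lemma heat_dist : exists2 c : R, 0 < c &
  forall h L u x, 0 < h -> 0 <= L -> BL L u -> `|heat h u x - u x| <= L * (c * Num.sqrt h).
Proof.
have [c c0 H] := noise_moment1; exists c => // h L u x h0 L0 uL.
have ux := BL_shift x uL.
rewrite -[X in _ - X](Ex_cst (N h)) /heat -ExB; [|exact: BL_itg ux|exact: itg_cst].
have i : itg (N h) (fun y => u (x + y) - u x).
  by apply: itgB; [exact: BL_itg ux|exact: itg_cst].
rewrite (le_trans (Ex_norm i))//.
apply: (@le_trans _ _ (Ex (N h) (fun y => L * enorm y))).
  apply: Ex_le; first exact: integrable_norm.
    by apply: itgZ; exact: expdom_itg expdom_enorm.
  by move=> y; case: uL => _ /(_ (x + y) x); rewrite addrAC subrr add0r.
by rewrite ExZ ?ler_wpM2l ?H//; exact: expdom_itg expdom_enorm.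
Qed.

Lemma heat_double h L u x : 0 < h -> BL L u -> heat (2 * h) u x = heat h (heat h u) x.
Proof.
move=> h0 uL; have ux := BL_shift x uL.
have f0 y : 0 <= u (x + y) by case: uL => + _ => /(_ (x + y))/andP[].
have E1 := @noise_conv R d h (fun y => u (x + y)) h0 (BL_meas ux) f0.
have E2 : (\int[N h]_y \int[N h]_z (u (x + ((y : 'rV[R]_d) + z)))%:E =
           \int[N h]_y (heat h u (x + (y : 'rV[R]_d)))%:E)%E.
  apply: eq_integral => y _.
  rewrite -[RHS]Ex_EFin; last exact: BL_itg (BL_shift (x + y) uL).
  by apply: eq_integral => z _; rewrite addrA.
apply: EFin_inj; rewrite -[RHS]Ex_EFin; last exact: BL_itg (BL_shift x (heat_BL h uL)).
have E3 := Ex_EFin (BL_itg (N (2 * h)) ux).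
exact: (etrans (esym E3) (etrans (esym E1) E2)).
Qed.

Lemma measurable_add3 x :
  measurable_fun setT (fun p : Rd R d * Rd R d => (x + (p.1 : 'rV[R]_d) + (p.2 : 'rV[R]_d)) : Rd R d).
Proof.
apply: measurable_RdD; last exact: measurable_snd.
by apply: measurable_RdD => //; exact: measurable_fst.
Qed.

Lemma heat_comm h k L u x : BL L u -> heat h (heat k u) x = heat k (heat h u) x.
Proof.
move=> uL; pose F (p : Rd R d * Rd R d) := u (x + (p.1 : 'rV[R]_d) + (p.2 : 'rV[R]_d)).
have mF : measurable_fun setT F by apply: (measurableT_comp (BL_meas uL)); exact: measurable_add3.
have F1 (q : Rd R d * Rd R d) : `|F q| <= 1 by exact: BL_norm uL.
rewrite [LHS](Ex_fubini (N h) (N k) mF F1); apply: (@Ex_eq _ (Rd R d) R) => y.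
by apply: (@Ex_eq _ (Rd R d) R) => z; rewrite /F /= addrAC.
Qed.

Definition heat_var h u x := heat h (fun y => u y ^+ 2) x - heat h u x ^+ 2.

Lemma heat_varE h u x : heat_var h u x = Var (N h) (fun y => u (x + y)).
Proof. by []. Qed.

(** Law of total variance for a time [2 h] split into two independent halves. *)
Lemma heat_var_double h L u x : 0 < h -> BL L u ->
  heat_var (2 * h) u x = Ex (N h) (fun y => heat_var h u (x + y)) + heat_var h (heat h u) x.
Proof.
move=> h0 uL; have u2 := BL_sqr uL.
rewrite /heat_var (heat_double _ h0 uL) (heat_double _ h0 u2).
have i1 := BL_itg (N h) (BL_shift x (heat_BL h u2)).
have i2 := BL_itg_sqr (N h) (BL_shift x (heat_BL h uL)).
by rewrite ExB// /heat; ring.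
Qed.

(** Expansion around [x]: the linear part contributes at most [2 h L^2], the remainder is of order
    [h^(3/2)]. The constant depends on the smoothing time [e] and on [L], not on [u] or [x], so that
    the bound can be iterated. *)
Lemma heat_var_smooth_small e L : 0 < e -> 0 <= L -> exists2 K : R, 0 <= K &
  forall h u x, 0 < h -> h <= 1 -> BL L u ->
    heat_var h (heat e u) x <= 2 * h * L ^+ 2 + K * (h * Num.sqrt h).
Proof.
move=> e0 L0; have [c c0 H4] := @noise_moment4 R d.
pose M := heat_rem (d := d) e + 2 * L.
have M0 : 0 <= M by rewrite addr_ge0 ?heat_rem_ge0// mulr_ge0.
exists (2 * L ^+ 2 + 2 * (M ^+ 2 * c)) => [|h u x h0 h1 uL].
  by rewrite addr_ge0// !mulr_ge0 ?sqr_ge0// ltW.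
set t := Num.sqrt h; have t0 : 0 < t by rewrite sqrtr_gt0.
have t2 : t ^+ 2 = h by rewrite sqr_sqrtr// ltW.
have t1 : t <= 1 by rewrite -sqrtr1 ler_sqrt.
have wL := heat_BL e uL; set w := heat e u in wL *.
have wx := BL_shift x wL.
rewrite heat_varE; apply: (le_trans (Var_le (w x) (BL_itg _ wx) (BL_itg_sqr _ wx))).
set p := grad_heat e u x.
have pL : enorm p <= L by exact: enorm_grad_heat uL.
have ed : expdom (fun y => (1 + t) * dot p y ^+ 2).
  by apply: expdomM; [exact: expdom_cst|apply: expdomX; exact: expdom_dot].
have e4 : expdom (fun y : 'rV[R]_d => (1 + t^-1) * M ^+ 2 * enorm y ^+ 4).
  by apply: expdomM; [exact: expdom_cst|apply: expdomX; exact: expdom_enorm].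
apply: (@le_trans _ _ (Ex (N h) (fun y => (1 + t) * dot p y ^+ 2 + (1 + t^-1) * M ^+ 2 * enorm y ^+ 4))).
  apply: Ex_le.
  - apply: expdom_itg => //; apply: expdomX; apply: expdomD; last exact: expdom_cst.
    exact: expdom_BL wx.
  - by apply: expdom_itg => //; exact: expdomD.
  move=> y; have T := heat_taylor x y L0 e0 uL; rewrite -/p -/w -/M -enorm_sqr in T.
  rewrite -[(1 + t^-1) * _ * _]mulrA (_ : M ^+ 2 * enorm y ^+ 4 = (M * enorm y ^+ 2) ^+ 2); last by ring.
  set q := dot p y in T *; set r := M * enorm y ^+ 2 in T *; set D := w (x + y) - w x in T *.
  have DE : D ^+ 2 <= (`|q| + r) ^+ 2.
    have r0 : 0 <= r by rewrite mulr_ge0 ?sqr_ge0.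
    rewrite -[leLHS]real_normK ?num_real// lerXn2r ?nnegrE ?addr_ge0//.
    have := ler_normD (D - q) q; rewrite subrK; lra.
  rewrite (le_trans DE)//.
  (* Young's inequality with weight [t = sqrt h], which balances [t] times a variance of order [h]
     against [1 / t] times a fourth moment of order [h^2]. *)
  have -> : (1 + t) * q ^+ 2 + (1 + t^-1) * r ^+ 2 = (`|q| + r) ^+ 2 + t^-1 * (t * `|q| - r) ^+ 2.
    by rewrite -[q ^+ 2]real_normK ?num_real//; field; rewrite gt_eqF.
  by rewrite lerDl mulr_ge0 ?sqr_ge0// invr_ge0 ltW.
rewrite ExD; [|exact: expdom_itg|exact: expdom_itg].
rewrite ExZ; last by apply: expdom_itg => //; apply: expdomX; exact: expdom_dot.
rewrite ExZ; last by apply: expdom_itg => //; apply: expdomX; exact: expdom_enorm.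
have V := noise_var_le p h0.
have V' : Ex (N h) (fun y => dot p y ^+ 2) <= 2 * h * L ^+ 2.
  rewrite (le_trans V)// ler_wpM2l ?mulr_ge0 ?(ltW h0)// -enorm_sqr lerXn2r ?nnegrE ?enorm_ge0//.
have A1 : (1 + t) * Ex (N h) (fun y => dot p y ^+ 2) <= (1 + t) * (2 * h * L ^+ 2).
  by rewrite ler_wpM2l// addr_ge0// ltW.
have A2 : (1 + t^-1) * M ^+ 2 * Ex (N h) (fun y => enorm y ^+ 4) <= (1 + t^-1) * M ^+ 2 * (c * h ^+ 2).
  by rewrite ler_wpM2l ?H4// mulr_ge0 ?sqr_ge0// addr_ge0// invr_ge0 ltW.
apply: (le_trans (lerD A1 A2)).
have -> : (1 + t^-1) * M ^+ 2 * (c * h ^+ 2) = M ^+ 2 * c * (h * t * (1 + t)).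
  by rewrite -t2; field; rewrite gt_eqF.
have -> : (1 + t) * (2 * h * L ^+ 2) = 2 * h * L ^+ 2 + 2 * L ^+ 2 * (h * t) by ring.
have P0 : 0 <= M ^+ 2 * c * (h * t) by rewrite !mulr_ge0 ?sqr_ge0// ltW.
have : M ^+ 2 * c * (h * t) * (1 + t) <= M ^+ 2 * c * (h * t) * 2.
  by rewrite ler_wpM2l//; lra.
lra.
Qed.

(** Time is halved [n] times. The main term is additive in time, whereas each halving divides the
    total error by [sqrt 2], so only the main term survives. *)
Lemma heat_var_smooth e h L u x : 0 < e -> 0 < h -> 0 <= L -> BL L u ->
  heat_var h (heat e u) x <= 2 * h * L ^+ 2.
Proof.
move=> e0 h0 L0 uL; have [K K0 HK] := heat_var_smooth_small e0 L0.
have ind n : forall h u x, 0 < h -> h <= 2 ^+ n -> BL L u ->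
    heat_var h (heat e u) x <= 2 * h * L ^+ 2 + K * (h * Num.sqrt (h / 2 ^+ n)).
  elim: n => [|n IH] k v z k0 kn vL.
    by rewrite expr0 divr1; exact: HK.
  pose k' := k / 2; have kE : k = 2 * k' by rewrite /k'; field.
  have k'0 : 0 < k' by rewrite divr_gt0.
  have k'n : k' <= 2 ^+ n by rewrite ler_pdivrMr// mulrC -exprS.
  have sE : k / 2 ^+ n.+1 = k' / 2 ^+ n by rewrite /k' exprS invfM mulrA.
  rewrite sE [in leLHS]kE (heat_var_double _ k'0 (heat_BL e vL)).
  have H2 : heat_var k' (heat k' (heat e v)) z <= 2 * k' * L ^+ 2 + K * (k' * Num.sqrt (k' / 2 ^+ n)).
    (* Commuting the two smoothings gives the second half the form [heat e _] required by the
       induction hypothesis. *)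
    rewrite (_ : heat k' (heat e v) = heat e (heat k' v)); last first.
      by apply/funext => y; exact: heat_comm vL.
    by apply: IH => //; exact: heat_BL.
  have eL := heat_BL e vL.
  have H1 : Ex (N k') (fun y => heat_var k' (heat e v) (z + y)) <=
      2 * k' * L ^+ 2 + K * (k' * Num.sqrt (k' / 2 ^+ n)).
    rewrite -[leRHS](Ex_cst (N k')); apply: Ex_le => [||y]; last exact: IH.
      apply: itgB; first exact: BL_itg (BL_shift z (heat_BL k' (BL_sqr eL))).
      exact: BL_itg_sqr (BL_shift z (heat_BL k' eL)).
    exact: itg_cst.
  by apply: (le_trans (lerD H1 H2)); rewrite kE; lra.
apply: (@le_small_slope _ _ _ (K * h)) => t t0 t1.
pose n := (Num.truncn (h / t ^+ 2)).+1.
have nb : h / t ^+ 2 < 2 ^+ n.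
  apply: (lt_trans (truncnS_gt _)); rewrite -natrX ltr_nat; exact: ltn_expl.
have hn : h / 2 ^+ n <= t ^+ 2.
  rewrite ler_pdivrMr ?exprn_gt0// mulrC -ler_pdivrMr ?exprn_gt0//; exact: ltW.
have hn2 : h <= 2 ^+ n.
  rewrite (le_trans _ (ltW nb))// ler_pdivlMr ?exprn_gt0// ler_piMr ?(ltW h0)//.
  by rewrite exprn_ile1// ltW.
rewrite (le_trans (ind n h u x h0 hn2 uL))// lerD2l -mulrA; apply: ler_wpM2l => //.
apply: ler_wpM2l; first exact: ltW.
by rewrite -[leRHS](ger0_norm (ltW t0)) -sqrtr_sqr ler_sqrt// sqr_ge0.
Qed.

(** The constant 4 collects [2 e] from the second moment and [2 e] from the squared mean, all values
    lying in [0, 1]. *)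
Lemma Var_dist (m : probability (Rd R d) R) L1 L2 f g (e : R) : BL L1 f -> BL L2 g ->
  (forall x, `|f x - g x| <= e) -> Var m f <= Var m g + 4 * e.
Proof.
move=> fL gL fg.
have if1 := BL_itg m fL; have ig := BL_itg m gL.
have if2 := BL_itg_sqr m fL; have ig2 := BL_itg_sqr m gL.
have e0 : 0 <= e by exact: le_trans (fg 0).
have H1 : Ex m (fun x => f x ^+ 2) <= Ex m (fun x => g x ^+ 2) + 2 * e.
  rewrite -(Ex_cst m (2 * e)) -ExD//; last exact: itg_cst.
  apply: Ex_le => //; first by apply: itgD => //; exact: itg_cst.
  move=> x; have := fg x; rewrite ler_distl => /andP[a1 a2].
  by have [/(_ x)/andP[f0 f1] _] := fL; have [/(_ x)/andP[g0 g1] _] := gL; nra.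
have H2 : Ex m g <= Ex m f + e.
  rewrite -(Ex_cst m e) -ExD//; last exact: itg_cst.
  apply: Ex_le => //; first by apply: itgD => //; exact: itg_cst.
  by move=> x; have := fg x; rewrite ler_distl => /andP[a1 a2]; lra.
have /andP[f0 f1] : 0 <= Ex m f <= 1.
  apply/andP; split; first by apply: Ex_ge0 => x; case: fL => /(_ x)/andP[].
  rewrite -(Ex_cst m 1); apply: Ex_le => //; first exact: itg_cst.
  by move=> x; case: fL => /(_ x)/andP[].
have /andP[g0 g1] : 0 <= Ex m g <= 1.
  apply/andP; split; first by apply: Ex_ge0 => x; case: gL => /(_ x)/andP[].
  rewrite -(Ex_cst m 1); apply: Ex_le => //; first exact: itg_cst.
  by move=> x; case: gL => /(_ x)/andP[].
rewrite /Var; nra.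
Qed.

Lemma heat_var_le h L u x : 0 < h -> 0 <= L -> BL L u -> heat_var h u x <= 2 * h * L ^+ 2.
Proof.
move=> h0 L0 uL; have [c c0 H] := heat_dist.
apply: (@le_small_slope _ _ _ (4 * (L * c))) => t t0 t1.
have t20 : 0 < t ^+ 2 by rewrite exprn_gt0.
have st : Num.sqrt (t ^+ 2) = t by rewrite sqrtr_sqr ger0_norm// ltW.
have := heat_var_smooth x t20 h0 L0 uL; rewrite !heat_varE => Hs.
have := @Var_dist (N h) L L _ _ (L * (c * t)) (BL_shift x uL) (BL_shift x (heat_BL (t ^+ 2) uL)).
have D y : `|u (x + y) - heat (t ^+ 2) u (x + y)| <= L * (c * t).
  by rewrite distrC -[in leRHS]st; exact: H.
move=> /(_ D); lra.
Qed.

End gaussian_poincare.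

(** * Smoothness of the heat flow *)

Section smoothness.
Context {R : realType} {d : nat}.
Implicit Types (h L : R) (a b p x : 'rV[R]_d) (u f g w : 'rV[R]_d -> R).
Local Notation N h := (noise d h).

Lemma derivable_taylor f x (v : 'rV[R]_d) (q C : R) :
  (forall t, `|t| <= 1 -> `|f (x + t *: v) - f x - t * q| <= C * t ^+ 2) ->
  derivable f x v /\ 'D_v f x = q.
Proof.
move=> H; suff cv : t^-1 *: (f (t *: v + x) - f x) @[t --> 0^'] --> q.
  by split; [apply/cvg_ex; exists q|exact: cvg_lim].
apply/cvgrPdist_le => e e0; near=> t.
have t0 : t != 0 by near: t; exact: nbhs_dnbhs_neq.
have C0 : 0 < `|C| + 1 by rewrite ltr_wpDl.
have t1 : `|t| <= 1 by near: t; apply: dnbhs0_le.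
have te : `|t| <= e / (`|C| + 1) by near: t; apply: dnbhs0_le; rewrite divr_gt0.
have tp : 0 < `|t| by rewrite normr_gt0.
rewrite distrC (_ : _ - q = t^-1 * (f (x + t *: v) - f x - t * q)); last first.
  by rewrite (addrC (t *: v)) mulrBr mulKf.
rewrite normrM normfV mulrC ler_pdivrMr// (le_trans (H t t1))//.
rewrite -[t ^+ 2]real_normK ?num_real// expr2 mulrA ler_pM2r//.
apply: (@le_trans _ _ ((`|C| + 1) * `|t|)).
  by rewrite ler_wpM2r// (le_trans (ler_norm _))// lerDl.
by rewrite mulrC -ler_pdivlMr.
Unshelve. all: by end_near. Qed.

Lemma continuous_local_lip f :
  (forall x, exists C, forall a, enorm a <= 1 -> `|f (x + a) - f x| <= C * enorm a) ->
  continuous f.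
Proof.
move=> H x A /nbhs_ballP[e /= e0 eA]; have [C HC] := H x.
have C0 : 0 < `|C| + 1 by rewrite ltr_wpDl.
have m0 : 0 < Num.min 1 (e / (`|C| + 1)) by rewrite lt_min ltr01 divr_gt0.
have [r r0 xr] := ball_enorm x m0.
apply/nbhs_ballP; exists r => //= y /xr; rewrite lt_min => /andP[y1 ye].
apply: eA; rewrite -ball_normE /= distrC.
have yx : y = x + (y - x) by rewrite addrC subrK.
rewrite enormC in y1 ye; rewrite {1}yx (le_lt_trans (HC _ (ltW y1)))//.
apply: (@le_lt_trans _ _ ((`|C| + 1) * enorm (y - x))).
  by rewrite ler_wpM2r ?enorm_ge0// (le_trans (ler_norm _))// lerDl.
by rewrite mulrC -ltr_pdivlMr.
Qed.

Lemma Ck_continuous k f : Ck k f -> continuous f.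
Proof. by case: k => [|k] []. Qed.

Lemma Ck_derivable k f x i : Ck k.+1 f -> derivable f x (delta_mx 0 i).
Proof. by move=> [_ [H _]]; exact: H. Qed.

Lemma Ck_partial k f i : Ck k.+1 f -> Ck k (partial i f).
Proof. by move=> [_ [_ H]]; exact: H. Qed.

Lemma CkW k f : Ck k.+1 f -> Ck k f.
Proof.
elim: k f => [|k IH] f [cf [df pf]]; first by split.
by split => //; split => // i; exact: IH.
Qed.

Lemma contD f g : continuous f -> continuous g -> continuous (fun x => f x + g x).
Proof. by move=> cf cg x; exact: (continuousD (cf x) (cg x)). Qed.

Lemma contM f g : continuous f -> continuous g -> continuous (fun x => f x * g x).
Proof. by move=> cf cg x; exact: (continuousM (cf x) (cg x)). Qed.

Lemma Ck_cst k (c : R) : Ck k (fun _ : 'rV[R]_d => c).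
Proof.
elim: k c => [|k IH] c; first by split => //; exact: cst_continuous.
split; first exact: cst_continuous.
split=> [x i|i]; first exact: derivable_cst.
rewrite (_ : partial i _ = fun=> 0) //.
by apply/funext => x; rewrite /partial derive_cst.
Qed.

Lemma Ck_add k f g : Ck k f -> Ck k g -> Ck k (fun x => f x + g x).
Proof.
elim: k f g => [|k IH] f g fk gk.
  by split => //; exact: contD (Ck_continuous fk) (Ck_continuous gk).
split; first exact: contD (Ck_continuous fk) (Ck_continuous gk).
split=> [x i|i]; first exact: (@derivableD R _ R^o f g x _ (Ck_derivable fk) (Ck_derivable gk)).
rewrite (_ : partial i _ = fun x => partial i f x + partial i g x).
  by apply: IH; exact: Ck_partial.
apply/funext => x; exact: (@deriveD R _ R^o f g x _ (Ck_derivable fk) (Ck_derivable gk)).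
Qed.

Lemma Ck_mul k f g : Ck k f -> Ck k g -> Ck k (fun x => f x * g x).
Proof.
elim: k f g => [|k IH] f g fk gk.
  by split => //; exact: contM (Ck_continuous fk) (Ck_continuous gk).
split; first exact: contM (Ck_continuous fk) (Ck_continuous gk).
split=> [x i|i]; first exact: (@derivableM R _ f g x _ (Ck_derivable fk) (Ck_derivable gk)).
rewrite (_ : partial i _ = fun x => f x * partial i g x + g x * partial i f x).
  by apply: Ck_add; apply: IH; [exact: CkW|exact: Ck_partial|exact: CkW|exact: Ck_partial].
apply/funext => x; exact: (@deriveM R _ f g x _ (Ck_derivable fk) (Ck_derivable gk)).
Qed.

Lemma coord_derive x i j : derivable (fun y : 'rV[R]_d => y 0 i) x (delta_mx 0 j) /\
  'D_(delta_mx 0 j) (fun y : 'rV[R]_d => y 0 i) x = (delta_mx 0 j : 'rV[R]_d) 0 i.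
Proof.
apply: (@derivable_taylor _ _ _ _ 0) => t _.
have -> : (x + t *: delta_mx 0 j) 0 i = x 0 i + t * (delta_mx 0 j : 'rV[R]_d) 0 i.
  by rewrite mxE [X in _ + X]mxE.
by rewrite (_ : _ - _ - _ = 0) ?normr0 ?mul0r//; ring.
Qed.

Lemma Ck_coord k i : Ck k (fun x : 'rV[R]_d => x 0 i).
Proof.
case: k => [|k]; first by split => // x; exact: coord_continuous.
split; first by move=> x; exact: coord_continuous.
split=> [x j|j]; first exact: (coord_derive x i j).1.
rewrite (_ : partial j _ = fun=> (delta_mx 0 j : 'rV[R]_d) 0 i); first exact: Ck_cst.
by apply/funext => x; exact: (coord_derive x i j).2.
Qed.

(** Expanding [|x - y|^2] in the Gaussian kernel factors the heat flow into this weight and the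
    Laplace transform [laplace]. *)
Definition gweight h x : R := expR (- sqnorm x / (4 * h)).

Lemma sqnorm_shift x a : sqnorm (x + a) = sqnorm x + (2 * dot x a + sqnorm a).
Proof. by rewrite sqnormD addrA. Qed.

Lemma sqnorm_delta i : sqnorm (delta_mx 0 i : 'rV[R]_d) = 1.
Proof. by rewrite -dotvv dot_delta mxE !eqxx. Qed.

Lemma gweight_continuous h : continuous (gweight h).
Proof.
have c1 := elip_continuous (@enorm_elip R d).
have c2 := contM (@cst_continuous _ _ (- (4 * h)^-1)) (contM c1 c1).
move=> x; rewrite (_ : gweight h = expR \o (fun x => - (4 * h)^-1 * (enorm x * enorm x))).
  by apply: continuous_comp; [exact: c2|exact: continuous_expR].
by apply/funext => y; rewrite /gweight /= -expr2 enorm_sqr !mulNr mulrC.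
Qed.

Lemma gweight_derive h x i : 0 < h -> derivable (gweight h) x (delta_mx 0 i) /\
  'D_(delta_mx 0 i) (gweight h) x = (- (2 * h)^-1 * x 0 i) * gweight h x.
Proof.
move=> h0; pose k := (4 * h)^-1; have k0 : 0 < k by rewrite invr_gt0 mulr_gt0.
pose A := 2 * `|x 0 i| + 1.
have A0 : 0 <= A by rewrite addr_ge0// mulr_ge0.
apply: (@derivable_taylor _ _ _ _ (gweight h x * ((k * A) ^+ 2 * expR (k * A) + k))) => t t1.
pose s := - (k * (2 * t * x 0 i + t ^+ 2)).
have e0 : 0 <= gweight h x by exact: expR_ge0.
have -> : gweight h (x + t *: delta_mx 0 i) = gweight h x * expR s.
  rewrite /gweight -expRD; congr expR.
  by rewrite sqnorm_shift dotZr dot_delta sqnormZ sqnorm_delta mulr1 /s -/k; ring.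
have -> : - (2 * h)^-1 = - (2 * k) by rewrite /k; field; rewrite gt_eqF.
rewrite (_ : _ - _ - _ = gweight h x * ((expR s - 1 - s) - k * t ^+ 2)); last by rewrite /s; ring.
rewrite normrM (ger0_norm e0) -mulrA ler_wpM2l// (le_trans (ler_normB _ _))//.
have sA : `|s| <= `|t| * (k * A).
  rewrite normrN normrM (ger0_norm (ltW k0)) mulrCA ler_pM2l//.
  rewrite (_ : _ + _ = t * (2 * x 0 i + t)); last by ring.
  rewrite normrM ler_wpM2l// (le_trans (ler_normD _ _))// normrM ger0_norm//.
  by rewrite lerD2l.
have sA1 : `|s| <= k * A by rewrite (le_trans sA)// ler_piMl// mulr_ge0// ltW.
rewrite mulrDl lerD//; last by rewrite ger0_norm// mulr_ge0 ?sqr_ge0// ltW.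
rewrite (le_trans (expR_taylor1_le s))// [leRHS]mulrAC.
apply: ler_pM; [exact: sqr_ge0|exact: expR_ge0| |by rewrite ler_expR].
rewrite -[leLHS]real_normK ?num_real// -[t ^+ 2]real_normK ?num_real// mulrC -exprMn.
by rewrite lerXn2r ?nnegrE// mulr_ge0// mulr_ge0// ltW.
Qed.

Lemma gweight_smooth h : 0 < h -> smooth (gweight h).
Proof.
move=> h0; elim => [|k IH]; first by split => //; exact: gweight_continuous.
split; first exact: gweight_continuous.
split=> [x i|i]; first exact: (gweight_derive x i h0).1.
rewrite (_ : partial i _ = fun x => (- (2 * h)^-1 * x 0 i) * gweight h x).
  by apply: Ck_mul => //; apply: Ck_mul; [exact: Ck_cst|exact: Ck_coord].
by apply/funext => x; exact: (gweight_derive x i h0).2.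
Qed.

(** A partial derivative multiplies [w] by a linear function, and [expdom] is stable under this: all
    orders of differentiability come from one induction. *)
Definition laplace h w x := Ex (N h) (fun y => w y * expR (dot ((2 * h)^-1 *: x) y)).

Lemma laplace_derive h w x i : 0 < h -> expdom w ->
  derivable (laplace h w) x (delta_mx 0 i) /\
  'D_(delta_mx 0 i) (laplace h w) x = laplace h (fun y => w y * ((2 * h)^-1 * y 0 i)) x.
Proof.
move=> h0 ew; pose k := (2 * h)^-1; have k0 : 0 < k by rewrite invr_gt0 mulr_gt0.
have ex z := @expdom_expR_dot R d z.
have nw : expdom (fun y => `|w y|).
  case: ew => mw [C [c [C0 c0 H]]]; split; first exact: measurableT_comp.
  by exists C, c; split => // y; rewrite normr_id.
have er : expdom (fun y : 'rV[R]_d => (k * enorm y) ^+ 2 * expR (k * enorm y)).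
  apply: expdomM; last by apply: expdom_expR_enorm; exact: ltW.
  by apply: expdomX; apply: expdomM; [exact: expdom_cst|exact: expdom_enorm].
have eC : expdom (fun y => `|w y| * expR (dot (k *: x) y) * ((k * enorm y) ^+ 2 * expR (k * enorm y))).
  by apply: expdomM => //; exact: expdomM.
apply: (@derivable_taylor _ _ _ _ (Ex (N h) (fun y => `|w y| * expR (dot (k *: x) y) * ((k * enorm y) ^+ 2 * expR (k * enorm y))))) => t t1.
have i1 z : itg (N h) (fun y => w y * expR (dot (k *: z) y)).
  by apply: expdom_itg => //; exact: expdomM.
have i2 : itg (N h) (fun y => t * ((w y * (k * y 0 i)) * expR (dot (k *: x) y))).
  apply: itgZ; apply: expdom_itg => //; apply: expdomM => //; apply: expdomM => //.
  by apply: expdomM; [exact: expdom_cst|exact: expdom_coord].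
rewrite /laplace -ExZ; last first.
  apply: expdom_itg => //; apply: expdomM => //; apply: expdomM => //.
  by apply: expdomM; [exact: expdom_cst|exact: expdom_coord].
rewrite -/k -ExB// -ExB//; last exact: itgB.
rewrite (le_trans (Ex_norm (itgB (itgB (i1 _) (i1 _)) i2)))// mulrC -ExZ; last exact: expdom_itg.
apply: Ex_le.
- by apply: integrable_norm; exact: itgB (itgB (i1 _) (i1 _)) i2.
- by apply: itgZ; exact: expdom_itg.
move=> y; pose s := t * (k * y 0 i).
have -> : expR (dot (k *: (x + t *: delta_mx 0 i)) y) = expR (dot (k *: x) y) * expR s.
  rewrite -expRD; congr expR; rewrite scalerDr dotDl scalerA [X in _ + X]dotZl (dotC (delta_mx _ _)) dot_delta.
  by rewrite /s; ring.
rewrite (_ : _ - _ - _ = w y * expR (dot (k *: x) y) * (expR s - 1 - s)); last by rewrite /s; ring.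
rewrite normrM [`|w y * _|]normrM (ger0_norm (expR_ge0 _)) mulrCA ler_wpM2l ?mulr_ge0 ?expR_ge0//.
rewrite (le_trans (expR_taylor1_le s))//.
have sA : `|s| <= `|t| * (k * enorm y).
  by rewrite /s !normrM (gtr0_norm k0) ler_wpM2l// ler_pM2l// coord_le_enorm.
have sA1 : `|s| <= k * enorm y.
  by rewrite (le_trans sA)// ler_piMl// mulr_ge0 ?enorm_ge0// ltW.
rewrite mulrA; apply: ler_pM; [exact: sqr_ge0|exact: expR_ge0| |by rewrite ler_expR].
rewrite -[leLHS]real_normK ?num_real// -[t ^+ 2]real_normK ?num_real// -exprMn.
by rewrite lerXn2r ?nnegrE// mulr_ge0// mulr_ge0 ?enorm_ge0// ltW.
Qed.

Lemma laplace_continuous h w : 0 < h -> expdom w -> continuous (laplace h w).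
Proof.
move=> h0 ew; pose k := (2 * h)^-1; have k0 : 0 < k by rewrite invr_gt0 mulr_gt0.
have ex z := @expdom_expR_dot R d z.
have nw : expdom (fun y => `|w y|).
  case: ew => mw [C [c [C0 c0 H]]]; split; first exact: measurableT_comp.
  by exists C, c; split => // y; rewrite normr_id.
apply: continuous_local_lip => x.
have eC : expdom (fun y => `|w y| * expR (dot (k *: x) y) * (k * enorm y * expR (k * enorm y))).
  apply: expdomM; first exact: expdomM.
  apply: expdomM; last by apply: expdom_expR_enorm; exact: ltW.
  by apply: expdomM; [exact: expdom_cst|exact: expdom_enorm].
exists (Ex (N h) (fun y => `|w y| * expR (dot (k *: x) y) * (k * enorm y * expR (k * enorm y)))) => a a1.
have i1 z : itg (N h) (fun y => w y * expR (dot (k *: z) y)).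
  by apply: expdom_itg => //; exact: expdomM.
rewrite /laplace -/k -ExB// (le_trans (Ex_norm (itgB (i1 _) (i1 _))))// mulrC -ExZ; last exact: expdom_itg.
apply: Ex_le.
- by apply: integrable_norm; exact: itgB (i1 _) (i1 _).
- by apply: itgZ; exact: expdom_itg.
move=> y; pose s := dot (k *: a) y.
rewrite scalerDr dotDl expRD -/s.
rewrite (_ : _ - _ = w y * expR (dot (k *: x) y) * (expR s - 1)); last by ring.
rewrite normrM [`|w y * _|]normrM (ger0_norm (expR_ge0 _)) mulrCA ler_wpM2l ?mulr_ge0 ?expR_ge0//.
rewrite (le_trans (expR_sub1_le s))//.
have sA : `|s| <= enorm a * (k * enorm y).
  by rewrite /s (le_trans (normr_dot_le _ _))// enormZ (gtr0_norm k0) mulrCA mulrA.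
have sA1 : `|s| <= k * enorm y.
  by rewrite (le_trans sA)// ler_piMl// mulr_ge0 ?enorm_ge0// ltW.
by rewrite mulrA; apply: ler_pM; [exact: normr_ge0|exact: expR_ge0| |rewrite ler_expR].
Qed.

Lemma laplace_smooth h w : 0 < h -> expdom w -> smooth (laplace h w).
Proof.
move=> h0 ew k; elim: k w ew => [|k IH] w ew; first by split => //; exact: laplace_continuous.
split; first exact: laplace_continuous.
split=> [x i|i]; first exact: (laplace_derive x i h0 ew).1.
rewrite (_ : partial i _ = laplace h (fun y => w y * ((2 * h)^-1 * y 0 i))).
  apply: IH; apply: expdomM => //.
  by apply: expdomM; [exact: expdom_cst|exact: expdom_coord].
by apply/funext => x; exact: (laplace_derive x i h0 ew).2.
Qed.

(** The Poincare constants are defined with smooth functions, so the mollified test functions must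
    meet that definition at every order. Shifting by [x] through the density [cmw h x] brings out
    the two factors. *)
Lemma heat_smooth h L u : 0 < h -> BL L u -> smooth (heat h u).
Proof.
move=> h0 uL k; have eu := expdom_BL uL.
rewrite (_ : heat h u = fun x => gweight h x * laplace h u x).
  by apply: Ck_mul; [exact: gweight_smooth|exact: laplace_smooth].
apply/funext => x.
have cE y : u y * cmw h x y = gweight h x * (u y * expR (dot ((2 * h)^-1 *: x) y)).
  by rewrite mulrCA /gweight -expRD /cmw dotZl; congr (_ * expR _); ring.
have i1 : itg (N h) (fun y => u y * cmw h x y).
  rewrite (_ : (fun y => _) = fun y => gweight h x * (u y * expR (dot ((2 * h)^-1 *: x) y))).
    by apply: itgZ; apply: expdom_itg => //; apply: expdomM => //; exact: expdom_expR_dot.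
  by apply/funext => y; exact: cE.
have [_ e1] := noise_translate h0 (BL_meas uL) i1.
rewrite /heat (@Ex_eq _ (Rd R d) R _ _ (fun y => u (y + x))); last by move=> y; rewrite addrC.
rewrite e1 (@Ex_eq _ (Rd R d) R _ _ _ cE) ExZ//.
by apply: expdom_itg => //; apply: expdomM => //; exact: expdom_expR_dot.
Qed.

Lemma gradient_heat h L u x : 0 <= L -> 0 < h -> BL L u ->
  gradient (heat h u) x = grad_heat h u x.
Proof.
move=> L0 h0 uL; apply/rowP => i; rewrite mxE /partial.
have [|_ ->] := @derivable_taylor (heat h u) x (delta_mx 0 i) (grad_heat h u x 0 i)
  (heat_rem (d := d) h + 2 * L).
  move=> t _; have := heat_taylor x (t *: delta_mx 0 i) L0 h0 uL.
  by rewrite dotZr dot_delta sqnormZ sqnorm_delta mulr1.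
by [].
Qed.

End smoothness.

(** * The Poincare inequality on bounded Lipschitz functions *)

Section poincare_bounded_lipschitz.
Context {R : realType} {d : nat}.
Variables (m : probability (Rd R d) R) (K : R).
Implicit Types (h L : R) (u f : 'rV[R]_d -> R).

Definition poincare_ineq := forall f : 'rV[R]_d -> R, smooth f ->
  ('V_m[f : Rd R d -> R] <= K%:E * \int[m]_x (sqnorm (gradient f x))%:E)%E.

Hypothesis mK : poincare_ineq.
Hypothesis K0 : 0 <= K.

Lemma variance_BL L u : BL L u -> 'V_m[u : Rd R d -> R] = (Var m u)%:E.
Proof.
move=> uL; have i1 := BL_itg m uL; have i2 := BL_itg_sqr m uL.
have -> : Var m u = Ex m (fun x => (u x - Ex m u) ^+ 2).
  by rewrite VarE// subrr expr0n addr0.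
rewrite /variance covariance.unlock expectation.unlock -Ex_EFin; last first.
  rewrite (_ : (fun x => _) = fun x => u x ^+ 2 - 2 * Ex m u * u x + Ex m u ^+ 2).
    by apply: itgD; [apply: itgB => //; exact: itgZ|exact: itg_cst].
  by apply/funext => x; ring.
by apply: eq_integral => x _; rewrite expr2.
Qed.

Lemma measurable_sqnorm_grad_heat h L u : 0 <= L -> 0 < h -> BL L u ->
  measurable_fun setT ((fun x => sqnorm (grad_heat h u x)) : Rd R d -> R).
Proof.
move=> L0 h0 uL.
rewrite (_ : (fun x => _) = fun x : Rd R d => \sum_i (partial i (heat h u) x) ^+ 2).
  apply: measurable_sum => i; apply: measurable_funX.
  apply: continuous_measurable_Rd.
  exact: Ck_continuous (Ck_partial i (heat_smooth h0 uL 1)).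
apply/funext => x; apply: eq_bigr => i _.
by rewrite -(gradient_heat x L0 h0 uL) mxE.
Qed.

Lemma sqnorm_grad_heat_le h L u x : 0 <= L -> 0 < h -> BL L u ->
  sqnorm (grad_heat h u x) <= L ^+ 2.
Proof.
move=> L0 h0 uL; rewrite -enorm_sqr lerXn2r ?nnegrE ?enorm_ge0//.
exact: enorm_grad_heat uL.
Qed.

Lemma itg_sqnorm_grad_heat h L u : 0 <= L -> 0 < h -> BL L u ->
  itg m (fun x => sqnorm (grad_heat h u x)).
Proof.
move=> L0 h0 uL; apply: bdm_itg; split; first exact: measurable_sqnorm_grad_heat uL.
exists (L ^+ 2) => x; rewrite ger0_norm ?sqnorm_ge0//.
exact: sqnorm_grad_heat_le uL.
Qed.

Lemma poincare_heat h L u : 0 <= L -> 0 < h -> BL L u ->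
  Var m (heat h u) <= K * Ex m (fun x => sqnorm (grad_heat h u x)).
Proof.
move=> L0 h0 uL; have := mK (heat_smooth h0 uL).
rewrite (variance_BL (heat_BL h uL)).
under eq_integral do rewrite (gradient_heat _ L0 h0 uL).
by rewrite Ex_EFin ?lee_fin//; exact: itg_sqnorm_grad_heat uL.
Qed.

(** Mollification by the heat flow at time [t^2] keeps the gradient below [L] and moves [u] by order
    [t], which then vanishes. *)
Lemma poincare_BL L u : 0 <= L -> BL L u -> Var m u <= K * L ^+ 2.
Proof.
move=> L0 uL; have [c c0 H] := @heat_dist R d.
apply: (@le_small_slope _ _ _ (4 * (L * c))) => t t0 t1.
have t20 : 0 < t ^+ 2 by rewrite exprn_gt0.
have st : Num.sqrt (t ^+ 2) = t by rewrite sqrtr_sqr ger0_norm// ltW.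
have D y : `|u y - heat (t ^+ 2) u y| <= L * (c * t).
  by rewrite distrC -[in leRHS]st; exact: H.
have := Var_dist m uL (heat_BL (t ^+ 2) uL) D.
have := poincare_heat L0 t20 uL.
have : Ex m (fun x => sqnorm (grad_heat (t ^+ 2) u x)) <= L ^+ 2.
  rewrite -(Ex_cst m (L ^+ 2)); apply: Ex_le.
  - exact: itg_sqnorm_grad_heat uL.
  - exact: itg_cst.
  - by move=> x; exact: sqnorm_grad_heat_le uL.
move=> /(ler_wpM2l K0); lra.
Qed.

End poincare_bounded_lipschitz.

(** * Convex potentials and the proximal map *)

Section elementary_calculus.
Context {R : realType} {d : nat}.
Implicit Types (f : 'rV[R]_d -> R) (x y z v : 'rV[R]_d).

Lemma ord_common_radius n (P : 'I_n -> R -> Prop) :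
  (forall i, exists2 r, 0 < r & forall s, 0 < s -> s <= r -> P i s) ->
  exists2 r, 0 < r & forall i s, 0 < s -> s <= r -> P i s.
Proof.
elim: n P => [|n IH] P H; first by exists 1 => // -[].
have [r0 r00 H0] := H ord0.
have [r1 r10 H1] := IH (fun i => P (lift ord0 i)) (fun i => H (lift ord0 i)).
exists (Num.min r0 r1) => [|i s s0]; first by rewrite lt_min r00.
rewrite le_min => /andP[sr0 sr1].
by case: (unliftP ord0 i) => [j|] ->; [exact: H1|exact: H0].
Qed.

Lemma derivable_eps f x v (e : R) : derivable f x v -> 0 < e ->
  exists2 r, 0 < r & forall t, `|t| <= r -> `|f (x + t *: v) - f x - t * 'D_v f x| <= e * `|t|.
Proof.
move=> fv e0; have : t^-1 *: (f (t *: v + x) - f x) @[t --> 0^'] --> 'D_v f x by exact: fv.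
move=> /cvgrPdist_le/(_ e e0); rewrite near_withinE => /nbhs_ballP[r /= r0 H].
exists (r / 2) => [|t tr]; first by rewrite divr_gt0.
have [->|t0] := eqVneq t 0.
  by rewrite scale0r addr0 subrr mul0r subrr normr0 mulr0.
have tb : ball 0 r t.
  by rewrite -ball_normE /= sub0r normrN (le_lt_trans tr)// gtr_pMr// invf_lt1// ltr1n.
have := H t tb t0; rewrite /= distrC => H1.
rewrite (_ : _ - _ = t * (t^-1 * (f (t *: v + x) - f x) - 'D_v f x)); last first.
  by rewrite mulrBr mulVKf// (addrC (t *: v)).
by rewrite normrM mulrC ler_pM2r// normr_gt0.
Qed.

Definition cube (r : R) : set 'rV[R]_d := [set v | forall i, v ord0 i \in `[(- r), r]].

Lemma cube_compact r : compact (cube r).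
Proof.
by apply: (@rV_compact _ _ (fun=> `[(- r), r]%classic)) => _; exact: segment_compact.
Qed.

Lemma cube_enorm r v : enorm v <= r -> cube r v.
Proof. by move=> vr i; rewrite in_itv /= -ler_norml (le_trans _ vr)// coord_le_enorm. Qed.

Lemma cube_enorm_le r v : 0 <= r -> cube r v -> enorm v <= d%:R * r.
Proof.
move=> r0 vr; rewrite (le_trans (enorm_le_mx_norm v))// ler_wpM2l//.
have -> : `|v| = mx_norm v by [].
have [->//|v0] := eqVneq (mx_norm v) 0.
have [[j i] /= ->] := mx_norm_neq0 v0; rewrite (ord1 j).
by have := vr i; rewrite in_itv /= -ler_norml.
Qed.

End elementary_calculus.

Section convex_potential.
Context {R : realType} {d : nat}.
Variable V : 'rV[R]_d -> R.
Hypothesis V1 : Ck 1 V.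
Hypothesis Vconvex : convex_function [set: convex_lmodType 'rV[R]_d] V.
Implicit Types (h t : R) (x y z v : 'rV[R]_d).

Lemma convex_ineq t x y : 0 <= t <= 1 ->
  V (t *: x + (1 - t) *: y) <= t * V x + (1 - t) * V y.
Proof.
move=> /andP[t0 t1].
have t01 : Itv.spec (@Itv.num_sem R) (Itv.Real `[0%Z, 1%Z]) t.
  by rewrite /= /Itv.num_sem /= num_real /= in_itv /= t0 t1.
exact: (Vconvex (Itv.mk t01) (x := x) (y := y) (in_setT _) (in_setT _)).
Qed.

Lemma convex_mean n (z : nat -> 'rV[R]_d) :
  V (n.+1%:R^-1 *: \sum_(i < n.+1) z i) <= n.+1%:R^-1 * \sum_(i < n.+1) V (z i).
Proof.
elim: n => [|n IH]; first by rewrite !big_ord1 invr1 scale1r mul1r.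
rewrite big_ord_recr [in leRHS]big_ord_recr /=.
pose t := n.+1%:R / n.+2%:R : R.
have n1 : (n.+1%:R : R) != 0 by rewrite pnatr_eq0.
have n2 : (n.+2%:R : R) != 0 by rewrite pnatr_eq0.
have t01 : 0 <= t <= 1.
  by rewrite /t divr_ge0//= ler_pdivrMr ?ltr0n// mul1r ler_nat.
have tc : 1 - t = n.+2%:R^-1.
  by apply: (mulIf n2); rewrite mulrBl /t divfK// mulVf// mul1r -natrB ?subSnn.
have tn : t * n.+1%:R^-1 = n.+2%:R^-1 by rewrite /t mulrAC divff// mul1r.
set A := n.+1%:R^-1 *: \sum_(i < n.+1) z i in IH.
have -> : n.+2%:R^-1 *: (\sum_(i < n.+1) z i + z n.+1) = t *: A + (1 - t) *: z n.+1.
  by rewrite tc /A scalerA tn scalerDr.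
apply: (le_trans (convex_ineq _ _ t01)).
rewrite tc mulrDr lerD2r.
rewrite [leRHS](_ : _ = t * (n.+1%:R^-1 * \sum_(i < n.+1) V (z i))); last by rewrite mulrA tn.
by apply: ler_wpM2l => //; case/andP: t01.
Qed.

(** Only partial derivatives are available, so first-order information is used along the axes:
    [x - s v] is the mean of the points [x - d s v_i e_i], where [V] is known up to [s] times a
    small error, and convexity passes to the mean. *)
Lemma subgradient x v : V x + dot (gradient V x) v <= V (x + v).
Proof.
have [d0|d0] := posnP d.
  have -> : v = 0 by apply/rowP => i; have := ltn_ord i; rewrite {2}d0.
  by rewrite dotC dot0l !addr0.
have dE : d.-1.+1 = d by rewrite prednK.
have dR : 0 < d%:R :> R by rewrite ltr0n.
have [_ [dV _]] := V1.
apply: (@le_small_slope _ _ _ (\sum_i `|v 0 i|)) => e e0 _.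
have [r r0 H] : exists2 r : R, 0 < r & forall (i : 'I_d) s, 0 < s -> s <= r ->
    V (x + (- (d%:R * s * v 0 i)) *: delta_mx 0 i) - V x <= - (d%:R * s) * (v 0 i * partial i V x - e * `|v 0 i|).
  apply: ord_common_radius => i.
  have [r r0 H] := derivable_eps (dV x i) e0.
  have D0 : 0 < d%:R * (`|v 0 i| + 1) by rewrite mulr_gt0// ltr_wpDl.
  exists (r / (d%:R * (`|v 0 i| + 1))) => [|s s0 sr]; first by rewrite divr_gt0.
  have ds0 : 0 <= d%:R * s by rewrite mulr_ge0// ltW.
  have sr' : `| - (d%:R * s * v 0 i)| <= r.
    rewrite normrN normrM (ger0_norm ds0).
    move: sr; rewrite ler_pdivlMr// => sr; apply: le_trans sr.
    rewrite mulrA (mulrC d%:R) ler_wpM2l// ?lerDl//.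
    by rewrite mulrC.
  have := le_trans (ler_norm _) (H _ sr').
  rewrite normrN normrM (ger0_norm ds0) /partial.
  set D := 'D_ _ _ _; nra.
pose s := Num.min r 1.
have s0 : 0 < s by rewrite lt_min r0 ltr01.
have sr : s <= r by rewrite ge_min lexx.
pose z (k : nat) : 'rV[R]_d := if insub k is Some i then x + (- (d%:R * s * v 0 i)) *: delta_mx 0 i else x.
have zE (i : 'I_d) : z i = x + (- (d%:R * s * v 0 i)) *: delta_mx 0 i by rewrite /z valK.
have mean : V (x - s *: v) <= d%:R^-1 * \sum_(i < d) V (z i).
  have := convex_mean d.-1 z; rewrite dE; congr (V _ <= _).
  under eq_bigr do rewrite zE.
  rewrite big_split /= sumr_const card_ord -(scaler_nat d x) scalerDr scalerA mulVf ?gt_eqF// scale1r.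
  congr (_ + _); rewrite scaler_sumr [in RHS](row_sum_delta v) scaler_sumr -sumrN.
  apply: eq_bigr => i _; rewrite !scalerA -[RHS]scaleNr; congr (_ *: _).
  by rewrite mulrN !mulrA mulVf ?gt_eqF// mul1r.
have t01 : 0 <= (1 + s)^-1 <= 1.
  rewrite invr_ge0 addr_ge0 ?(ltW s0)//= invf_le1 ?lerDl ?(ltW s0)//.
  by rewrite ltr_wpDr// ltW.
have s1 : 1 + s != 0 by rewrite gt_eqF// ltr_wpDr// ltW.
have := convex_ineq (x - s *: v) (x + v) t01.
(* [x] divides the segment from [x - s v] to [x + v] with weights [1 / (1 + s)] and [s / (1 + s)];
   the step [s] finally cancels. *)
have -> : (1 + s)^-1 *: (x - s *: v) + (1 - (1 + s)^-1) *: (x + v) = x.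
  rewrite (_ : 1 - (1 + s)^-1 = s * (1 + s)^-1); last by field.
  by apply/rowP => i; rewrite !mxE; field.
move=> H0.
have sum_le : \sum_(i < d) V (z i) <= \sum_(i < d) (V x - (d%:R * s) * (v 0 i * partial i V x - e * `|v 0 i|)).
  apply: ler_sum => i _; rewrite zE; have := H i s s0 sr; lra.
have sumE : \sum_(i < d) (V x - (d%:R * s) * (v 0 i * partial i V x - e * `|v 0 i|)) =
    d%:R * V x - d%:R * s * (dot (gradient V x) v - e * \sum_i `|v 0 i|).
  rewrite big_split /= sumr_const card_ord -[X in X + _]mulr_natl sumrN -mulr_sumr; congr (_ - _ * _).
  rewrite big_split /= sumrN -mulr_sumr; congr (_ - _).
  by apply: eq_bigr => i _; rewrite mxE mulrC.
have Vm : V (x - s *: v) <= V x - s * (dot (gradient V x) v - e * \sum_i `|v 0 i|).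
  apply: (le_trans mean); rewrite mulrC ler_pdivrMr// (le_trans sum_le)// sumE; lra.
have s1p : 0 < 1 + s by rewrite ltr_wpDr// ltW.
have H2 : (1 + s) * V x <= V (x - s *: v) + s * V (x + v).
  rewrite -(ler_pM2l (x := (1 + s)^-1)) ?invr_gt0// mulKf//.
  apply: (le_trans H0); rewrite mulrDr lerD2l.
  by rewrite (_ : 1 - (1 + s)^-1 = (1 + s)^-1 * s) ?mulrA//; field.
have H3 : s * (V x + dot (gradient V x) v) <= s * (V (x + v) + (\sum_i `|v 0 i|) * e) by lra.
by rewrite ler_pM2l in H3.
Qed.

Lemma gradient_monotone x y : 0 <= dot (gradient V x - gradient V y) (x - y).
Proof.
have A := subgradient x (y - x); rewrite [x + _]addrC subrK -opprB dotNr in A.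
have B := subgradient y (x - y); rewrite [y + _]addrC subrK in B.
rewrite dotBl; lra.
Qed.

Lemma bregman_ge0 x v : 0 <= V (x + v) - V x - dot (gradient V x) v.
Proof. by have := subgradient x v; lra. Qed.

(** The tangent inequality at the other endpoint [x + v]. Second-order errors are thus measured by
    the modulus of continuity of the gradient. *)
Lemma bregman_le x v : V (x + v) - V x - dot (gradient V x) v <=
  enorm (gradient V (x + v) - gradient V x) * enorm v.
Proof.
have := subgradient (x + v) (- v); rewrite addrK dotNr => H.
have := dot_le (gradient V (x + v) - gradient V x) v; rewrite dotBl; lra.
Qed.

Lemma gradient_continuous_eps x (e : R) : 0 < e -> exists2 r : R, 0 < r &
  forall y, ball x r y -> enorm (gradient V x - gradient V y) <= e.
Proof.
move=> e0; have [_ [_ pV]] := V1.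
have d1 : 0 < d.+1%:R :> R by [].
have [r r0 H] : exists2 r : R, 0 < r & forall (i : 'I_d) s, 0 < s -> s <= r ->
    forall y, ball x s y -> `|partial i V x - partial i V y| <= e / d.+1%:R.
  apply: ord_common_radius => i.
  have ci : {for x, continuous (partial i V)} by case: (pV i) => + _; apply.
  have /nbhs_ballP[r /= r0 H] : nbhs x (partial i V @^-1` ball (partial i V x) (e / d.+1%:R)).
    by apply: ci; apply: nbhsx_ballx; rewrite divr_gt0.
  exists r => // s s0 sr y xy; have := H y (le_ball sr xy).
  by rewrite /= -ball_normE /= => /ltW.
exists r => // y xy; rewrite (le_trans (enorm_le_mx_norm _))//.
have -> : `|gradient V x - gradient V y| = mx_norm (gradient V x - gradient V y) by [].
have [->|v0] := eqVneq (mx_norm (gradient V x - gradient V y)) 0; first by rewrite mulr0 ltW.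
have [[j i] /= ->] := mx_norm_neq0 v0; rewrite (ord1 j) !mxE.
have := H i r r0 (lexx _) y xy; rewrite ler_pdivlMr// mulrC; apply: le_trans.
by rewrite ler_wpM2r// ler_nat.
Qed.

Lemma enorm_gradient_continuous : continuous (fun x => enorm (gradient V x)).
Proof.
move=> x A /nbhs_ballP[e /= e0 eA].
have e20 : 0 < e / 2 by rewrite divr_gt0.
have [r r0 H] := gradient_continuous_eps x e20.
apply/nbhs_ballP; exists r => //= y /H xy; apply: eA; rewrite -ball_normE /=.
rewrite (le_lt_trans (enormBB _ _))// (le_lt_trans xy)//.
by rewrite gtr_pMr// invf_lt1// ltr1n.
Qed.

Lemma gradient_bounded (rho : R) : exists2 M : R, 0 <= M &
  forall x, enorm x <= rho -> enorm (gradient V x) <= M.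
Proof.
have [r0|r0] := leP 0 rho; last first.
  by exists 0 => // x; have := enorm_ge0 x => x0 /(le_trans x0); rewrite leNgt r0.
have ne : (cube rho : set 'rV[R]_d) !=set0.
  by exists 0 => i; rewrite mxE in_itv /= oppr_le0 r0.
have [|c _ H] := EVT_max_rV ne (@cube_compact R d rho) (f := fun x => enorm (gradient V x)).
  exact/continuous_subspaceT/enorm_gradient_continuous.
exists (enorm (gradient V c)) => [|x xr]; first exact: enorm_ge0.
by apply: H; apply/mem_set; exact: cube_enorm.
Qed.

(** Compactness of a cube containing the ball; [y] is not confined to it, because each local radius
    covers a full neighbourhood. *)
Lemma gradient_uniform_continuous (rho e : R) : 0 < e -> exists2 del : R, 0 < del &
  forall x y, enorm x <= rho -> enorm (x - y) <= del ->
    enorm (gradient V x - gradient V y) <= e.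
Proof.
move=> e0; have e20 : 0 < e / 2 by rewrite divr_gt0.
have /compact_near_coveringP cK := @cube_compact R d rho.
pose P (s : R) x := forall y, enorm (x - y) <= s -> enorm (gradient V x - gradient V y) <= e.
have : \forall s \near (0 : R)^'+, cube rho `<=` P s.
  apply: cK => x0 _; have [r r0 H] := gradient_continuous_eps x0 e20.
  have r20 : 0 < r / 2 by rewrite divr_gt0.
  exists (ball x0 (r / 2), [set s | s < r / 2]) => /=.
    split; first exact: nbhsx_ballx.
    exact: nbhs_right_lt.
  move=> [x s] /= [x0x sr] y xy.
  have yb : ball x0 r y.
    rewrite (splitr r); apply: ball_triangle x0x _.
    by apply: enorm_ball; exact: le_lt_trans sr.
  have xb : ball x0 r x by apply: le_ball x0x; rewrite ler_pdivrMr// ler_peMr ?(ltW r0)// ler1n.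
  rewrite (le_trans (enorm_tri (gradient V x0) _ _))// enormC (splitr e) lerD// H//.
move=> H.
have [r /= r0 {}H] : exists2 r : R, 0 < r & forall s : R, ball (0 : R) r s -> 0 < s -> cube rho `<=` P s.
  by move: H; rewrite near_withinE => /nbhs_ballP[r r0 H]; exists r.
have del0 : 0 < r / 2 by rewrite divr_gt0.
have Hdel : cube rho `<=` P (r / 2).
  apply: H => //; rewrite -ball_normE /= sub0r normrN gtr0_norm//.
  by rewrite gtr_pMr// invf_lt1// ltr1n.
exists (r / 2) => // x y xr xy; apply: Hdel => //; exact: cube_enorm.
Qed.

End convex_potential.

(** * The proximal map and the chain it generates *)

Section proximal_chain.
Context {R : realType} {d : nat}.
Variable V : 'rV[R]_d -> R.
Hypothesis V1 : Ck 1 V.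
Hypothesis Vconvex : convex_function [set: convex_lmodType 'rV[R]_d] V.
Implicit Types (h t L : R) (x y z v : 'rV[R]_d) (f : 'rV[R]_d -> R).
Local Notation N h := (noise d h).

(** The equation is the optimality condition for [V x + |x - z|^2 / (2 h)]. By the tangent
    inequality at [z], the quadratic term wins at distance more than [2 h |grad V z|], so a
    minimiser over a compact box is global. *)
Lemma prox_exists h z : 0 < h -> exists x, x + h *: gradient V x = z.
Proof.
move=> h0; pose F x := V x + (2 * h)^-1 * sqnorm (x - z).
pose g := enorm (gradient V z); pose rho := 2 * h * g.
have g0 : 0 <= g by exact: enorm_ge0.
have rho0 : 0 <= rho by rewrite !mulr_ge0// ltW.
have cF : continuous F.
  apply: contD; first exact: (Ck_continuous V1).
  rewrite (_ : (fun x => _) = fun x => (2 * h)^-1 * (enorm (x - z) * enorm (x - z))); last first.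
    by apply/funext => x; rewrite -expr2 enorm_sqr.
  have ce : continuous (fun x => enorm (x - z)).
    apply: (@elip_continuous _ _ 1) => x y; rewrite mul1r (le_trans (enormBB _ _))//.
    by rewrite opprB addrA subrK.
  apply: contM; [exact: cst_continuous|exact: contM].
pose S := [set v : 'rV[R]_d | forall i, v ord0 i \in `[z 0 i - rho, z 0 i + rho]].
have cS : compact S.
  by apply: (@rV_compact _ _ (fun i => `[z 0 i - rho, z 0 i + rho]%classic)) => i; exact: segment_compact.
have Sz : S z by move=> i; rewrite in_itv /=; apply/andP; split; lra.
have [||c cS' Hc] := @EVT_min_rV R d F S _ cS; first by exists z.
  exact/continuous_subspaceT.
have Fmin x : F c <= F x.
  have [Sx|Sx] := pselect (S x); first by apply: Hc; exact/mem_set.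
  apply: (le_trans (Hc z (mem_set Sz))); rewrite /F subrr -{1}dotvv dot0l mulr0 addr0.
  have xr : rho < enorm (x - z).
    rewrite ltNge; apply/negP => xr; apply: Sx => i; rewrite in_itv /=.
    by have := le_trans (coord_le_enorm (x - z) i) xr; rewrite !mxE ler_norml; lra.
  have := subgradient V1 Vconvex z (x - z); rewrite [z + _]addrC subrK => H1.
  have := normr_dot_le (gradient V z) (x - z); rewrite ler_norml => /andP[H2 _].
  rewrite -enorm_sqr; set r := enorm (x - z) in xr H2 *.
  have r0 : 0 <= r by exact: enorm_ge0.
  have : (2 * h)^-1 * r ^+ 2 >= g * r.
    rewrite [leRHS]mulrC ler_pdivlMr ?mulr_gt0//.
    have : r * rho <= r * r by rewrite ler_wpM2l// ltW.
    rewrite /rho expr2; lra.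
  rewrite -/g in H2; lra.
exists c; apply/rowP => i; apply/eqP; rewrite -subr_eq0; apply/eqP.
have [_ [dV _]] := V1.
pose q := partial i V c + (c - z) 0 i / h.
suff q0 : q = 0.
  rewrite !mxE; have : h * q = 0 by rewrite q0 mulr0.
  by rewrite /q mulrDr mulrCA mulfV ?gt_eqF// mulr1 !mxE; lra.
(* First-order optimality along one axis in both directions; the bound [t <= h e] makes the
   quadratic cost [t^2 / (2 h)] at most [t e / 2]. *)
have q0 (s : R) : (s = 1) \/ (s = -1) -> 0 <= s * q.
  move=> s1; apply: (@le_small_slope _ _ _ 1) => e e0 _.
  have [r r0 H] := derivable_eps (dV c i) (divr_gt0 e0 (ltr0Sn _ 1)).
  pose t := Num.min r (h * e).
  have t0 : 0 < t by rewrite lt_min r0 mulr_gt0.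
  have tr : t <= r by rewrite ge_min lexx.
  have te : t <= h * e by rewrite ge_min lexx orbT.
  have st : `|s * t| = t by case: s1 => ->; rewrite ?mul1r ?mulN1r ?normrN gtr0_norm.
  have s2 : s ^+ 2 = 1 by case: s1 => ->; rewrite ?expr1n// sqrrN expr1n.
  have := H (s * t); rewrite st => /(_ tr); rewrite ler_norml => /andP[_ H1].
  have := Fmin (c + (s * t) *: delta_mx 0 i); rewrite /F addrAC [sqnorm (c - z + _)]sqnorm_shift.
  rewrite dotZr dot_delta sqnormZ sqnorm_delta mulr1 exprMn s2 mul1r => H2.
  rewrite -/(partial i V c) in H1.
  have e2 : (2 * h)^-1 * t ^+ 2 <= t * (e / 2).
    rewrite mulrC ler_pdivrMr ?mulr_gt0// (_ : t * (e / 2) * (2 * h) = t * (h * e)); last by field.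
    by rewrite expr2 ler_pM2l.
  have H3 : 0 <= t * (s * q + e).
    rewrite (_ : t * (s * q + e) = s * t * partial i V c + (2 * h)^-1 * (2 * (s * t * (c - z) 0 i)) + e * t); last first.
      by rewrite /q; field; rewrite gt_eqF.
    lra.
  by rewrite pmulr_rge0// in H3; rewrite mul1r.
have := q0 1 (or_introl erefl); have := q0 (-1) (or_intror erefl).
rewrite mul1r mulN1r oppr_ge0 => a b; apply/eqP; rewrite eq_le; exact/andP.
Qed.

(** Encoded by its optimality equation, the form in which an implicit Euler step occurs; the default
    0 is never taken when [h] is positive. *)
Definition prox h z : 'rV[R]_d := xget 0 [set x | x + h *: gradient V x = z].

Lemma proxE h z : 0 < h -> prox h z + h *: gradient V (prox h z) = z.
Proof. by move=> h0; have [x xz] := prox_exists z h0; exact: (@xgetPex _ 0 [set x | x + h *: gradient V x = z] (ex_intro _ x xz)). Qed.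

Lemma prox_subE h z : 0 < h -> z - prox h z = h *: gradient V (prox h z).
Proof. by move=> h0; apply/eqP; rewrite subr_eq addrC eq_sym; apply/eqP; exact: proxE. Qed.

(** Monotonicity of the gradient gives [|a - b|^2 <= (a - b) . (x - y)] for the images [a] and
    [b]. *)
Lemma prox_contract h x y : 0 < h -> enorm (prox h x - prox h y) <= enorm (x - y).
Proof.
move=> h0; set a := prox h x; set b := prox h y.
have xE : x - y = (a - b) + h *: (gradient V a - gradient V b).
  by rewrite -(proxE x h0) -(proxE y h0) -/a -/b scalerBr opprD addrACA.
have m := gradient_monotone V1 Vconvex a b; rewrite dotC in m.
have [e0|e0] := eqVneq (enorm (a - b)) 0; first by rewrite e0 enorm_ge0.
have ep : 0 < enorm (a - b) by rewrite lt_def e0 enorm_ge0.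
rewrite -(ler_pM2l ep) -expr2 enorm_sqr; apply: le_trans (dot_le _ _).
by rewrite xE dotDr dotZr dotvv lerDl mulr_ge0// ltW.
Qed.

(** Monotonicity between [z] and its image. The length of a proximal step is thereby bounded by the
    gradient at its starting point, which can be kept in a ball. *)
Lemma prox_gradient_le h z : 0 < h -> enorm (gradient V (prox h z)) <= enorm (gradient V z).
Proof.
move=> h0; set p := gradient V (prox h z).
have := gradient_monotone V1 Vconvex z (prox h z).
rewrite (prox_subE z h0) -/p dotZr pmulr_rge0// dotBl dotvv -enorm_sqr subr_ge0 => H.
have [e0|e0] := eqVneq (enorm p) 0; first by rewrite e0 enorm_ge0.
have ep : 0 < enorm p by rewrite lt_def e0 enorm_ge0.
by rewrite -(ler_pM2r ep) -expr2 (le_trans H)// dot_le.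
Qed.

Lemma prox_dist h z : 0 < h -> enorm (prox h z - z) <= h * enorm (gradient V z).
Proof.
move=> h0; rewrite enormC (prox_subE z h0) enormZ gtr0_norm//.
by rewrite ler_pM2l// prox_gradient_le.
Qed.

Definition Qstep h f : 'rV[R]_d -> R := heat h (f \o prox h).
Definition Qn h n f := iter n (Qstep h) f.

Lemma prox_BL h L f : 0 < h -> 0 <= L -> BL L f -> BL L (f \o prox h).
Proof. by move=> h0 L0; apply: BL_comp => // x y; exact: prox_contract. Qed.

Lemma Qstep_BL h L f : 0 < h -> 0 <= L -> BL L f -> BL L (Qstep h f).
Proof. by move=> h0 L0 fL; apply: heat_BL; exact: prox_BL. Qed.

Lemma Qn_BL h n L f : 0 < h -> 0 <= L -> BL L f -> BL L (Qn h n f).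
Proof. by move=> h0 L0 fL; elim: n => // n IH; exact: Qstep_BL. Qed.

(** The square of a Cameron-Martin density is, up to a constant, the density for the doubled shift.
    Its mean is the price of a shift in Cauchy-Schwarz, hence the source of the Harnack exponent. *)
Lemma cmw_sqr h a : 0 < h -> expdom (cmw h a) /\
  Ex (N h) (fun y => cmw h a y ^+ 2) = expR (sqnorm a / (2 * h)).
Proof.
move=> h0; have E b y : cmw h b y = expR (- (sqnorm b / (4 * h))) * expR (dot ((2 * h)^-1 *: b) y).
  by rewrite /cmw -expRD dotZl; congr expR; ring.
split.
  rewrite (_ : cmw h a = (fun y => expR (- (sqnorm a / (4 * h))) * expR (dot ((2 * h)^-1 *: a) y))).
    by apply: expdomM; [exact: expdom_cst|exact: expdom_expR_dot].
  by apply/funext => y; exact: E.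
rewrite (@Ex_eq _ (Rd R d) R _ _ (fun y => expR (sqnorm a / (2 * h)) * cmw h (2 *: a) y)); last first.
  move=> y; rewrite /cmw expr2 -!expRD; congr expR; rewrite sqnormZ dotZl.
  by field; rewrite gt_eqF.
by have [i e] := noise_cmw (2 *: a) h0; rewrite ExZ// e mulr1.
Qed.

(* one step of Wang's Harnack inequality: a fraction [t] of the displacement
   [x - y] is absorbed by a Cameron-Martin shift of the Gaussian *)
Lemma heat_harnack_step h L (u U : 'rV[R]_d -> R) x y t (k : R) : 0 < h ->
  BL L u -> BL L U -> (forall z, u (z + (1 - t) *: (x - y)) ^+ 2 <= U z * k) ->
  heat h u x ^+ 2 <= heat h U y * (k * expR (t ^+ 2 * sqnorm (x - y) / (2 * h))).
Proof.
move=> h0 uL UL H; pose b := y + (1 - t) *: (x - y).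
have xE : x = b + t *: (x - y).
  by rewrite /b -addrA -scalerDl subrK scale1r addrC subrK.
have ub := BL_shift b uL; have mub := BL_meas ub; have eub := expdom_BL ub.
have [ec c2] := cmw_sqr (t *: (x - y)) h0.
have i1 : itg (N h) (fun z => u (b + z) * cmw h (t *: (x - y)) z).
  by apply: expdom_itg => //; exact: expdomM.
have [_ e1] := noise_translate h0 mub i1.
have hE : heat h u x = Ex (N h) (fun z => u (b + z) * cmw h (t *: (x - y)) z).
  by rewrite -e1; apply: (@Ex_eq _ (Rd R d) R) => z; rewrite {1}xE [z + _]addrC addrA.
have [_ CS] := Ex_CS mub (@measurable_cmw R d h _) (BL_itg_sqr (N h) ub) (expdom_itg h0 (expdomX 2 ec)).
rewrite hE (le_trans CS)// c2 sqnormZ mulrA; apply: ler_wpM2r; first exact: expR_ge0.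
have Uy := BL_itg (N h) (BL_shift y UL).
rewrite /heat mulrC -ExZ//; apply: Ex_le; [exact: BL_itg_sqr ub|exact: itgZ|].
by move=> z; rewrite [leRHS]mulrC /b addrAC; exact: H.
Qed.

(** The displacement is used up evenly over the [n + 1] steps, while the contraction keeps what is
    left from growing; [n + 1] equal squared costs then sum to [|x - y|^2] over the total time. *)
Lemma Qn_harnack h L n f x y : 0 < h -> 0 <= L -> BL L f ->
  Qn h n.+1 f x ^+ 2 <= Qn h n.+1 f y * expR (sqnorm (x - y) / (2 * (n.+1%:R * h))).
Proof.
move=> h0 L0 fL; elim: n x y => [|n IH] x y.
  have fp := prox_BL h0 L0 fL.
  have := @heat_harnack_step h L _ _ x y 1 1 h0 fp fp.
  rewrite expr1n !mul1r; apply => z; rewrite subrr scale0r addr0 mulr1 expr2 /=.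
  by have [/(_ (prox h z))/andP[a b] _] := fL; rewrite ler_piMl.
have fp := prox_BL h0 L0 (Qn_BL n.+1 h0 L0 fL).
have n1 : (n.+1%:R : R) != 0 by rewrite pnatr_eq0.
have n2 : (n.+2%:R : R) != 0 by rewrite pnatr_eq0.
(* This fraction minimises [(1 - t)^2 / (n + 1) + t^2], with minimum [1 / (n + 2)]. *)
pose t : R := n.+2%:R^-1; pose D := sqnorm (x - y).
have := @heat_harnack_step h L _ _ x y t (expR ((1 - t) ^+ 2 * D / (2 * (n.+1%:R * h)))) h0 fp fp.
rewrite -expRD (_ : _ / _ + _ / _ = D / (2 * (n.+2%:R * h))); last first.
  have E (a : R) : a != 0 -> a + 1 != 0 -> (1 - (a + 1)^-1) ^+ 2 * D / (2 * (a * h)) +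
      (a + 1)^-1 ^+ 2 * D / (2 * h) = D / (2 * ((a + 1) * h)).
    by move=> a0 a1; field; rewrite a0 a1 gt_eqF.
  by have := E _ n1; rewrite (natr1 n.+1); exact.
apply => z /=; rewrite (le_trans (IH _ (prox h z)))//.
have [/(_ (prox h z))/andP[a _] _] := Qn_BL n.+1 h0 L0 fL.
apply: ler_wpM2l => //; rewrite ler_expR; apply: ler_wpM2r.
  by rewrite invr_ge0 !mulr_ge0// ltW.
rewrite -sqnormZ -!enorm_sqr lerXn2r ?nnegrE ?enorm_ge0// (le_trans (prox_contract _ _ h0))//.
by rewrite addrAC subrr add0r.
Qed.

(** Total variance, one step at a time: each step adds at most [2 h L^2] by the Gaussian bound,
    because the function it acts on is still [L]-Lipschitz. *)
Lemma Qn_variance h L n f x : 0 < h -> 0 <= L -> BL L f ->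
  Qn h n (fun z => f z ^+ 2) x - Qn h n f x ^+ 2 <= n%:R * (2 * h * L ^+ 2).
Proof.
move=> h0 L0 fL; elim: n x => [|n IH] x; first by rewrite /Qn /= subrr mul0r.
have f2 := BL_sqr fL; have L20 : 0 <= 2 * L by rewrite mulr_ge0.
have A := BL_shift x (prox_BL h0 L20 (Qn_BL n h0 L20 f2)).
have B := prox_BL h0 L0 (Qn_BL n h0 L0 fL).
have B2 := BL_shift x (BL_sqr B).
have H := heat_var_le x h0 L0 B.
have : Qn h n.+1 (fun z => f z ^+ 2) x - heat h (fun z => Qn h n f (prox h z) ^+ 2) x <=
    n%:R * (2 * h * L ^+ 2).
  rewrite /Qn /= /Qstep /heat -ExB; [|exact: BL_itg A|exact: BL_itg B2].
  rewrite -[leRHS](Ex_cst (N h)); apply: Ex_le.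
  - by apply: itgB; [exact: BL_itg A|exact: BL_itg B2].
  - exact: itg_cst.
  - by move=> z; exact: IH.
rewrite /heat_var in H; rewrite -natr1 mulrDl mul1r.
have -> : Qn h n.+1 f x = heat h (Qn h n f \o prox h) x by [].
rewrite /= in H *; lra.
Qed.

(** Total variance again, with a random starting point: the law after [n] steps inherits a Poincare
    inequality on Lipschitz functions, with constant [K + 2 n h]. *)
Lemma Qn_Var (m : probability (Rd R d) R) (K : R) h L n f : poincare_ineq m K -> 0 <= K ->
  0 < h -> 0 <= L -> BL L f ->
  Ex m (Qn h n (fun z => f z ^+ 2)) - Ex m (Qn h n f) ^+ 2 <= (K + n%:R * (2 * h)) * L ^+ 2.
Proof.
move=> mK K0 h0 L0 fL; have QL := Qn_BL n h0 L0 fL.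
have f2 := BL_sqr fL; have L20 : 0 <= 2 * L by rewrite mulr_ge0.
have H1 := poincare_BL mK K0 L0 QL.
have : Ex m (Qn h n (fun z => f z ^+ 2)) - Ex m (fun x => Qn h n f x ^+ 2) <= n%:R * (2 * h * L ^+ 2).
  have i1 := BL_itg m (Qn_BL n h0 L20 f2); have i2 := BL_itg_sqr m QL.
  rewrite -ExB// -[leRHS](Ex_cst m); apply: Ex_le; [exact: itgB|exact: itg_cst|].
  by move=> x; exact: Qn_variance.
rewrite /Var in H1; lra.
Qed.

End proximal_chain.

Lemma integral_indicT dT (T : measurableType dT) (R : realType)
    (m : {measure set T -> \bar R}) (A : set T) :
  measurable A -> (\int[m]_x (\1_A x)%:E = m A)%E.
Proof. by move=> mA; rewrite integral_indic// setIT. Qed.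

Lemma Ex_image_measure d1 d2 (T1 : measurableType d1) (T2 : measurableType d2) (R : realType)
    (f : T1 -> T2) (mf : measurable_fun setT f) (m : {measure set T1 -> \bar R}) (g : T2 -> R) :
  measurable_fun setT g -> itg m (g \o f) -> Ex (image_measure mf m) g = Ex m (g \o f).
Proof.
move=> mg gf; congr fine; rewrite [LHS](integral_pushforward mf)//.
exact/measurable_EFinP.
Qed.

Section noise_tails.
Context {R : realType} {d : nat}.
Local Notation N h := (noise d h).

(** A common majorant for tails: on [|y| > r] and up to the factor [r^-4], it dominates 1 and
    [exp (M |y| / 2)] once [M sqrt h <= 1], yet its mean is of order [h^2], negligible against one
    step. *)
Definition tailw (h : R) (y : 'rV[R]_d) : R :=
  enorm y ^+ 4 * expR ((2 * Num.sqrt h)^-1 * enorm y).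

Lemma expdom_tailw h : 0 < h -> expdom (tailw h).
Proof.
move=> h0; apply: expdomM; first exact: expdomX expdom_enorm.
by apply: expdom_expR_enorm; rewrite invr_ge0 mulr_ge0// sqrtr_ge0.
Qed.

Lemma noise_tailw : exists2 c : R, 0 < c & forall h, 0 < h -> Ex (N h) (tailw h) <= c * h ^+ 2.
Proof.
pose K : R := 1 + \sum_(i < d) (expR (d%:R ^+ 2) + expR (d%:R ^+ 2)).
have K1 : 1 <= K.
  by rewrite lerDl sumr_ge0// => i _; apply: addr_ge0; exact: expR_ge0.
have K0 : 0 < K by exact: lt_le_trans K1.
exists (24 * (16 * K)) => [|h h0]; first by rewrite !mulr_gt0.
pose s := Num.sqrt h; have s0 : 0 < s by rewrite sqrtr_gt0.
have s2 : s ^+ 2 = h by rewrite sqr_sqrtr// ltW.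
have si0 : 0 <= s^-1 by rewrite invr_ge0 ltW.
have EK : Ex (N h) (fun y => expR (s^-1 * enorm y)) <= K.
  have iN b := expdom_itg h0 (@expdom_expR_dot R d b).
  have iS : itg (N h) (fun y => \sum_i (expR (dot ((s^-1 * d%:R) *: delta_mx 0 i) y) +
       expR (dot (- (s^-1 * d%:R) *: delta_mx 0 i) y))).
    by apply: itg_sum => i; exact: itgD (iN _) (iN _).
  apply: (@le_trans _ _ (Ex (N h) (fun y => 1 + \sum_i (expR (dot ((s^-1 * d%:R) *: delta_mx 0 i) y) +
       expR (dot (- (s^-1 * d%:R) *: delta_mx 0 i) y))))).
    apply: Ex_le; first exact: itg_expR_enorm.
      by apply: itgD => //; exact: itg_cst.
    by move=> y; exact: expR_enorm_le.
  rewrite ExD//; last exact: itg_cst.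
  rewrite Ex_cst lerD2l Ex_sum; last by move=> i; exact: itgD (iN _) (iN _).
  apply: ler_sum => i _; rewrite (ExD (iN _) (iN _)) !(noise_mgf _ h0).2 !sqnormZ sqnorm_delta.
  by rewrite sqrrN mulr1 exprMn exprVn s2 mulVKf// gt_eqF.
apply: (@le_trans _ _ (Ex (N h) (fun y => (24 * (16 * h ^+ 2)) * expR (s^-1 * enorm y)))).
  apply: Ex_le; first exact: expdom_itg (expdom_tailw h0).
    by apply: itgZ; exact: itg_expR_enorm.
  move=> y; pose q := (2 * s)^-1 * enorm y.
  have q0 : 0 <= q by rewrite mulr_ge0 ?enorm_ge0// invr_ge0 mulr_ge0// ltW.
  have := @expR_ge1Dxn R q 3 q0; rewrite (_ : 4`!%:R = 24) // => H.
  have eq4 : enorm y ^+ 4 = 16 * h ^+ 2 * q ^+ 4.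
    by rewrite /q -s2; field; rewrite gt_eqF.
  have eE : expR (s^-1 * enorm y) = expR q * expR q.
    by rewrite -expRD; congr expR; rewrite /q; field; rewrite gt_eqF.
  rewrite /tailw -/s -/q eE eq4 [leRHS]mulrA; apply: ler_wpM2r; first exact: expR_ge0.
  rewrite (_ : 24 * (16 * h ^+ 2) * expR q = 16 * h ^+ 2 * (24 * expR q)); last by ring.
  by apply: ler_wpM2l; [rewrite mulr_ge0// sqr_ge0|lra].
rewrite ExZ; last exact: itg_expR_enorm.
rewrite (_ : 24 * (16 * K) * h ^+ 2 = 24 * (16 * h ^+ 2) * K); last by ring.
by apply: ler_wpM2l => //; apply: mulr_ge0 => //; apply: mulr_ge0 => //; exact: sqr_ge0.
Qed.

Lemma noise_moment2 : exists2 c : R, 0 < c & forall h, 0 < h -> Ex (N h) (fun y => enorm y ^+ 2) <= c * h.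
Proof.
exists (2 * d%:R + 1) => [|h h0]; first by rewrite ltr_wpDl// mulr_ge0.
have iS i : itg (N h) (fun y => dot (delta_mx 0 i) y ^+ 2).
  by apply: expdom_itg => //; apply: expdomX; exact: expdom_dot.
rewrite (@Ex_eq _ (Rd R d) R _ _ (fun y => \sum_i dot (delta_mx 0 i) y ^+ 2)); last first.
  by move=> y; rewrite enorm_sqr; apply: eq_bigr => i _; rewrite dotC dot_delta.
rewrite Ex_sum// (@le_trans _ _ (\sum_(i < d) 2 * h))//.
  by apply: ler_sum => i _; have := noise_var_le (delta_mx 0 i : 'rV[R]_d) h0; rewrite sqnorm_delta mulr1.
rewrite sumr_const card_ord -[leLHS]mulr_natl; have : 0 <= d%:R :> R by []. 
by nra.
Qed.

End noise_tails.

(** * Reversibility of the Gaussian walk for Lebesgue measure *)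

Section local_invariance.
Context {R : realType} {d : nat}.
Variables (V : 'rV[R]_d -> R) (pi : probability (Rd R d) R).
Hypothesis V1 : Ck 1 V.
Hypothesis Vconvex : convex_function [set: convex_lmodType 'rV[R]_d] V.
Hypothesis piE : forall A : set (Rd R d), measurable A ->
  pi A = (\int[lebesgue_Rd d]_(x in A) (expR (- V x))%:E)%E.
Implicit Types (h L : R) (x y z v : 'rV[R]_d) (f g : 'rV[R]_d -> R).
Local Notation N h := (noise d h).
Local Notation lam := (lebesgue_Rd d).

Lemma measurable_V : measurable_fun setT (V : Rd R d -> R).
Proof. by apply: continuous_measurable_Rd; exact: (Ck_continuous V1). Qed.

Definition boltz x : R := expR (- V x).

Lemma measurable_boltz : measurable_fun setT (boltz : Rd R d -> R).
Proof. by apply: measurableT_comp => //; apply: measurable_funN; exact: measurable_V. Qed.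

Lemma integral_boltz : (\int[lam]_x (boltz x)%:E = 1)%E.
Proof. by rewrite -(piE measurableT); have H := @probability_setT _ _ _ pi; apply: H. Qed.

(* exchanges the endpoints [x] and [x + y] of a jump [(x, y)] *)
Definition swapm (p : Rd R d * Rd R d) : Rd R d * Rd R d :=
  ((p.1 : 'rV[R]_d) + p.2, - (p.2 : 'rV[R]_d)).

Lemma measurable_swapm : measurable_fun setT swapm.
Proof.
apply/measurable_fun_pairP; split.
  by apply: measurable_RdD; [exact: measurable_fst|exact: measurable_snd].
exact: (measurableT_comp (@measurable_opp R d) measurable_snd).
Qed.

(** Lebesgue measure is translation invariant and the noise is even, so a jump and its reversal have
    the same weight. *)
Lemma ge0_integral_swapm h (F : Rd R d * Rd R d -> \bar R) : 0 < h ->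
  measurable_fun setT F -> (forall p, 0 <= F p)%E ->
  (\int[lam \x N h]_p F (swapm p) = \int[lam \x N h]_p F p)%E.
Proof.
move=> h0 mF F0.
have mFs : measurable_fun setT (F \o swapm) by exact: (measurableT_comp mF measurable_swapm).
rewrite (fubini_tonelli1 _ mFs (fun p => F0 _)) (fubini_tonelli1 _ mF F0).
rewrite [LHS](fubini_tonelli _ mFs (fun p => F0 _)) [RHS](fubini_tonelli _ mF F0) /=.
pose G (y : Rd R d) := (\int[lam]_x F (x, y))%E.
have mG : measurable_fun setT G := measurable_fun_fubini_tonelli_G _ mF F0.
have G0 y : (0 <= G y)%E by exact: integral_ge0.
transitivity (\int[N h]_y G (- (y : 'rV[R]_d))%R)%E.
  apply: eq_integral => y _; rewrite /G.
  rewrite -(@ge0_integral_Rd_isometry R d 1 y (fun x => F (x, (- (y : 'rV[R]_d))%R))).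
  - by apply: eq_integral => x _; rewrite scale1r.
  - by left.
  - by apply: (measurableT_comp mF); exact: measurable_pair2.
  - by [].
transitivity (\int[image_prob (@measurable_opp R d) (N h)]_y G y)%E.
  exact/esym/(ge0_integral_image (@measurable_opp R d) (N h) mG G0).
by apply: eq_measure_integral => A mA _; exact/esym/noise_opp_measure.
Qed.

Lemma Ex_swapm h (F : Rd R d * Rd R d -> R) : 0 < h ->
  itg (lam \x N h)%E F ->
  itg (lam \x N h)%E (F \o swapm) /\ Ex (lam \x N h)%E (F \o swapm) = Ex (lam \x N h)%E F.
Proof.
move=> h0 iF; have mF := itg_meas iF.
have E A : measurable A -> (lam \x N h)%E A = image_measure measurable_swapm (lam \x N h)%E A.
  move=> mA.
  have m1 : measurable_fun setT (EFin \o \1_A : Rd R d * Rd R d -> \bar R).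
    exact/measurable_EFinP/measurable_indic.
  have i0 p : (0 <= (EFin \o \1_A : Rd R d * Rd R d -> \bar R) p)%E by rewrite lee_fin.
  transitivity (\int[lam \x N h]_p (\1_A p)%:E)%E; first exact/esym/integral_indicT.
  rewrite -(ge0_integral_swapm h0 m1 i0).
  rewrite -(ge0_integral_image measurable_swapm _ m1 i0).
  exact: (integral_indicT (image_measure measurable_swapm (lam \x N h)%E) mA).
have iF' := itg_eq_measure E iF.
have mE : measurable_fun setT (EFin \o F) by exact/measurable_EFinP.
pose G p := `|(F p)%:E|%E.
have mG : measurable_fun setT G by exact: (measurableT_comp (@abse_measurable R setT) mE).
have H := ge0_integral_swapm h0 mG (fun p => abse_ge0 _).
have iFs : itg (lam \x N h)%E (F \o swapm).
  apply/integrableP; split; first by apply/measurable_EFinP; exact: measurableT_comp mF measurable_swapm.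
  rewrite (_ : (\int[lam \x N h]_x _)%E = (\int[lam \x N h]_p G (swapm p))%E); last by apply: eq_integral.
  by rewrite H; case/integrableP : iF.
split; first exact: iFs.
exact: (etrans (esym (Ex_image_measure measurable_swapm mF iFs)) (esym (Ex_eq_measure F E))).
Qed.

End local_invariance.

(** * Approximate invariance and dissipation of the proximal chain *)

Lemma BL_osc {R : realType} {d : nat} (L : R) (f : 'rV[R]_d -> R) x y : BL L f -> `|f x - f y| <= 1.
Proof.
move=> [f01 _]; have := f01 x; have := f01 y => /andP[a1 a2] /andP[b1 b2].
by rewrite ler_norml; apply/andP; split; lra.
Qed.

Lemma expRB_osc {R : realType} (q a b : R) : 0 <= a -> 0 <= b ->
  `|expR (q - a) - expR (q - b)| <= expR q * (a + b) /\
  `|expR (q - a) - expR (q - b)| <= expR q.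
Proof.
move=> a0 b0; have q0 := expR_ge0 q.
rewrite !expRD -mulrBr normrM ger0_norm//; split; last rewrite -[leRHS]mulr1.
all: apply: ler_wpM2l => //.
all: have ea := expR_ge1Dx (- a); have eb := expR_ge1Dx (- b).
all: have ea1 : expR (- a) <= 1 by rewrite expR_le1 oppr_le0.
all: have eb1 : expR (- b) <= 1 by rewrite expR_le1 oppr_le0.
all: have ea2 := expR_ge0 (- a); have eb2 := expR_ge0 (- b).
all: by rewrite ler_norml; apply/andP; split; lra.
Qed.

Section one_step_drift.
Context {R : realType} {d : nat}.
Variable V : 'rV[R]_d -> R.
Hypothesis V1 : Ck 1 V.
Hypothesis Vconvex : convex_function [set: convex_lmodType 'rV[R]_d] V.
Implicit Types (h L : R) (x y z v : 'rV[R]_d) (f g : 'rV[R]_d -> R).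
Local Notation N h := (noise d h).

(** Square root of the ratio of the densities of [pi] at [x + y] and at [x]. Jumps of the Gaussian
    walk weighted by it are reversible for [pi], and to first order in [h] the weight acts like the
    drift. *)
Definition tilt x y : R := expR (- (V (x + y) - V x) / 2).

(** Convexity bounds [V (x + y) - V x] below by a linear form, so the weight is integrable against
    the noise however fast [V] grows. *)
Lemma tilt_le x y : tilt x y <= expR (2^-1 * (enorm (gradient V x) * enorm y)).
Proof.
rewrite ler_expR; have := subgradient V1 Vconvex x y.
by have := normr_dot_le (gradient V x) y; rewrite ler_norml => /andP[]; lra.
Qed.

Lemma measurable_tilt x : measurable_fun setT (tilt x : Rd R d -> R).
Proof.
apply: measurableT_comp => //; apply: measurable_funM => //; apply: measurable_funN.
apply: measurable_funB => //.
apply: (measurableT_comp (f := V : Rd R d -> R)).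
  by apply: continuous_measurable_Rd; exact: (Ck_continuous V1).
by apply: measurable_RdD.
Qed.

Lemma expdom_tilt x : expdom (tilt x).
Proof.
split; first exact: measurable_tilt.
exists 1, (2^-1 * enorm (gradient V x)); split => //.
  by rewrite mulr_ge0 ?enorm_ge0.
by move=> y; rewrite mul1r -mulrA ger0_norm ?expR_ge0// tilt_le.
Qed.

(** The one-step increment of the chain with the proximal drift replaced by the reversible
    weight. *)
Definition drift h g x := Ex (N h) (fun y => (g (x + y) - g x) * tilt x y).

(** Three replacements, at a cost [o(h)] uniform on the ball: the proximal step by
    [x - h grad V x + Y]; this drift by the density [cmw], exactly; then [cmw] by [tilt]. The last
    two share the factor [exp (- p . y / 2)], with [p] the gradient at [x], and differ by a term in
    [h |p|^2] and by the Bregman remainder of [V]. *)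
Lemma one_step_drift (rho L e : R) : 0 <= L -> 0 < e -> exists2 h0 : R, 0 < h0 &
  forall h g x, 0 < h -> h <= h0 -> BL L g -> enorm x <= rho ->
    `|Qstep V h g x - g x - drift h g x| <= h * e.
Proof.
move=> L0 e0.
have [M M0 HM] := gradient_bounded V1 (rho + 1).
have [c1 c10 H1] := @noise_moment1 R d.
have [c2 c20 H2] := @noise_moment2 R d.
have [c4 c40 H4] := @noise_tailw R d.
pose E := expR (M / 2); have E0 : 0 < E by exact: expR_gt0.
(* the modulus [e1] of the gradient controls both the proximal step and the Bregman remainder *)
pose K1 := L + L * E * c2 / 2 + 1.
have K10 : 0 < K1 by rewrite /K1 ltr_wpDl// addr_ge0// !mulr_ge0// ltW.
pose e1 := e / (2 * K1); have e10 : 0 < e1 by rewrite divr_gt0// mulr_gt0.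
have [del del0 Hdel] := gradient_uniform_continuous V1 rho e10.
pose r := Num.min 1 (del / 2).
have r0 : 0 < r by rewrite lt_min ltr01 divr_gt0.
have r1 : r <= 1 by rewrite ge_min lexx.
have rdel : r <= del / 2 by rewrite ge_min lexx orbT.
pose K2 := L * E * (M ^+ 2 / 2) * c1.
pose K3 := 3 * c4 / r ^+ 4.
have K20 : 0 <= K2 by rewrite !mulr_ge0 ?sqr_ge0// ltW.
have K30 : 0 <= K3 by rewrite divr_ge0 ?exprn_ge0 ?mulr_ge0// ltW.
(* A threshold for [s = sqrt h]. Its three terms give [h <= s], keep [s (M + 1)] within the radius
   [r], and absorb the errors of order [h^(3/2)] and [h^2] into [h e / 2]. *)
pose s0 := Num.min (Num.min 1 (r / (M + 1))) (e / (2 * (K2 + K3 + 1))).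
have K230 : 0 < 2 * (K2 + K3 + 1) by lra.
have M10 : 0 < M + 1 by lra.
have s00 : 0 < s0 by rewrite !lt_min ltr01 !divr_gt0.
exists (s0 ^+ 2) => [|h g x h0 hs gL xr]; first by rewrite exprn_gt0.
pose s := Num.sqrt h; have sp : 0 < s by rewrite sqrtr_gt0.
have s2 : s ^+ 2 = h by rewrite sqr_sqrtr// ltW.
have ss0 : s <= s0.
  by rewrite -(ger0_norm (ltW s00)) -sqrtr_sqr ler_sqrt// sqr_ge0.
have s1 : s <= 1 by rewrite (le_trans ss0)// !ge_min lexx.
have sM : s * (M + 1) <= r.
  by rewrite -ler_pdivlMr// (le_trans ss0)// !ge_min lexx orbT.
have se : s * (2 * (K2 + K3 + 1)) <= e.
  by rewrite -ler_pdivlMr// (le_trans ss0)// !ge_min lexx orbT.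
have hs1 : h <= s by rewrite -s2 expr2 ler_piMl// ltW.
have h1 : h <= 1 by rewrite (le_trans hs1).
have hM : h * M <= r.
  by rewrite (le_trans _ sM)// ler_pM//; [exact: ltW|lra].
have hM2 : h * M ^+ 2 <= 1.
  rewrite -s2 -exprMn exprn_ile1 ?mulr_ge0// ?(ltW sp)//.
  by rewrite (le_trans _ (le_trans sM r1))// ler_wpM2l ?(ltW sp)// lerDl.
pose p := gradient V x.
have pM : enorm p <= M by apply: HM; rewrite (le_trans xr)// lerDl.
have gx := BL_shift x gL; have gp := prox_BL V1 Vconvex h0 L0 gL.
have gpx := BL_shift x gp; have gs := BL_shift (x - h *: p) gL.
have [ecmw _] := cmw_sqr (- (h *: p)) h0.
have pE : sqnorm (- (h *: p)) = h ^+ 2 * sqnorm p.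
  by rewrite -scaleN1r !sqnormZ sqrrN expr1n mul1r.
have ew := expdom_tailw (d := d) h0.
have iw : itg (N h) (fun y : 'rV[R]_d => r ^- 4 * tailw h y) by apply: itgZ; exact: expdom_itg.
have r40 : 0 < r ^+ 4 by rewrite exprn_gt0.
have tail1 y : r < enorm y -> 1 <= r ^- 4 * (enorm y ^+ 4).
  move=> yr; rewrite mulrC ler_pdivlMr// mul1r lerXn2r ?nnegrE ?enorm_ge0 ?(ltW r0)//; exact: ltW.
have sinv : (2 * s)^-1 >= M / 2.
  by rewrite invfM [leRHS]mulrC ler_pM2r// -(ler_pM2l sp) mulfV ?gt_eqF// (le_trans _ (le_trans sM r1))// ler_wpM2l ?(ltW sp)// lerDl.
have tail2 y : r < enorm y -> expR (M / 2 * enorm y) <= r ^- 4 * tailw h y.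
  move=> yr; rewrite /tailw mulrA; apply: (@le_trans _ _ (1 * expR ((2 * s)^-1 * enorm y))).
    by rewrite mul1r ler_expR ler_wpM2r// enorm_ge0.
  by apply: ler_wpM2r; [exact: expR_ge0|exact: tail1].
have tail3 y : r < enorm y -> 1 <= r ^- 4 * tailw h y.
  move=> yr; rewrite (le_trans _ (tail2 y yr))// -expR0 ler_expR mulr_ge0 ?enorm_ge0//.
  by rewrite divr_ge0.
have tail0 y : 0 <= r ^- 4 * tailw h y.
  by rewrite mulr_ge0 ?invr_ge0 ?(ltW r40)// mulr_ge0 ?expR_ge0// exprn_ge0// enorm_ge0.
have EW : Ex (N h) (fun y => r ^- 4 * tailw h y) <= c4 / r ^+ 4 * h ^+ 2.
  rewrite ExZ; last exact: expdom_itg.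
  by rewrite mulrC [leRHS]mulrAC; apply: ler_wpM2r; [rewrite invr_ge0 ltW|exact: H4].
have A1 : `|Qstep V h g x - heat h g (x - h *: p)| <= L * h * e1 + c4 / r ^+ 4 * h ^+ 2.
  rewrite /Qstep /heat -ExB; [|exact: BL_itg gpx|exact: BL_itg gs].
  have i1 : itg (N h) (fun y => (g \o prox V h) (x + y) - g (x - h *: p + y)).
    by apply: itgB; [exact: BL_itg gpx|exact: BL_itg gs].
  rewrite (le_trans (Ex_norm i1))//.
  apply: (@le_trans _ _ (Ex (N h) (fun y => L * h * e1 + r ^- 4 * tailw h y))).
    apply: Ex_le; [exact: integrable_norm|by apply: itgD => //; exact: itg_cst|].
    move=> y /=; have [yr|yr] := leP (enorm y) r.
      rewrite ler_wpDr//; have [_ gl] := gL; rewrite (le_trans (gl _ _))// -mulrA ler_wpM2l//.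
      have -> : prox V h (x + y) - (x - h *: p + y) = h *: (p - gradient V (prox V h (x + y))).
        have := prox_subE V1 Vconvex (x + y) h0 => /esym E1.
        rewrite scalerBr E1; apply/rowP => i; rewrite !mxE; ring.
      rewrite enormZ gtr0_norm//; apply: ler_wpM2l; [exact: ltW|apply: Hdel => //].
      rewrite (le_trans (enorm_tri (x + y) _ _))// opprD addrA subrr add0r enormN (splitr del) lerD//.
        exact: le_trans rdel.
      rewrite enormC (le_trans (prox_dist V1 Vconvex _ h0))// (le_trans _ rdel)// (le_trans _ hM)//.
      apply: ler_wpM2l; [exact: ltW|apply: HM].
      by rewrite (le_trans (enormD _ _))// lerD// (le_trans yr).
    rewrite (le_trans _ (_ : r ^- 4 * tailw h y <= _))//; last first.
      by rewrite lerDr; apply: mulr_ge0; [exact: mulr_ge0 L0 (ltW h0)|exact: ltW].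
    rewrite (le_trans _ (tail3 y yr))//.
    exact: BL_osc gL.
  rewrite ExD//; last exact: itg_cst.
  by rewrite Ex_cst lerD2l.
(* Cameron-Martin turns the drift into the exponential weight [cmw] *)
have m1 : itg (N h) (cmw h (- (h *: p))) := (noise_cmw (- (h *: p)) h0).1.
have igm : itg (N h) (fun y => g (x + y) * cmw h (- (h *: p)) y).
  by apply: expdom_itg => //; apply: expdomM => //; exact: expdom_BL gx.
have A2 : heat h g (x - h *: p) - g x = Ex (N h) (fun y => (g (x + y) - g x) * cmw h (- (h *: p)) y).
  have [_ e2] := noise_translate h0 (BL_meas gx) igm.
  have -> : heat h g (x - h *: p) = Ex (N h) (fun y => g (x + y) * cmw h (- (h *: p)) y).
    by rewrite -e2; apply: (@Ex_eq _ (Rd R d) R) => y; rewrite addrA addrAC.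
  have {1}-> : g x = Ex (N h) (fun y => g x * cmw h (- (h *: p)) y).
    by rewrite ExZ// (noise_cmw _ h0).2 mulr1.
  rewrite -ExB//; last exact: itgZ.
  by apply: (@Ex_eq _ (Rd R d) R) => y; rewrite mulrBl.
have edg : expdom (fun y => g (x + y) - g x).
  by apply: expdomD; [exact: expdom_BL gx|exact: expdom_cst].
have i2 : itg (N h) (fun y => (g (x + y) - g x) * cmw h (- (h *: p)) y).
  by apply: expdom_itg => //; exact: expdomM.
have i3 : itg (N h) (fun y => (g (x + y) - g x) * tilt x y).
  by apply: expdom_itg => //; apply: expdomM => //; exact: expdom_tilt.
have LE0 : 0 <= L * E := mulr_ge0 L0 (ltW E0).
have hM20 : 0 <= h * M ^+ 2 / 2 by rewrite divr_ge0 ?mulr_ge0 ?sqr_ge0 ?(ltW h0).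
have e120 : 0 <= e1 / 2 by rewrite divr_ge0 ?(ltW e10).
have en1 : expdom (fun y : 'rV[R]_d => L * E * (h * M ^+ 2 / 2) * enorm y).
  by apply: expdomM; [exact: expdom_cst|exact: expdom_enorm].
have en2 : expdom (fun y : 'rV[R]_d => L * E * (e1 / 2) * enorm y ^+ 2).
  by apply: expdomM; [exact: expdom_cst|exact: expdomX expdom_enorm].
have A3 : `|heat h g (x - h *: p) - g x - drift h g x| <=
   L * E * (h * M ^+ 2 / 2) * (c1 * s) + L * E * (e1 / 2) * (c2 * h) + 2 * (c4 / r ^+ 4 * h ^+ 2).
  rewrite A2 /drift -ExB// (le_trans (Ex_norm (itgB i2 i3)))//.
  apply: (@le_trans _ _ (Ex (N h) (fun y => (L * E * (h * M ^+ 2 / 2) * enorm y + L * E * (e1 / 2) * enorm y ^+ 2)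
      + 2 * (r ^- 4 * tailw h y)))).
    apply: Ex_le; [by apply: integrable_norm; exact: itgB| |].
      by apply: itgD; [apply: expdom_itg => //; exact: expdomD|exact: itgZ].
    move=> y; rewrite -mulrBr normrM.
    have y0 := enorm_ge0 y.
    pose a := h * sqnorm p / 4; pose Bg := V (x + y) - V x - dot p y; pose b := Bg / 2.
    pose q := - dot p y / 2.
    have a0 : 0 <= a by rewrite divr_ge0// mulr_ge0 ?sqnorm_ge0// ltW.
    have Bg0 : 0 <= Bg by have := bregman_ge0 V1 Vconvex x y.
    have b0 : 0 <= b by rewrite divr_ge0.
    have mE : cmw h (- (h *: p)) y = expR (q - a).
      rewrite /cmw; congr expR; rewrite dotNl dotZl pE /q /a.
      by field; rewrite gt_eqF.
    have tE : tilt x y = expR (q - b).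
      by rewrite /tilt; congr expR; rewrite /q /b /Bg; field.
    have qM : q <= M / 2 * enorm y.
      have := normr_dot_le p y; rewrite ler_norml => /andP[H _].
      have H' : enorm p * enorm y <= M * enorm y by rewrite ler_wpM2r.
      by rewrite /q; move: H' H; clear; lra.
    have n1 : 0 <= L * E * (h * M ^+ 2 / 2) * enorm y.
      by apply: mulr_ge0 => //; apply: mulr_ge0.
    have n2 : 0 <= L * E * (e1 / 2) * enorm y ^+ 2.
      by apply: mulr_ge0; [apply: mulr_ge0|exact: sqr_ge0].
    have [ab1 ab2] := expRB_osc q a0 b0.
    have [yr|yr] := leP (enorm y) r; last first.
      rewrite ler_wpDl ?addr_ge0// mE tE.
      apply: (@le_trans _ _ (1 * expR q)).
        by apply: ler_pM => //; exact: BL_osc gL.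
      rewrite mul1r; apply: (@le_trans _ _ (r ^- 4 * tailw h y)).
        by rewrite (le_trans _ (tail2 y yr))// ler_expR.
      by rewrite ler_peMl// ler1n.
    rewrite ler_wpDr ?(mulr_ge0 (ler0n R 2) (tail0 y))//.
    have ab : `|expR (q - a) - expR (q - b)| <= E * (a + b).
      rewrite (le_trans ab1)//; apply: ler_wpM2r; first exact: addr_ge0.
      by rewrite ler_expR (le_trans qM)// ler_piMr// ?divr_ge0// (le_trans yr).
    have bE : b <= e1 / 2 * enorm y.
      have B3 : enorm (gradient V (x + y) - gradient V x) <= e1.
        rewrite enormC; apply: Hdel => //; rewrite opprD addrA subrr add0r enormN.
        by rewrite (le_trans yr)// (le_trans rdel)// ler_pdivrMr// ler_peMr ?(ltW del0)// ler1n.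
      have B2 : Bg <= e1 * enorm y.
        by rewrite (le_trans (bregman_le V1 Vconvex x y))// ler_wpM2r.
      by rewrite /b; move: B2; clear; lra.
    have aE : a <= h * M ^+ 2 / 2.
      have : sqnorm p <= M ^+ 2 by rewrite -enorm_sqr lerXn2r ?nnegrE ?enorm_ge0.
      move=> /(ler_wpM2l (ltW h0)) H; have H' : 0 <= h * M ^+ 2 by rewrite mulr_ge0 ?sqr_ge0// ltW.
      by rewrite /a; move: H H'; clear; lra.
    have [_ /(_ (x + y) x)] := gL; rewrite addrAC subrr add0r => gl.
    rewrite mE tE; apply: (le_trans (ler_pM (normr_ge0 _) (normr_ge0 _) gl ab)).
    rewrite [leRHS](_ : _ = L * enorm y * (E * (h * M ^+ 2 / 2 + e1 / 2 * enorm y))); last by ring.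
    apply: ler_wpM2l; first by rewrite mulr_ge0.
    by apply: ler_wpM2l; [exact: ltW|exact: lerD].
  rewrite ExD; [|by apply: expdom_itg => //; exact: expdomD|exact: itgZ].
  rewrite ExD; [|exact: expdom_itg|exact: expdom_itg].
  rewrite ExZ; last exact: expdom_itg expdom_enorm.
  rewrite ExZ; last by apply: expdom_itg => //; exact: expdomX expdom_enorm.
  rewrite (ExZ _ iw); apply: lerD; last by rewrite ler_pM2l.
  apply: lerD; apply: ler_wpM2l.
  - exact: mulr_ge0.
  - exact: H1.
  - exact: mulr_ge0.
  - exact: H2.
have -> : Qstep V h g x - g x - drift h g x =
   (Qstep V h g x - heat h g (x - h *: p)) + (heat h g (x - h *: p) - g x - drift h g x) by ring.
rewrite (le_trans (ler_normD _ _))// (le_trans (lerD A1 A3))//.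
have -> : L * h * e1 + c4 / r ^+ 4 * h ^+ 2 + (L * E * (h * M ^+ 2 / 2) * (c1 * s) +
   L * E * (e1 / 2) * (c2 * h) + 2 * (c4 / r ^+ 4 * h ^+ 2)) =
   h * ((K1 - 1) * e1 + K2 * s + K3 * h).
  by rewrite /K1 /K2 /K3; ring.
apply: ler_wpM2l; first exact: ltW.
have k1 : (K1 - 1) * e1 <= e / 2.
  have : K1 * e1 = e / 2 by rewrite /e1; field; rewrite gt_eqF.
  by rewrite mulrBl mul1r => ->; lra.
have k3 : K3 * h <= K3 * s by rewrite ler_wpM2l.
by move: se; rewrite mulrDr; lra.
Qed.

End one_step_drift.

(** * Clipping and cutoff functions *)

Section cutoff.
Context {R : realType} {d : nat}.
Implicit Types (r L : R) (x y : 'rV[R]_d).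

Definition clamp01 (a : R) : R := Num.max 0 (Num.min 1 a).

Lemma clamp01_itv a : 0 <= clamp01 a <= 1.
Proof. by rewrite /clamp01 le_max lexx ge_max ler01 ge_min lexx. Qed.

Lemma clamp01P a : [\/ a <= 0 /\ clamp01 a = 0, 0 <= a <= 1 /\ clamp01 a = a | 1 <= a /\ clamp01 a = 1].
Proof.
rewrite /clamp01; have [a1|a1] := leP 1 a.
  by apply: Or33; split => //; apply/max_idPr.
have [a0|a0] := leP a 0; first by apply: Or31; split => //; apply/max_idPl.
by apply: Or32; rewrite (ltW a0) (ltW a1); split => //; apply/max_idPr; exact: ltW.
Qed.

Lemma clamp01_dist a b : `|clamp01 a - clamp01 b| <= `|a - b|.
Proof.
have h1 := ler_norm (a - b); have h2 := ler_norm (b - a); rewrite (distrC b a) in h2.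
case: (clamp01P a) => -[a0 ->]; case: (clamp01P b) => -[b0 ->]; rewrite ler_norml.
all: by apply/andP; split; lra.
Qed.

Lemma clamp01_BL L (f : 'rV[R]_d -> R) : elip L f -> BL L (fun x => clamp01 (f x)).
Proof.
move=> fL; split => [x|x y]; first exact: clamp01_itv.
exact: le_trans (clamp01_dist _ _) (fL x y).
Qed.

(** Equal to 1 on the ball of radius [r] and to 0 outside that of radius [2 r]. The small Lipschitz
    constant [1 / r] is the point: the boundary error in the invariance of [pi] is proportional to
    it. *)
Definition cutoff r x : R := clamp01 (2 - r^-1 * enorm x).

Lemma cutoff_BL r : 0 < r -> BL r^-1 (cutoff r).
Proof.
move=> r0; apply: clamp01_BL => x y.
rewrite (_ : _ - _ = r^-1 * (enorm y - enorm x)); last by ring.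
rewrite normrM gtr0_norm ?invr_gt0//; apply: ler_wpM2l; first by rewrite invr_ge0 ltW.
by have := @enorm_elip R d y x; rewrite mul1r enormC.
Qed.

Lemma cutoff_supp r x : 0 < r -> 2 * r < enorm x -> cutoff r x = 0.
Proof.
move=> r0 xr; rewrite /cutoff /clamp01; apply/max_idPl.
rewrite ge_min; apply/orP; right; rewrite subr_le0 -ler_pdivrMl ?invr_gt0// invrK mulrC; exact: ltW.
Qed.

Lemma cutoff1 r x : 0 < r -> enorm x <= r -> cutoff r x = 1.
Proof.
move=> r0 xr; rewrite /cutoff /clamp01.
have : r^-1 * enorm x <= 1 by rewrite mulrC ler_pdivrMr// mul1r.
move=> H; have -> : Num.min 1 (2 - r^-1 * enorm x) = 1 by apply/min_idPl; lra.
by apply/max_idPr.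
Qed.

Lemma cutoff_tight (m : probability (Rd R d) R) (e : R) : 0 < e ->
  exists2 r0 : R, 0 < r0 & forall r, r0 <= r -> Ex m (fun x => 1 - cutoff r x) <= e.
Proof.
move=> e0; pose F n : set (Rd R d) := [set x | enorm (x : 'rV[R]_d) <= n.+1%:R].
have mF n : measurable (F n).
  rewrite [X in measurable X](_ : _ = setT `&` (@enorm R d : Rd R d -> R) @^-1` `]-oo, n.+1%:R]); last first.
    by apply/seteqP; split => x /=; rewrite in_itv /=; [|case].
  exact: measurable_enorm.
have FT : \bigcup_n F n = setT.
  apply/seteqP; split => // x _; exists (Num.truncn (enorm (x : 'rV[R]_d))) => //=.
  by rewrite /F /= ltW// truncnS_gt.
have ndF : nondecreasing_seq F.
  move=> i j ij; apply/subsetPset => x; rewrite /F /= => /le_trans; apply.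
  by rewrite ler_nat.
have := nondecreasing_cvg_mu mF (bigcupT_measurable _ mF) ndF (mu := m).
have mT : m (\bigcup_n F n) = 1%E by rewrite FT; have H := @probability_setT _ _ _ m; apply: H.
rewrite [X in _ --> X]mT => /fine_cvgP[_ /cvgrPdist_le/(_ e e0)[n _ /(_ n (leqnn n))]] /= nF.
have {}nF : 1 - e <= fine (m (F n)).
  by move: nF; rewrite ler_norml => /andP[_]; lra.
exists n.+1%:R => // r nr; have r0 : 0 < r by rewrite (lt_le_trans _ nr).
have [i1 Er] := Ex_indic m (mF n).
have cr := BL_itg m (cutoff_BL r0).
rewrite ExB//; last exact: itg_cst.
rewrite Ex_cst; suff : Ex m (\1_(F n)) <= Ex m (cutoff r) by rewrite Er; lra.
apply: Ex_le => // x; rewrite indicE; case: (boolP (_ \in _)) => [/set_mem xF|_] /=.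
  by rewrite cutoff1// (le_trans xF).
by have /andP[] := clamp01_itv (2 - r^-1 * enorm (x : 'rV[R]_d)).
Qed.

End cutoff.

Lemma half_double (R : realType) (a : R) : 2^-1 * (a + a) = a.
Proof. lra. Qed.

Lemma Ex_iterated d1 d2 (T1 : measurableType d1) (T2 : measurableType d2) (R : realType)
    (m1 : {sigma_finite_measure set T1 -> \bar R}) (m2 : {sigma_finite_measure set T2 -> \bar R})
    (F : T1 * T2 -> R) (G : T1 -> R) :
  itg (m1 \x m2)%E F ->
  (forall x, itg m2 (fun y => F (x, y)) /\ G x = Ex m2 (fun y => F (x, y))) ->
  itg m1 G /\ Ex m1 G = Ex (m1 \x m2)%E F.
Proof.
move=> iF FG; have E : EFin \o G = fubini_F m2 (EFin \o F).
  by apply/funext => x; rewrite /fubini_F /= (FG x).2 -Ex_EFin//; exact: (FG x).1.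
split; first by rewrite /itg E; exact: integrable_fubini_F iF.
by congr fine; apply: (etrans _ (integral12_prod_meas1 iF)); rewrite -E.
Qed.

(** * The reversible drift tested against [pi] *)

Section symmetrised_drift.
Context {R : realType} {d : nat}.
Variables (V : 'rV[R]_d -> R) (pi : probability (Rd R d) R).
Hypothesis V1 : Ck 1 V.
Hypothesis Vconvex : convex_function [set: convex_lmodType 'rV[R]_d] V.
Hypothesis piE : forall A : set (Rd R d), measurable A ->
  pi A = (\int[lebesgue_Rd d]_(x in A) (expR (- V x))%:E)%E.
Implicit Types (h L l : R) (x y z v : 'rV[R]_d) (f g chi w : 'rV[R]_d -> R).
Local Notation N h := (noise d h).
Local Notation lam := (lebesgue_Rd d).

Let piE' (A : set (Rd R d)) : measurable A -> pi A = (\int[lam]_(x in A) (boltz V x)%:E)%E.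
Proof. exact: piE. Qed.

(** Geometric mean of the Boltzmann weights at the two endpoints of a jump: invariant under [swapm],
    and equal to [boltz V x * tilt V x y]. *)
Definition gibbs2 (p : Rd R d * Rd R d) : R := expR (- (V p.1 + V ((p.1 : 'rV[R]_d) + p.2)) / 2).

Let measurable_shiftV :
  measurable_fun setT (fun p : Rd R d * Rd R d => V ((p.1 : 'rV[R]_d) + p.2)).
Proof.
apply: (measurableT_comp (measurable_V V1)).
by apply: measurable_RdD; [exact: measurable_fst|exact: measurable_snd].
Qed.

Lemma measurable_gibbs2 : measurable_fun setT gibbs2.
Proof.
apply: measurableT_comp => //; apply: measurable_funM => //; apply: measurable_funN.
apply: measurable_funD => //.
exact: (measurableT_comp (measurable_V V1) measurable_fst).
Qed.

Lemma gibbs2_le p : gibbs2 p <= 2^-1 * (boltz V p.1 + boltz V ((p.1 : 'rV[R]_d) + p.2)).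
Proof.
rewrite /gibbs2 /boltz; set a := V p.1; set b := V _.
have E (c : R) : expR (- c) = expR (- c / 2) ^+ 2 by rewrite expr2 -expRD; congr expR; field.
have -> : - (a + b) / 2 = - a / 2 + - b / 2 by field.
rewrite expRD (E a) (E b); have := sqr_ge0 (expR (- a / 2) - expR (- b / 2)).
rewrite sqrrB; lra.
Qed.

Lemma itg_boltz_noise h w : 0 < h -> itg (N h) w -> (forall y, 0 <= w y) ->
  itg (lam \x N h)%E (fun p => boltz V p.1 * w p.2) /\
  Ex (lam \x N h)%E (fun p => boltz V p.1 * w p.2) = Ex (N h) w.
Proof.
move=> h0 iw w0.
have mF : measurable_fun setT (fun p : Rd R d * Rd R d => boltz V p.1 * w p.2).
  apply: measurable_funM.
    exact: (measurableT_comp (measurable_boltz V1) measurable_fst).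
  exact: (measurableT_comp (itg_meas iw) measurable_snd).
have mE : measurable_fun setT (fun p : Rd R d * Rd R d => (boltz V p.1 * w p.2)%:E).
  by apply/measurable_EFinP.
have F0 p : (0 <= (boltz V p.1 * w p.2)%:E)%E by rewrite lee_fin mulr_ge0 ?expR_ge0.
have E : (\int[lam \x N h]_p (boltz V p.1 * w p.2)%:E)%E = (Ex (N h) w)%:E.
  have H := @fubini_tonelli1 _ _ (Rd R d) (Rd R d) R lam (N h) _ mE F0; apply: (etrans H).
  transitivity (\int[lam]_x ((boltz V x)%:E * (Ex (N h) w)%:E))%E.
    apply: eq_integral => x _; rewrite /fubini_F /= -Ex_EFin//.
    rewrite -ge0_integralZl//.
    - by apply/measurable_EFinP; exact: itg_meas iw.
    - by move=> y _; rewrite lee_fin.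
    - by rewrite lee_fin expR_ge0.
  rewrite ge0_integralZr//; first by rewrite (integral_boltz piE) mul1e.
  - by apply/measurable_EFinP; exact: measurable_boltz V1.
  - by move=> x _; rewrite lee_fin expR_ge0.
  - by rewrite lee_fin Ex_ge0.
split; last by rewrite /Ex /Rintegral; move: E => /= ->.
apply/integrableP; split; first exact: mE.
apply: (@le_lt_trans _ _ (\int[lam \x N h]_p (boltz V p.1 * w p.2)%:E)%E); last by rewrite E ltry.
apply: ge0_le_integral => //.
- exact: (measurableT_comp (@abse_measurable R setT) mE).
- by move=> p _; rewrite /= ger0_norm// mulr_ge0// expR_ge0.
Qed.

(** By the arithmetic-geometric inequality [gibbs2] is below the average of the two endpoint
    weights, and [swapm] shows that both give the same integral when [w] is even. *)
Lemma itg_gibbs2 h w : 0 < h -> itg (N h) w -> (forall y, 0 <= w y) -> (forall y, w (- y) = w y) ->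
  itg (lam \x N h)%E (fun p => gibbs2 p * w p.2) /\
  Ex (lam \x N h)%E (fun p => gibbs2 p * w p.2) <= Ex (N h) w.
Proof.
move=> h0 iw w0 wN.
have [i1 e1] := itg_boltz_noise h0 iw w0; have [i2 e2] := Ex_swapm h0 i1.
have i3 := itgZ 2^-1 (itgD i1 i2).
have le p : gibbs2 p * w p.2 <= 2^-1 * (boltz V p.1 * w p.2 + ((fun p => boltz V p.1 * w p.2) \o @swapm R d) p).
  rewrite /= wN -mulrDl mulrA; apply: ler_wpM2r => //; exact: gibbs2_le.
have i4 : itg (lam \x N h)%E (fun p => gibbs2 p * w p.2).
  apply: itg_le i3 _.
    apply: measurable_funM; first exact: measurable_gibbs2.
    exact: (measurableT_comp (itg_meas iw) measurable_snd).
  by move=> p; rewrite ger0_norm; [exact: le|apply: mulr_ge0 => //; exact: expR_ge0].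
split => //; apply: (le_trans (Ex_le i4 i3 le)).
have H1 := ExZ 2^-1 (itgD i1 i2); have H2 := ExD i1 i2.
have := etrans H1 (f_equal ( *%R 2^-1) (etrans H2 (f_equal2 +%R e1 (etrans e2 e1)))).
by move=> ->; rewrite half_double.
Qed.

(* Symmetrising over the endpoints of a jump [y] leaves a product of two increments, hence [|y|^2]. *)
Lemma drift_symmetric h L l g chi : 0 < h -> 0 <= L -> 0 <= l -> BL L g -> BL l chi ->
  itg pi (fun x => chi x * drift V h g x) /\
  `|Ex pi (fun x => chi x * drift V h g x)| <= 2^-1 * (L * l) * Ex (N h) (fun y => enorm y ^+ 2).
Proof.
move=> h0 L0 l0 gL cl.
pose Phi (p : Rd R d * Rd R d) := chi p.1 * (g ((p.1 : 'rV[R]_d) + p.2) - g p.1) * gibbs2 p.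
have madd : measurable_fun setT (fun p : Rd R d * Rd R d => ((p.1 : 'rV[R]_d) + p.2 : 'rV[R]_d) : Rd R d).
  by apply: measurable_RdD; [exact: measurable_fst|exact: measurable_snd].
have mPhi : measurable_fun setT Phi.
  apply: measurable_funM; last exact: measurable_gibbs2.
  apply: measurable_funM; first exact: (measurableT_comp (BL_meas cl) measurable_fst).
  apply: measurable_funB; first exact: (measurableT_comp (BL_meas gL) madd).
  exact: (measurableT_comp (BL_meas gL) measurable_fst).
have gib0 p : 0 <= gibbs2 p by exact: expR_ge0.
have i1 : itg (N h) (fun=> 1) by exact: itg_cst.
have iPhi : itg (lam \x N h)%E Phi.
  apply: itg_le mPhi (itg_gibbs2 h0 i1 (fun=> ler01) (fun=> erefl)).1 _ => p.
  rewrite mulr1 /Phi !normrM (ger0_norm (gib0 p)); apply: ler_piMl => //.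
  by apply: mulr_ile1 => //; [exact: BL_norm cl|exact: BL_osc gL].
have [iPs ePs] := Ex_swapm h0 iPhi.
have e2 : expdom (fun y : 'rV[R]_d => enorm y ^+ 2) by exact: expdomX expdom_enorm.
have [iK eK] := itg_gibbs2 h0 (expdom_itg h0 e2) (fun y => sqr_ge0 _)
  (fun y => f_equal (fun a => a ^+ 2) (enormN y)).
have H1 : `|Ex (lam \x N h)%E Phi| <= 2^-1 * (L * l) * Ex (N h) (fun y => enorm y ^+ 2).
  have iS := itgZ 2^-1 (itgD iPhi iPs).
  have -> : Ex (lam \x N h)%E Phi = Ex (lam \x N h)%E (fun p => 2^-1 * (Phi p + (Phi \o @swapm R d) p)).
    have A := ExZ 2^-1 (itgD iPhi iPs); have B := ExD iPhi iPs.
    have := etrans A (f_equal ( *%R 2^-1) (etrans B (f_equal (+%R _) ePs))).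
    by move=> ->; rewrite half_double.
  apply: (le_trans (Ex_norm iS)).
  have iZ := itgZ (2^-1 * (L * l)) iK.
  apply: (@le_trans _ _ (Ex (lam \x N h)%E (fun p => 2^-1 * (L * l) * (gibbs2 p * enorm (p.2 : 'rV[R]_d) ^+ 2)))).
    apply: Ex_le => //; first exact: integrable_norm.
    move=> [x y]; rewrite normrM ger0_norm ?invr_ge0// -mulrA; apply: ler_wpM2l; first by rewrite invr_ge0.
    have -> : Phi (x, y) + (Phi \o @swapm R d) (x, y) =
       (chi x - chi ((x : 'rV[R]_d) + y)) * (g ((x : 'rV[R]_d) + y) - g x) * gibbs2 (x, y).
      rewrite /Phi /gibbs2 /swapm /= addrK [V _ + V x]addrC; ring.
    rewrite !normrM (ger0_norm (gib0 _)) [gibbs2 _ * _]mulrC !mulrA.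
    apply: ler_wpM2r => //=; rewrite [leRHS](_ : _ = (l * enorm (y : 'rV[R]_d)) * (L * enorm (y : 'rV[R]_d))); last by ring.
    apply: ler_pM => //.
      by have [_ /(_ (x : 'rV[R]_d) (x + y))] := cl; rewrite opprD addrA subrr add0r enormN.
    by have [_ /(_ (x + y) (x : 'rV[R]_d))] := gL; rewrite addrAC subrr add0r.
  apply: (@le_trans _ _ (2^-1 * (L * l) * Ex (lam \x N h)%E (fun p => gibbs2 p * enorm (p.2 : 'rV[R]_d) ^+ 2))).
    by have := ExZ (2^-1 * (L * l)) iK => ->.
  by apply: ler_wpM2l => //; rewrite mulr_ge0 ?invr_ge0 ?mulr_ge0.
have edg x : expdom (fun y => (g (x + y) - g x) * tilt V x y).
  apply: expdomM; last exact: expdom_tilt V1 Vconvex x.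
  by apply: expdomD; [exact: expdom_BL (BL_shift x gL)|exact: expdom_cst].
have PhiE x y : Phi (x, y) = boltz V x * chi x * ((g (x + y) - g x) * tilt V x y).
  rewrite /Phi (_ : gibbs2 (x, y) = boltz V x * tilt V x y); first by ring.
  by rewrite /gibbs2 /boltz /tilt /= -expRD; congr expR; field.
have [iG eG] : itg lam (fun x => chi x * drift V h g x * boltz V x) /\
    Ex lam (fun x => chi x * drift V h g x * boltz V x) = Ex (lam \x N h)%E Phi.
  apply: (@Ex_iterated _ _ (Rd R d) (Rd R d) R lam (N h)) iPhi _ => x.
  rewrite (_ : (fun y => Phi (x, y)) = fun y => boltz V x * chi x * ((g (x + y) - g x) * tilt V x y)); last first.
    by apply/funext => y; exact: PhiE.
  split; first by apply: itgZ; apply: expdom_itg => //; exact: edg.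
  by rewrite ExZ; [rewrite /drift; ring|apply: expdom_itg => //; exact: edg].
(* Measurability of the drift is recovered from the integrable product with the Boltzmann weight, by
   multiplying back by [exp V]. *)
have mdr : measurable_fun setT ((fun x => chi x * drift V h g x) : Rd R d -> R).
  rewrite (_ : (fun x => _) = fun x => chi x * drift V h g x * boltz V x * expR (V x)).
    apply: measurable_funM; first exact: itg_meas iG.
    by apply: measurableT_comp => //; exact: measurable_V V1.
  by apply/funext => x; rewrite -[RHS]mulrA -expRD addNr expR0 mulr1.
have b0 x : 0 <= boltz V x by exact: expR_ge0.
have iD : itg pi (fun x => chi x * drift V h g x).
  by apply/(itg_density (measurable_boltz V1) b0 piE' mdr).
split => //.
by rewrite (Ex_density (measurable_boltz V1) b0 piE' iD) eG.
Qed.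

End symmetrised_drift.

Section local_dissipation.
Context {R : realType} {d : nat}.
Variable V : 'rV[R]_d -> R.
Hypothesis V1 : Ck 1 V.
Hypothesis Vconvex : convex_function [set: convex_lmodType 'rV[R]_d] V.
Implicit Types (h L : R) (x y : 'rV[R]_d) (g : 'rV[R]_d -> R).
Local Notation N h := (noise d h).

(* Bessel's inequality: the fluctuation of [g (prox h (x + Y))] dominates its projection on the
   linear functions of [Y], which is [2h |grad_heat h g x|^2] up to the proximal correction *)
Lemma step_variance_ge rho L e : 0 <= L -> 0 < e -> exists2 h0 : R, 0 < h0 &
  forall h g x, 0 < h -> h <= h0 -> BL L g -> enorm x <= rho ->
    2 * h * sqnorm (grad_heat h g x) <=
    Qstep V h (fun y => g y ^+ 2) x - Qstep V h g x ^+ 2 + h * e.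
Proof.
move=> L0 e0.
have [M M0 HM] := gradient_bounded V1 (rho + 1).
have [c1 c10 H1] := @noise_moment1 R d; have [c4 c40 H4] := @noise_moment4 R d.
pose K := L * M * c1 + c4.
have K0 : 0 <= K by rewrite addr_ge0 ?mulr_ge0 ?(ltW c10) ?(ltW c40).
pose K2 := 2 * L * (d%:R * K) + 1.
have K20 : 0 < K2 by rewrite ltr_wpDl// !mulr_ge0.
pose s0 := Num.min 1 (e / K2).
have s00 : 0 < s0 by rewrite lt_min ltr01 divr_gt0.
exists (s0 ^+ 2) => [|h g x h0 hs gL xr]; first by rewrite exprn_gt0.
pose s := Num.sqrt h; have sp : 0 < s by rewrite sqrtr_gt0.
have s2 : s ^+ 2 = h by rewrite sqr_sqrtr// ltW.
have ss0 : s <= s0.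
  by rewrite -(ger0_norm (ltW s00)) -sqrtr_sqr ler_sqrt// sqr_ge0.
have s1 : s <= 1 by rewrite (le_trans ss0)// ge_min lexx.
have se : s * K2 <= e by rewrite -ler_pdivlMr// (le_trans ss0)// ge_min lexx orbT.
have hs1 : h <= s by rewrite -s2 expr2 ler_piMl// ltW.
have gp := prox_BL V1 Vconvex h0 L0 gL; have gpx := BL_shift x gp; have gx := BL_shift x gL.
pose f y := g (prox V h (x + y)); pose q : 'rV[R]_d := \row_i Ex (N h) (fun y => f y * y 0 i).
pose p : 'rV[R]_d := (2 * h) *: grad_heat h g x.
have B : sqnorm q <= 2 * h * Var (N h) f.
  exact: (noise_bessel h0 (BL_meas gpx) (fun y => BL_norm y gpx)).
have ip i : itg (N h) (fun y : 'rV[R]_d => g (x + y) * y 0 i).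
  by apply: expdom_itg => //; apply: expdomM; [exact: expdom_BL gx|exact: expdom_coord].
have iq i : itg (N h) (fun y : 'rV[R]_d => f y * y 0 i).
  by apply: expdom_itg => //; apply: expdomM; [exact: expdom_BL gpx|exact: expdom_coord].
have pE i : p 0 i = Ex (N h) (fun y => g (x + y) * y 0 i).
  by rewrite !mxE mulrA mulfV ?mul1r// gt_eqF// mulr_gt0.
(* The proximal map displaces [x + Y] by at most [h M] when [|Y| <= 1]; larger noises are paid for
   by the fourth moment. *)
have qp i : `|(q - p) 0 i| <= K * (h * s).
  rewrite mxE [in X in `|_ + X|]mxE pE mxE -ExB// (le_trans (Ex_norm (itgB (iq i) (ip i))))//.
  have ie1 := expdom_itg h0 (@expdom_enorm R d).
  have ie4 := expdom_itg h0 (expdomX 4 (@expdom_enorm R d)).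
  apply: (@le_trans _ _ (Ex (N h) (fun y : 'rV[R]_d => (L * (h * M)) * enorm y + enorm y ^+ 4))).
    apply: Ex_le; [by apply: integrable_norm; exact: itgB|by apply: itgD => //; exact: itgZ|].
    move=> y; rewrite -mulrBl normrM; have y0 := enorm_ge0 y.
    have yi := coord_le_enorm y i; have hM : 0 <= L * (h * M) by rewrite !mulr_ge0// ltW.
    have [y1|y1] := leP (enorm y) 1.
      rewrite ler_wpDr ?exprn_ge0//; apply: ler_pM => //.
      have [_ gl] := gL; rewrite (le_trans (gl _ _))//; apply: ler_wpM2l => //.
      rewrite (le_trans (prox_dist V1 Vconvex _ h0))//; apply: ler_wpM2l; first exact: ltW.
      by apply: HM; rewrite (le_trans (enormD _ _))// lerD.
    rewrite ler_wpDl ?(mulr_ge0 hM y0)//; apply: (@le_trans _ _ (1 * enorm y)).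
      by apply: ler_pM => //; exact: BL_osc gL.
    by rewrite mul1r -[leLHS]expr1 ler_eXn2l.
  rewrite ExD//; last exact: itgZ.
  rewrite ExZ// /K mulrDl; apply: lerD.
    rewrite (_ : L * M * c1 * (h * s) = L * (h * M) * (c1 * s)); last by ring.
    by apply: ler_wpM2l; [rewrite !mulr_ge0// ltW|exact: H1].
  apply: (le_trans (H4 _ h0)); apply: ler_wpM2l; first exact: ltW.
  by rewrite expr2; apply: ler_wpM2l; [exact: ltW|].
have Dq : enorm (q - p) <= d%:R * (K * (h * s)).
  apply: cube_enorm_le; first by rewrite mulr_ge0 ?mulr_ge0 ?(ltW h0) ?(ltW sp).
  by move=> i; rewrite in_itv /= -ler_norml; exact: qp.
have Dp : enorm p <= 2 * h * L.
  rewrite enormZ gtr0_norm ?mulr_gt0//; apply: ler_wpM2l; first by rewrite mulr_ge0// ltW.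
  exact: enorm_grad_heat gL.
have D2 : - (2 * h * L * (d%:R * (K * (h * s)))) <= dot p (q - p).
  have := normr_dot_le p (q - p); rewrite ler_norml => /andP[+ _]; apply: le_trans.
  by rewrite lerN2; apply: ler_pM => //; exact: enorm_ge0.
have sq : sqnorm q = sqnorm p + 2 * dot p (q - p) + sqnorm (q - p).
  by rewrite -sqnormD addrC subrK.
have s0' := sqnorm_ge0 (q - p).
have sp2 : sqnorm p = (2 * h) ^+ 2 * sqnorm (grad_heat h g x) by rewrite sqnormZ.
have VE : Qstep V h (fun y => g y ^+ 2) x - Qstep V h g x ^+ 2 = Var (N h) f by [].
(* As [|p|] is of order [h] and [|q - p|] of order [h^(3/2)], the cross term is of order [h^(5/2)]:
   still [o(h)] after division by [2 h]. *)
rewrite VE -(@ler_pM2l _ (2 * h)) ?mulr_gt0//.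
apply: (@le_trans _ _ (2 * h * Var (N h) f + 2 * (2 * h * L * (d%:R * (K * (h * s)))))).
  move: B D2 s0' sp2 sq; clear.
  set a := sqnorm _; set b := sqnorm p; set c := dot _ _; set D := sqnorm (q - p); set E := _ * (_ * (K * _)).
  set F := 2 * h * Var _ _.
  rewrite (_ : 2 * h * (2 * h * _) = (2 * h) ^+ 2 * sqnorm (grad_heat h g x)); last by ring.
  move=> H2 H3 H5 <- H6; lra.
rewrite [leRHS]mulrDr lerD2l (_ : 2 * (2 * h * L * (d%:R * (K * (h * s)))) = 2 * h * (h * (s * (K2 - 1)))); last first.
  by rewrite /K2; ring.
apply: ler_wpM2l; first by rewrite mulr_ge0// ltW.
apply: ler_wpM2l; first exact: ltW.
by rewrite (le_trans _ se)//; apply: ler_wpM2l; [exact: ltW|rewrite gerBl].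
Qed.

End local_dissipation.

(** * Approximate invariance of [pi] *)

Section approximate_stationarity.
Context {R : realType} {d : nat}.
Variables (V : 'rV[R]_d -> R) (pi : probability (Rd R d) R).
Hypothesis V1 : Ck 1 V.
Hypothesis Vconvex : convex_function [set: convex_lmodType 'rV[R]_d] V.
Hypothesis piE : forall A : set (Rd R d), measurable A ->
  pi A = (\int[lebesgue_Rd d]_(x in A) (expR (- V x))%:E)%E.
Implicit Types (h L r : R) (x y z v : 'rV[R]_d) (f g : 'rV[R]_d -> R).
Local Notation N h := (noise d h).
Local Notation Q h := (Qstep V h).

(** On the ball of radius [2 r] the increment is the reversible drift up to [h e / 2]; tested
    against the cutoff, that drift has a mean of order [L h / r]. The radius is therefore chosen
    first and the step after it. *)
Lemma local_invariance L e : 0 <= L -> 0 < e -> exists2 r0 : R, 0 < r0 & forall r, r0 <= r ->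
  exists2 h0 : R, 0 < h0 & forall h g, 0 < h -> h <= h0 -> BL L g ->
    `|Ex pi (fun x => cutoff r x * (Q h g x - g x))| <= h * e.
Proof.
move=> L0 e0; have [c2 c20 H2] := @noise_moment2 R d.
have e20 : 0 < e / 2 by rewrite divr_gt0.
exists (L * c2 / e + 1) => [|r rr].
  by rewrite ltr_wpDl// divr_ge0 ?mulr_ge0 ?(ltW c20) ?(ltW e0).
have r0 : 0 < r.
  by rewrite (lt_le_trans _ rr)// ltr_wpDl// divr_ge0 ?mulr_ge0 ?(ltW c20) ?(ltW e0).
have Lr : L * c2 <= r * e.
  by rewrite -ler_pdivrMr// (le_trans _ rr)// lerDl.
have [h0 h00 H0] := one_step_drift V1 Vconvex (2 * r) L0 e20.
exists h0 => // h g hp hh gL.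
have cr := @cutoff_BL R d r r0; have Qg := Qstep_BL V1 Vconvex hp L0 gL.
have rV0 : 0 <= r^-1 by rewrite invr_ge0 ltW.
have [iD eD] := drift_symmetric V1 Vconvex piE hp L0 rV0 gL cr.
have iQ : itg pi (fun x => cutoff r x * (Q h g x - g x)).
  rewrite (_ : (fun x => _) = fun x => cutoff r x * Q h g x - cutoff r x * g x).
    by apply: itgB; [exact: BL_itg (BL_M cr Qg)|exact: BL_itg (BL_M cr gL)].
  by apply/funext => x; rewrite mulrBr.
have H1 : `|Ex pi (fun x => cutoff r x * (Q h g x - g x)) - Ex pi (fun x => cutoff r x * drift V h g x)| <= h * (e / 2).
  rewrite -ExB// -[leRHS](Ex_cst pi) (le_trans (Ex_norm (itgB iQ iD)))//.
  apply: Ex_le; [by apply: integrable_norm; exact: itgB|exact: itg_cst|].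
  move=> x; rewrite -mulrBr normrM ger0_norm; last by have /andP[] := cr.1 x.
  have [xr|xr] := leP (enorm (x : 'rV[R]_d)) (2 * r).
    apply: le_trans (H0 h g x hp hh gL xr).
    by apply: ler_piMl => //; have /andP[] := cr.1 x.
  by rewrite cutoff_supp// mul0r mulr_ge0 ?(ltW hp) ?(ltW e20).
have H3 : `|Ex pi (fun x => cutoff r x * drift V h g x)| <= h * (e / 2).
  apply: (le_trans eD); apply: (@le_trans _ _ (2^-1 * (L * r^-1) * (c2 * h))).
    by apply: ler_wpM2l; [rewrite mulr_ge0 ?invr_ge0 ?mulr_ge0|exact: H2].
  rewrite (_ : 2^-1 * (L * r^-1) * (c2 * h) = h * (2^-1 * (L * c2 / r))); last by ring.
  apply: ler_wpM2l; first exact: ltW.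
  rewrite [leRHS]mulrC; apply: ler_wpM2l; first by rewrite invr_ge0.
  by rewrite ler_pdivrMr// [leRHS]mulrC.
rewrite -[X in `|X|](subrK (Ex pi (fun x => cutoff r x * drift V h g x))).
rewrite (le_trans (ler_normD _ _))// (le_trans (lerD H1 H3))// -mulrDr.
by rewrite -splitr.
Qed.

Lemma Ex_cutoff r L f : 0 < r -> BL L f ->
  Ex pi (fun x => cutoff r x * f x) <= Ex pi f <= Ex pi (fun x => cutoff r x * f x) + Ex pi (fun x => 1 - cutoff r x).
Proof.
move=> r0 fL; have cr := @cutoff_BL R d r r0.
have i1 := BL_itg pi (BL_M cr fL); have i2 := BL_itg pi fL; have i3 := BL_itg pi (BL_compl cr).
apply/andP; split.
  apply: Ex_le => // x; have /andP[a b] := cr.1 x; have /andP[f0 f1] := fL.1 x.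
  exact: ler_piMl.
rewrite -ExD//; apply: Ex_le => //; first exact: itgD.
by move=> x; have /andP[a b] := cr.1 x; have /andP[f0 f1] := fL.1 x; nra.
Qed.

(** The one-step errors add up to at most [T e], since the iterates never leave [BL L]; tightness
    then removes the cutoff. *)
Lemma Qn_invariance L T kappa : 0 <= L -> 0 <= T -> 0 < kappa -> exists2 h0 : R, 0 < h0 &
  forall h n g, 0 < h -> h <= h0 -> n%:R * h <= T -> BL L g ->
    `|Ex pi (Qn V h n g) - Ex pi g| <= kappa.
Proof.
move=> L0 T0 k0; pose e := kappa / (2 * (T + 1)).
have T1 : 0 < 2 * (T + 1) by lra.
have e0 : 0 < e by rewrite divr_gt0.
have [r1 r10 H1] := local_invariance L0 e0.
have k20 : 0 < kappa / 2 by rewrite divr_gt0.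
have [r2 r20 H2] := cutoff_tight pi k20.
pose r := Num.max r1 r2.
have [|h0 h00 H] := H1 r; first by rewrite le_max lexx.
have rp : 0 < r by rewrite lt_max r10.
exists h0 => // h n g hp hh nT gL.
have cr := @cutoff_BL R d r rp.
have QL k := Qn_BL V1 Vconvex k hp L0 gL.
have i1 k := BL_itg pi (BL_M cr (QL k)).
have A k : `|Ex pi (fun x => cutoff r x * Qn V h k g x) - Ex pi (fun x => cutoff r x * g x)| <= k%:R * h * e.
  elim: k => [|k IH]; first by rewrite subrr normr0 !mul0r.
  have := H h _ hp hh (QL k).
  rewrite (_ : (fun x => _) = fun x => cutoff r x * Qn V h k.+1 g x - cutoff r x * Qn V h k g x); last first.
    by apply/funext => x; rewrite mulrBr.
  rewrite (ExB (i1 k.+1) (i1 k)) => S.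
  rewrite -(subrK (Ex pi (fun x => cutoff r x * Qn V h k g x)) (Ex pi (fun x => cutoff r x * Qn V h k.+1 g x))).
  rewrite -addrA (le_trans (ler_normD _ _))// (le_trans (lerD S IH))//.
  by rewrite -natr1 !mulrDl mul1r addrC.
have {}A : `|Ex pi (fun x => cutoff r x * Qn V h n g x) - Ex pi (fun x => cutoff r x * g x)| <= kappa / 2.
  apply: (le_trans (A n)); apply: (@le_trans _ _ (T * e)); first by rewrite ler_pM2r.
  have : e * (2 * (T + 1)) = kappa by rewrite /e divfK// gt_eqF.
  by lra.
have c2 : Ex pi (fun x => 1 - cutoff r x) <= kappa / 2 by apply: H2; rewrite le_max lexx orbT.
have := Ex_cutoff rp (QL n); have := Ex_cutoff rp gL; move: A; rewrite !ler_norml.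
move: c2; clear; set a := Ex _ _; set b := Ex _ _; set c := Ex _ _; set D := Ex _ _; set E := Ex _ _.
by move=> ? /andP[? ?] /andP[? ?] /andP[? ?]; apply/andP; split; lra.
Qed.

End approximate_stationarity.

Lemma sqr_le_add (R : realType) (a b k : R) : 0 <= a <= 1 -> 0 <= b <= 1 -> 0 <= k -> b - a <= k ->
  b ^+ 2 <= a ^+ 2 + 2 * k.
Proof. by move=> /andP[a0 a1] /andP[b0 b1] k0 ba; nra. Qed.

(** * Exponential decay of the variance under [pi] *)

Section variance_decay.
Context {R : realType} {d : nat}.
Variables (V : 'rV[R]_d -> R) (pi : probability (Rd R d) R) (C : R).
Hypothesis V1 : Ck 1 V.
Hypothesis Vconvex : convex_function [set: convex_lmodType 'rV[R]_d] V.
Hypothesis piE : forall A : set (Rd R d), measurable A ->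
  pi A = (\int[lebesgue_Rd d]_(x in A) (expR (- V x))%:E)%E.
Hypothesis C0 : 0 < C.
Hypothesis piC : poincare_ineq pi C.
Implicit Types (h L r : R) (x y z v : 'rV[R]_d) (f g : 'rV[R]_d -> R).
Local Notation N h := (noise d h).
Local Notation Q h := (Qstep V h).

(** Poincare bounds the variance by the squared gradient of [heat h g], and [step_variance_ge]
    converts [2 h] times that gradient term into the fluctuation averaged out in one step. Outside
    the ball the gradient is only known to be at most [L], which tightness absorbs. *)
Lemma variance_dissipation L e : 0 <= L -> 0 < e -> exists2 r0 : R, 0 < r0 & forall r, r0 <= r ->
  exists2 h0 : R, 0 < h0 & forall h g, 0 < h -> h <= h0 -> BL L g ->
    2 * h * Var pi g <=
    C * (Ex pi (fun x => cutoff r x * (Q h (fun y => g y ^+ 2) x - Q h g x ^+ 2)) + h * e).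
Proof.
move=> L0 e0; have [c c0 Hc] := @heat_dist R d.
have e30 : 0 < e / 3 by rewrite divr_gt0.
have K0 : 0 < 2 * L ^+ 2 + 1 by rewrite ltr_wpDl// mulr_ge0 ?sqr_ge0.
have [r0 r00 Hr] := cutoff_tight pi (divr_gt0 e30 K0).
exists r0 => // r rr; have rp : 0 < r by exact: lt_le_trans rr.
have [h1 h10 H1] := step_variance_ge V1 Vconvex (2 * r) L0 e30.
pose K := 8 * (L * c) + 1; have Kp : 0 < K by rewrite ltr_wpDl// !mulr_ge0// ltW.
pose s0 := C * (e / 3) / K; have s00 : 0 < s0 by rewrite divr_gt0// mulr_gt0.
exists (Num.min h1 (s0 ^+ 2)) => [|h g hp]; first by rewrite lt_min h10 exprn_gt0.
rewrite le_min => /andP[hh1 hs] gL.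
pose s := Num.sqrt h; have sp : 0 < s by rewrite sqrtr_gt0.
have ss0 : s <= s0.
  by rewrite -(ger0_norm (ltW s00)) -sqrtr_sqr ler_sqrt// sqr_ge0.
have sK : s * K <= C * (e / 3) by rewrite -ler_pdivlMr.
have L20 : 0 <= 2 * L by rewrite mulr_ge0.
have cr := @cutoff_BL R d r rp; have Qg := Qstep_BL V1 Vconvex hp L0 gL.
have Qg2 := Qstep_BL V1 Vconvex hp L20 (BL_sqr gL); have Q2g := BL_sqr Qg.
set W := Ex pi _.
have iW : itg pi (fun x => cutoff r x * (Q h (fun y => g y ^+ 2) x - Q h g x ^+ 2)).
  rewrite (_ : (fun x => _) = fun x => cutoff r x * Q h (fun y => g y ^+ 2) x - cutoff r x * Q h g x ^+ 2).
    by apply: itgB; [exact: BL_itg (BL_M cr Qg2)|exact: BL_itg (BL_M cr Q2g)].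
  by apply/funext => x; rewrite mulrBr.
have iS := itg_sqnorm_grad_heat pi L0 hp gL.
have i1 := BL_itg pi (BL_compl cr).
pose S := Ex pi (fun x => sqnorm (grad_heat h g x)).
have E1 : 2 * h * S <= W + h * (e / 3) + 2 * h * L ^+ 2 * Ex pi (fun x => 1 - cutoff r x).
  rewrite -(ExZ _ iS) -(ExZ _ i1) -[h * (e / 3)](Ex_cst pi).
  have ic := itg_cst pi (h * (e / 3)).
  rewrite -(ExD iW ic) -(ExD (itgD iW ic) (itgZ _ i1)).
  apply: Ex_le; [exact: itgZ|by apply: itgD (itgD iW ic) _; exact: itgZ|].
  move=> x; have /andP[a b] := cr.1 x.
  have le1 := @sqnorm_grad_heat_le R d h L g x L0 hp gL.
  have le0 := sqnorm_ge0 (grad_heat h g x).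
  set w := _ - _ ^+ 2.
  have X1 : 2 * h * ((1 - cutoff r x) * sqnorm (grad_heat h g x)) <= 2 * h * ((1 - cutoff r x) * L ^+ 2).
    by apply: ler_wpM2l; [rewrite mulr_ge0// ltW|apply: ler_wpM2l => //; rewrite subr_ge0].
  have X2 : cutoff r x * (2 * h * sqnorm (grad_heat h g x)) <= cutoff r x * w + h * (e / 3).
    have [xr|xr] := leP (enorm (x : 'rV[R]_d)) (2 * r).
      apply: (le_trans (ler_wpM2l a (H1 h g x hp hh1 gL xr))); rewrite mulrDr lerD2l.
      by apply: ler_piMl => //; rewrite mulr_ge0 ?(ltW hp) ?(ltW e30).
    by rewrite cutoff_supp// !mul0r add0r mulr_ge0 ?(ltW hp) ?(ltW e30).
  by move: X1 X2; rewrite /=; clear; lra.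
have E2 := poincare_heat piC L0 hp gL.
have dist x : `|g x - heat h g x| <= L * (c * s) by rewrite distrC; exact: Hc.
have E3 := Var_dist pi gL (heat_BL h gL) dist.
have E4 : 2 * L ^+ 2 * Ex pi (fun x => 1 - cutoff r x) <= e / 3.
  have t0 : 0 <= Ex pi (fun x => 1 - cutoff r x).
    by apply: Ex_ge0 => x; have := cr.1 x; lra.
  have := Hr r rr; rewrite ler_pdivlMr// => H; apply: le_trans H.
  by rewrite mulrC ler_wpM2l// lerDl.
rewrite -/S in E2.
have F1 : 2 * h * S <= W + h * (e / 3) + h * (e / 3).
  apply: (le_trans E1); rewrite lerD2l (_ : 2 * h * L ^+ 2 * _ = h * (2 * L ^+ 2 * Ex pi (fun x => 1 - cutoff r x))); last by ring.
  by apply: ler_wpM2l; first exact: ltW.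
have F2 : 2 * h * (4 * (L * (c * s))) <= h * (C * (e / 3)).
  rewrite (_ : 2 * h * _ = h * (s * (K - 1))); last by rewrite /K; ring.
  apply: ler_wpM2l; first exact: ltW.
  by rewrite (le_trans _ sK)//; apply: ler_wpM2l; [exact: ltW|rewrite gerBl].
have F3 : 2 * h * Var pi (heat h g) <= C * (2 * h * S).
  rewrite [leRHS](_ : _ = 2 * h * (C * S)); last by ring.
  by apply: ler_wpM2l => //; rewrite mulr_ge0// ltW.
have F4 := ler_wpM2l (ltW C0) F1.
have F5 : 2 * h * Var pi g <= 2 * h * (Var pi (heat h g) + 4 * (L * (c * s))).
  by apply: ler_wpM2l => //; rewrite mulr_ge0// ltW.
move: F2 F3 F4 F5; clear; lra.
Qed.

Lemma BL_mean L f : BL L f -> 0 <= Ex pi f <= 1.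
Proof.
move=> fL; apply/andP; split; first by apply: Ex_ge0 => x; have /andP[] := fL.1 x.
rewrite -(Ex_cst pi 1); apply: Ex_le; [exact: BL_itg fL|exact: itg_cst|].
by move=> x; have /andP[] := fL.1 x.
Qed.

(** Dissipation subtracted from the approximate invariance for [g^2] gives
    [a (k + 1) <= (1 - q) a k + q kappa / 2] with [q = 2 h / C], and [1 - q <= exp (- q)]. The
    factor 1/4 bounds the variance of a function with values in [0, 1]. *)
Lemma Qn_decay L T kappa : 0 <= L -> 0 <= T -> 0 < kappa -> exists2 h0 : R, 0 < h0 &
  forall h n f, 0 < h -> h <= h0 -> n%:R * h <= T -> BL L f ->
    Ex pi (fun x => (Qn V h n f x - Ex pi f) ^+ 2) <= expR (- (2 / C * (n%:R * h))) / 4 + kappa.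
Proof.
move=> L0 T0 k0; have L20 : 0 <= 2 * L by rewrite mulr_ge0.
have k8 : 0 < kappa / 8 by rewrite divr_gt0.
have k4 : 0 < kappa / 4 by rewrite divr_gt0.
pose e := kappa / 4 / C; have e0 : 0 < e by rewrite divr_gt0.
have eC : C * e = kappa / 4 by rewrite mulrC divfK// gt_eqF.
have [h1 h10 H1] := Qn_invariance V1 Vconvex piE L0 T0 k8.
have [r2 r20 H2] := local_invariance V1 Vconvex piE L20 e0.
have [r3 r30 H3] := variance_dissipation L0 e0.
have [r4 r40 H4] := cutoff_tight pi k4.
pose r := Num.max r2 (Num.max r3 r4).
have rr2 : r2 <= r by rewrite le_max lexx.
have rr3 : r3 <= r by rewrite !le_max lexx orbT.
have rr4 : r4 <= r by rewrite !le_max lexx !orbT.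
have {H2}[h2 h20 H2] := H2 r rr2; have {H3}[h3 h30 H3] := H3 r rr3.
have {}H4 := H4 r rr4; have rp : 0 < r by exact: lt_le_trans rr2.
(* The bound [C / 2] keeps [q] at most 1, so that the recursion has a nonnegative factor. *)
exists (Num.min (Num.min h1 h2) (Num.min h3 (C / 2))) => [|h n f hp].
  by rewrite !lt_min h10 h20 h30 divr_gt0.
rewrite !le_min => /andP[/andP[hh1 hh2] /andP[hh3 hC]] nT fL.
set m := Ex pi f; have /andP[m0 m1] : 0 <= m <= 1 := BL_mean fL.
have cr := @cutoff_BL R d r rp.
pose g k := Qn V h k f; have gL k : BL L (g k) := Qn_BL V1 Vconvex k hp L0 fL.
(* Recentred by the fixed [m^2], since the mean of an iterate is only known to stay within
   [kappa / 8] of [m]. *)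
pose a k := Ex pi (fun x => cutoff r x * g k x ^+ 2) - m ^+ 2.
pose q := 2 * h / C; have q0 : 0 <= q by rewrite divr_ge0 ?mulr_ge0 ?(ltW hp) ?(ltW C0).
have q1 : q <= 1 by rewrite ler_pdivrMr// mul1r; move: hC; rewrite ler_pdivlMr// mulrC.
have qC : q * C = 2 * h by rewrite divfK// gt_eqF.
have mean k : (k <= n)%N -> `|Ex pi (g k) - m| <= kappa / 8.
  move=> kn; apply: H1 => //; rewrite (le_trans _ nT)//; apply: ler_wpM2r; first exact: ltW.
  by rewrite ler_nat.
have step k : (k < n)%N -> a k.+1 <= (1 - q) * a k + q * (kappa / 2).
  move=> kn; have mk := mean k (ltnW kn).
  have A := H2 h _ hp hh2 (BL_sqr (gL k)).
  have B := H3 h _ hp hh3 (gL k).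
  have Qg2 := Qstep_BL V1 Vconvex hp L20 (BL_sqr (gL k)).
  have i1 := BL_itg pi (BL_M cr Qg2); have i2 := BL_itg pi (BL_M cr (BL_sqr (gL k))).
  have i3 := BL_itg pi (BL_M cr (BL_sqr (gL k.+1))).
  have EA : Ex pi (fun x => cutoff r x * (Q h (fun y => g k y ^+ 2) x - g k x ^+ 2)) =
     Ex pi (fun x => cutoff r x * Q h (fun y => g k y ^+ 2) x) - Ex pi (fun x => cutoff r x * g k x ^+ 2).
    by rewrite -ExB//; apply: (@Ex_eq _ (Rd R d) R) => x; rewrite mulrBr.
  have EB : Ex pi (fun x => cutoff r x * (Q h (fun y => g k y ^+ 2) x - Q h (g k) x ^+ 2)) =
     Ex pi (fun x => cutoff r x * Q h (fun y => g k y ^+ 2) x) - Ex pi (fun x => cutoff r x * g k.+1 x ^+ 2).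
    by rewrite -ExB//; apply: (@Ex_eq _ (Rd R d) R) => x; rewrite mulrBr.
  rewrite EA in A; rewrite EB in B.
  have /andP[G _] := Ex_cutoff pi rp (BL_sqr (gL k)).
  have /andP[M0 M1] := BL_mean (gL k).
  have VE : Var pi (g k) = Ex pi (fun x => g k x ^+ 2) - Ex pi (g k) ^+ 2 by [].
  rewrite VE in B; rewrite /a; move: A B G M0 M1 mk.
  set X := Ex pi (fun x => cutoff r x * Q h _ x); set Y := Ex pi (fun x => cutoff r x * g k x ^+ 2).
  set Z := Ex pi (fun x => cutoff r x * g k.+1 x ^+ 2); set G2 := Ex pi (fun x => g k x ^+ 2).
  set G1 := Ex pi (g k); rewrite -qC !ler_norml => /andP[_ A] B G M0 M1 /andP[_ mk].
  have {}B : q * (G2 - G1 ^+ 2) <= X - Z + h * e.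
    by rewrite -(ler_pM2l C0) mulrA (mulrC C q).
  have G12 : G1 ^+ 2 <= m ^+ 2 + 2 * (kappa / 8).
    by apply: sqr_le_add => //; [exact/andP|exact/andP|exact: ltW].
  have C1 : q * (Y - m ^+ 2 - 2 * (kappa / 8)) <= q * (G2 - G1 ^+ 2).
    by apply: ler_wpM2l => //; lra.
  have C2 : 2 * (h * e) = q * (kappa / 4) by rewrite -eC mulrA mulrA qC; ring.
  move: A B C1 C2; clear; lra.
have claim k : (k <= n)%N -> a k <= expR (- (2 / C * (k%:R * h))) / 4 + kappa / 2.
  elim: k => [_|k IH kn].
    rewrite mul0r mulr0 oppr0 expR0; have /andP[G _] := Ex_cutoff pi rp (BL_sqr fL).
    have F : Ex pi (fun x => f x ^+ 2) <= m.
      apply: Ex_le; [exact: BL_itg_sqr fL|exact: BL_itg fL|].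
      by move=> x; have /andP[f0 f1] := fL.1 x; rewrite expr2 ler_piMl.
    have : m - m ^+ 2 <= 1 / 4 by have := sqr_ge0 (m - 2^-1); rewrite sqrrB; lra.
    move: G F k0; rewrite /a /g /Qn /=; clear; lra.
  have {}IH := IH (ltnW kn); apply: (le_trans (step k kn)).
  have IH' : (1 - q) * a k <= (1 - q) * (expR (- (2 / C * (k%:R * h))) / 4 + kappa / 2).
    by apply: ler_wpM2l => //; rewrite subr_ge0.
  have -> : expR (- (2 / C * (k.+1%:R * h))) = expR (- q) * expR (- (2 / C * (k%:R * h))).
    by rewrite -expRD; congr expR; rewrite /q -natr1; ring.
  have eq : (1 - q) * expR (- (2 / C * (k%:R * h))) <= expR (- q) * expR (- (2 / C * (k%:R * h))).
    by apply: ler_wpM2r; [exact: expR_ge0|exact: expR_ge1Dx].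
  move: IH' eq; clear; lra.
have {claim}cn := claim n (leqnn n); have mn := mean n (leqnn n).
have /andP[_ G] := Ex_cutoff pi rp (BL_sqr (gL n)).
have -> : Ex pi (fun x => (Qn V h n f x - m) ^+ 2) = Ex pi (fun x => g n x ^+ 2) - 2 * m * Ex pi (g n) + m ^+ 2.
  rewrite (VarE m (BL_itg pi (gL n)) (BL_itg_sqr pi (gL n))) /Var; ring.
move: cn mn G; rewrite /a ler_norml => cn /andP[mn _] G.
have : m * (m - kappa / 8) <= m * Ex pi (g n) by apply: ler_wpM2l => //; lra.
have : m * (kappa / 8) <= kappa / 8 by apply: ler_piMl => //; exact: ltW.
move: cn G H4; clear; lra.
Qed.

End variance_decay.

(** * The Langevin process and its implicit Euler scheme *)

Section pi_systems.
Context dT (T : measurableType dT) (R : realType).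
Local Open Scope ereal_scope.

Lemma pi_system_unique (m1 m2 : {measure set T -> \bar R}) (G : set (set T)) :
  setI_closed G -> (forall A, G A -> measurable A) ->
  m1 setT = m2 setT -> m1 setT \is a fin_num ->
  (forall A, G A -> m1 A = m2 A) -> forall A, <<s G >> A -> m1 A = m2 A.
Proof.
move=> GI Gm mT fT GE A GA.
pose H := [set A : set T | measurable A /\ m1 A = m2 A].
suff : <<s G >> `<=` H by move=> /(_ A GA)[].
rewrite -setI_closed_g_dynkin_g_sigma_algebra//; apply: smallest_sub; last first.
  by move=> C GC; split; [exact: Gm|exact: GE].
have compl (m : {measure set T -> \bar R}) C : measurable C -> m setT \is a fin_num ->
    m (~` C) = m setT - m C.
  move=> mC fm; rewrite -(setvU C) measureU//; last 2 first.
  - exact: measurableC.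
  - by rewrite setICl.
  rewrite addeK// ge0_fin_numE// (@le_lt_trans _ _ (m setT))//.
    by apply: le_measure; rewrite ?inE.
  by rewrite ltey_eq fm.
split; first by split.
  move=> C [mC EC]; split; first exact: measurableC.
  by rewrite !compl// -?mT// EC.
move=> F tF HF; split; first by apply: bigcupT_measurable => i; exact: (HF i).1.
rewrite !measure_bigcup//; try by move=> i _; exact: (HF i).1.
by apply: eq_eseriesr => i _; exact: (HF i).2.
Qed.

(** Both sides, as functions of [A], are finite measures of total mass [P E] that agree on the
    pi-system. *)
Lemma indep_sigma (P : probability T R) (G : set (set T)) (E : set T) :
  setI_closed G -> (forall A, G A -> measurable A) -> measurable E ->
  (forall A, G A -> P (A `&` E) = P E * P A) ->
  forall A, <<s G >> A -> P (A `&` E) = P E * P A.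
Proof.
move=> GI Gm mE GE A GA.
have pT := @probability_setT _ _ _ P.
have PE0 : (0 <= fine (P E))%R by rewrite fine_ge0.
have fE : P E = (fine (P E))%:E by rewrite fineK// fin_num_measure.
have sE C : mscale (NngNum PE0) P C = P E * P C by rewrite [in RHS]fE.
have rE C : mrestr P mE C = P (C `&` E) by [].
rewrite -sE; apply: (@pi_system_unique (mrestr P mE) (mscale (NngNum PE0) P) G GI Gm) => //.
- by apply: (etrans (rE setT)); rewrite [RHS]sE pT mule1 setTI.
- by rewrite (_ : _ setT = P E) ?fin_num_measure//; apply: (etrans (rE setT)); rewrite setTI.
- by move=> C GC; apply: (etrans (rE C)); rewrite [RHS]sE; exact: GE.
Qed.

End pi_systems.

Section brownian_increments.
Context {R : realType} {d : nat}.

Definition boxes : set (set (Rd R d)) := [set C | exists2 A : 'I_d -> set R,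
  forall i, measurable (A i) & C = [set v | forall i, A i ((v : 'rV[R]_d) 0 i)]].

Lemma boxes_setI_closed : setI_closed boxes.
Proof.
move=> _ _ [A mA ->] [A' mA' ->]; exists (fun i => A i `&` A' i).
  by move=> i; exact: measurableI.
by apply/seteqP; split => v /=; [move=> [a a'] i; split|move=> a; split => i; case: (a i)].
Qed.

(** The identity from the sigma-algebra of boxes to the Borel one is measurable because its
    coordinates are. *)
Lemma boxes_generate (A : set (Rd R d)) : measurable A -> <<s boxes >> A.
Proof.
move=> mA.
have mid : measurable_fun setT (fun v : g_sigma_algebraType boxes => (v : 'rV[R]_d) : Rd R d).
  apply: measurable_fun_Rd => i _ C mC; rewrite setTI; apply: sub_sigma_algebra.
  exists (fun j => if j == i then C else setT); first by move=> j; case: ifP.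
  apply/seteqP; split => v /= => [vC j|/(_ i)]; last by rewrite eqxx.
  by case: eqP => // ->.
by have := mid measurableT _ mA; rewrite setTI.
Qed.

End brownian_increments.

Section euler_scheme.
Context {R : realType} {d : nat}.
Variable V : 'rV[R]_d -> R.
Hypothesis V1 : Ck 1 V.
Hypothesis Vconvex : convex_function [set: convex_lmodType 'rV[R]_d] V.
Variable eta : nat -> R.
Hypothesis eta0 : forall j, 0 < eta j.

(** The steps vary because three time spans of unrelated lengths are later cut into equal steps and
    concatenated. *)
Definition grid k : R := \sum_(j < k) eta j.

Lemma gridS k : grid k.+1 = grid k + eta k.
Proof. by rewrite /grid big_ord_recr. Qed.

Lemma grid_ge0 k : 0 <= grid k.
Proof. by apply: sumr_ge0 => j _; exact: ltW. Qed.

Lemma grid_homo : {homo grid : i j / (i <= j)%N >-> i <= j}.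
Proof. by apply: homo_leq => [x //|x y z|k]; [exact: le_trans|rewrite gridS lerDl ltW]. Qed.

Lemma measurable_prox h : 0 < h ->
  measurable_fun setT ((fun z => prox V h z : 'rV[R]_d) : Rd R d -> Rd R d).
Proof.
move=> h0; apply: measurable_fun_Rd => i; apply: continuous_measurable_Rd.
apply: (@elip_continuous _ _ 1) => x y; rewrite mul1r.
rewrite (_ : _ - _ = (prox V h x - prox V h y) 0 i); last by rewrite !mxE.
by rewrite (le_trans (coord_le_enorm _ _))// prox_contract.
Qed.

Fixpoint euler (T : Type) (x : T -> 'rV[R]_d) (D : nat -> T -> 'rV[R]_d) k : T -> 'rV[R]_d :=
  if k is k'.+1 then fun w => prox V (eta k') (euler x D k' w + Num.sqrt 2 *: D k' w) else x.

Lemma measurable_euler dT (T : measurableType dT) (x : T -> 'rV[R]_d) D k :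
  measurable_fun setT (x : T -> Rd R d) ->
  (forall j, (j < k)%N -> measurable_fun setT (D j : T -> Rd R d)) ->
  measurable_fun setT (euler x D k : T -> Rd R d).
Proof.
move=> mx; elim: k => // k IH mD.
apply: (measurableT_comp (measurable_prox (eta0 k))).
apply: measurable_RdD; first by apply: IH => j jk; apply: mD; exact: ltnW.
by apply: measurable_RdZ; exact: mD.
Qed.

(** The kernel of the last step is the first to act on [f]: conditioning runs backwards in time. *)
Fixpoint Qgrid k f : 'rV[R]_d -> R := if k is k'.+1 then Qgrid k' (Qstep V (eta k') f) else f.

Context {dO : measure_display} {Omega : measurableType dO}.
Variables (P : probability Omega R) (mu0 : probability (Rd R d) R).
Variables (B : R -> Omega -> 'rV[R]_d) (X0 : Omega -> 'rV[R]_d).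
Hypothesis hB : standard_brownian_motion P B.
Hypothesis mX0 : measurable_fun setT (X0 : Omega -> Rd R d).
Hypothesis hX0 : independent_of_process P X0 B.
Hypothesis lawX0 : forall A : set (Rd R d), measurable A -> pushforward P (X0 : Omega -> Rd R d) A = mu0 A.
Local Open Scope ereal_scope.

Definition incr k w := (B (grid k.+1) w - B (grid k) w)%R.

Lemma measurable_B k : measurable_fun setT (B (grid k) : Omega -> Rd R d).
Proof. by case: hB => + _ _ _ _; apply; exact: grid_ge0. Qed.

Lemma measurable_incr k : measurable_fun setT (incr k : Omega -> Rd R d).
Proof. by apply: measurable_RdB; exact: measurable_B. Qed.

Lemma measurable_preimageT dT (T : measurableType dT) (f : T -> Rd R d) A :
  measurable_fun setT f -> measurable A -> measurable [set w | A (f w)].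
Proof. by move=> mf mA; have := mf measurableT _ mA; rewrite setTI. Qed.

Lemma incr_law k (A : set (Rd R d)) : measurable A ->
  P [set w | A (Num.sqrt 2 *: incr k w)%R] = noise d (eta k) A.
Proof.
move=> mA.
have mA' : measurable [set v : Rd R d | A (Num.sqrt 2 *: (v : 'rV[R]_d))%R].
  exact: measurable_preimageT (@measurable_scale R d (Num.sqrt 2)) mA.
apply: (@pi_system_unique _ _ R (image_prob (measurable_incr k) P) (@gauss R d (eta k)) boxes
  (@boxes_setI_closed R d)); last exact: boxes_generate.
- by move=> _ [C mC ->]; exact: measurable_Rd_box.
- have H1 := @probability_setT _ _ _ (image_prob (measurable_incr k) P).
  have H2 := @probability_setT _ _ _ (@gauss R d (eta k)).
  exact: (etrans H1 (esym H2)).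
- exact: fin_num_measure.
- move=> _ [C mC ->]; case: hB => _ _ _ + _.
  have := gauss_box (eta k) mC => gE.
  move=> /(_ (grid k) (grid k.+1)); rewrite grid_ge0 gridS ltrDl eta0 => /(_ isT _ mC).
  by rewrite (addrAC (grid k)) subrr add0r -gridS => E; exact: (etrans E (esym gE)).
Qed.

Lemma measurable_forall_ord dT (T : measurableType dT) n (F : 'I_n -> set T) :
  (forall i, measurable (F i)) -> measurable [set w | forall i, F i w].
Proof.
move=> mF; rewrite (_ : mkset _ = \bigcap_(i in [set: 'I_n]) F i).
  by apply: fin_bigcap_measurable => [|i _]; [exact: finite_finset|exact: mF].
by apply/seteqP; split => w /= H i //; exact: H.
Qed.

(** Independence of [X0] is assumed against cylinders of [B]; [indep_sigma] extends it to the
    sigma-algebra generated by those on the grid, which contains the events on increments. *)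
Lemma incr_indep0 n (A0 : set (Rd R d)) (A : 'I_n -> set (Rd R d)) :
  measurable A0 -> (forall i, measurable (A i)) ->
  P [set w | A0 (X0 w) /\ forall i, A i (incr i w)] =
  P [set w | A0 (X0 w)] * \prod_(i < n) P [set w | A i (incr i w)].
Proof.
move=> mA0 mA.
pose G := [set C : set Omega | exists2 A : 'I_n.+1 -> set (Rd R d), forall i, measurable (A i) &
  C = [set w | forall i, A i (B (grid i) w)]].
have GI : setI_closed G.
  move=> _ _ [C mC ->] [C' mC' ->]; exists (fun i => C i `&` C' i).
    by move=> i; exact: measurableI.
  by apply/seteqP; split => v /=; [move=> [a a'] i; split|move=> a; split => i; case: (a i)].
have Gm C : G C -> measurable C.
  move=> [A' mA' ->]; apply: measurable_forall_ord => i.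
  by apply: measurable_preimageT => //; exact: measurable_B.
have mBG i : (i <= n)%N -> measurable_fun setT (B (grid i) : g_sigma_algebraType G -> Rd R d).
  move=> ni _ C mC; rewrite setTI; apply: sub_sigma_algebra.
  exists (fun j => if j == i :> nat then C else setT); first by move=> j; case: ifP.
  apply/seteqP; split => w /= => [wC j|/(_ (Ordinal (ni : i < n.+1)%N))]; last by rewrite eqxx.
  by case: eqP => // ->.
have mE : measurable [set w | A0 (X0 w)] by exact: measurable_preimageT.
have ind := indep_sigma GI Gm mE.
have {}ind C : <<s G >> C -> P (C `&` [set w | A0 (X0 w)]) = P [set w | A0 (X0 w)] * P C.
  apply: ind => _ [C' mC' ->].
  rewrite -(hX0 (t := fun i : 'I_n.+1 => grid i) (fun i => grid_ge0 i) mA0 mC').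
  by congr (P _); rewrite setIC.
rewrite (_ : mkset _ = [set w | forall i, A i (incr i w)] `&` [set w | A0 (X0 w)]); last by rewrite setIC.
rewrite ind.
  by congr (_ * _); case: hB => _ _ _ _; apply => //; [exact: grid_ge0|exact: grid_homo].
apply: (@measurable_forall_ord _ (g_sigma_algebraType G) n (fun i => [set w | A i (incr i w)])) => i.
apply: measurable_preimageT => //; apply: measurable_RdB; apply: mBG => //; exact: ltnW.
Qed.

Lemma incr_indep n (A0 : set (Rd R d)) (A : nat -> set (Rd R d)) :
  measurable A0 -> (forall i, measurable (A i)) ->
  P [set w | A0 (X0 w) /\ forall i, (i < n)%N -> A i (incr i w)] =
  P [set w | A0 (X0 w)] * \prod_(i < n) P [set w | A i (incr i w)].
Proof.
move=> mA0 mA; rewrite -(@incr_indep0 n A0 (fun i => A i))//; congr (P _).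
apply/seteqP; split => w /= [wA0 H]; split => // i; first exact: H.
by move=> ni; exact: (H (Ordinal ni)).
Qed.

(** The state after [k] steps is a measurable function of [X0] and the first [k] increments;
    rectangles in these form a pi-system, on which [incr_indep] gives independence from the next
    increment. *)
Lemma euler_step_indep k (A A' : set (Rd R d)) : measurable A -> measurable A' ->
  P [set w | A (euler X0 incr k w) /\ A' (Num.sqrt 2 *: incr k w)%R] =
  P [set w | A (euler X0 incr k w)] * noise d (eta k) A'.
Proof.
move=> mA mA'.
pose G := [set C : set Omega | exists A0 : set (Rd R d), exists2 A : nat -> set (Rd R d),
  measurable A0 /\ (forall i, measurable (A i)) &
  C = [set w | A0 (X0 w) /\ forall i, (i < k)%N -> A i (incr i w)]].
have GI : setI_closed G.
  move=> _ _ [C0 [C [mC0 mC] ->]] [C0' [C' [mC0' mC'] ->]].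
  exists (C0 `&` C0'), (fun i => C i `&` C' i).
    by split => [|i]; exact: measurableI.
  apply/seteqP; split => w /=.
    by move=> [[a1 a2] [b1 b2]]; split => // i ik; split; [exact: a2|exact: b2].
  by move=> [[a1 b1] H]; split; split => // i ik; case: (H i ik).
have Gm C : G C -> measurable C.
  move=> [C0 [C' [mC0 mC'] ->]].
  rewrite (_ : mkset _ = [set w | C0 (X0 w)] `&` [set w | forall i : 'I_k, C' i (incr i w)]).
    apply: measurableI; first exact: measurable_preimageT.
    by apply: measurable_forall_ord => i; apply: measurable_preimageT => //; exact: measurable_incr.
  apply/seteqP; split => w /= [H0 H]; split => // i; first exact: H.
  by move=> ik; exact: (H (Ordinal ik)).
pose A2 : set (Rd R d) := [set v : Rd R d | A' (Num.sqrt 2 *: (v : 'rV[R]_d))%R].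
have mA2 : measurable A2 by exact: measurable_preimageT (@measurable_scale R d (Num.sqrt 2)) mA'.
have mE : measurable [set w | A2 (incr k w)].
  by apply: measurable_preimageT => //; exact: measurable_incr.
have ind : forall C, <<s G >> C -> P (C `&` [set w | A2 (incr k w)]) = P [set w | A2 (incr k w)] * P C.
  apply: indep_sigma => // _ [C0 [C [mC0 mC] ->]].
  pose C' i := if i == k then A2 else C i.
  have mC' i : measurable (C' i) by rewrite /C'; case: ifP.
  rewrite (_ : _ `&` _ = [set w | C0 (X0 w) /\ forall i, (i < k.+1)%N -> C' i (incr i w)]); last first.
    apply/seteqP; split => w /=.
      move=> [[w0 wC] w2]; split => // i; rewrite ltnS leq_eqVlt /C'.
      by case: eqP => [->//|_ /= ik]; exact: wC.
    move=> [w0 wC]; split; last by have := wC k (leqnn _); rewrite /C' eqxx.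
    by split => // i ik; have := wC i (ltnW ik); rewrite /C' ltn_eqF.
  rewrite !incr_indep// big_ord_recr /= /C' eqxx muleA muleC.
  congr (_ * (_ * _)); apply: eq_bigr => i _; rewrite ltn_eqF//.
have mS : measurable_fun setT (euler X0 incr k : g_sigma_algebraType G -> Rd R d).
  apply: measurable_euler => [_ C mC|j jk _ C mC]; rewrite setTI; apply: sub_sigma_algebra.
    exists C, (fun=> setT) => //.
    by apply/seteqP; split => w //= [].
  exists setT, (fun i => if i == j then C else setT); first by split => // i; case: ifP.
  apply/seteqP; split => w /= => [wC|[_ /(_ j jk)]]; last by rewrite eqxx.
  by split => // i ik; case: eqP => // ->.
have := ind _ (measurable_preimageT mS mA); rewrite muleC => H; apply: (etrans H).
by congr (_ * _); exact: incr_law.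
Qed.

Lemma measurable_chain k : measurable_fun setT (euler X0 incr k : Omega -> Rd R d).
Proof. by apply: measurable_euler => // j _; exact: measurable_incr. Qed.

(** The last step is peeled off: independence makes the joint law of state and noise a product
    measure, and integrating out the noise by Fubini produces [Qstep]. *)
Lemma euler_law k L f : (0 <= L)%R -> BL L f ->
  Ex P (fun w => f (euler X0 incr k w)) = Ex mu0 (Qgrid k f).
Proof.
move=> L0; elim: k f => [|k IH] f fL /=.
  have E := Ex_image mX0 (BL_meas fL) (image_itg (BL_meas fL) (BL_itg (image_prob mX0 P) fL)).
  rewrite -[LHS]E; apply: Ex_eq_measure; exact: lawX0.
have QL := Qstep_BL V1 Vconvex (eta0 k) L0 fL.
rewrite -IH//; set h := eta k; set S := euler X0 incr k.
have mS : measurable_fun setT (S : Omega -> Rd R d) := measurable_chain k.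
have mY : measurable_fun setT ((fun w => Num.sqrt 2 *: incr k w)%R : Omega -> Rd R d).
  by apply: measurable_RdZ; exact: measurable_incr.
have fp := prox_BL V1 Vconvex (eta0 k) L0 fL.
pose F (p : Rd R d * Rd R d) : R := f (prox V h ((p.1 : 'rV[R]_d) + p.2)).
have mF : measurable_fun setT F.
  apply: (measurableT_comp (BL_meas fp)).
  by apply: measurable_RdD; [exact: measurable_fst|exact: measurable_snd].
have F1 p : (`|F p| <= 1)%R by exact: BL_norm fp.
have mSY : measurable_fun setT ((fun w => (S w, Num.sqrt 2 *: incr k w)%R) : Omega -> Rd R d * Rd R d).
  exact/measurable_fun_pairP.
have bF (m : probability (Rd R d * Rd R d)%type R) : itg m F by apply: bdm_itg; split => //; exists 1%R.
have E1 := Ex_image mSY mF (image_itg mF (bF (image_prob mSY P))).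
have E2 : Ex (image_prob mSY P) F = Ex (image_prob mS P \x noise d h) F.
  apply: Ex_eq_measure => A mA; apply/esym/product_measure_unique => // A1 A2 mA1 mA2.
  exact: euler_step_indep.
have E3 := @Ex_prod _ _ (Rd R d) (Rd R d) R (image_prob mS P) (noise d h) F 1 mF F1.
have E4 := Ex_image mS (BL_meas QL) (image_itg (BL_meas QL) (BL_itg (image_prob mS P) QL)).
exact: (etrans (esym E1) (etrans E2 (etrans E3 E4))).
Qed.

End euler_scheme.

(** * Pathwise convergence of the implicit scheme *)

Section path_error.
Context {R : realType}.

Lemma segment_uniform_continuous (f : R -> R) (T e : R) : {within `[0, T], continuous f} -> 0 < e ->
  exists2 del : R, 0 < del & forall r, 0 < r -> r <= del -> forall s t,
    0 <= s <= T -> 0 <= t <= T -> `|s - t| <= r -> `|f s - f t| <= e.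
Proof.
move=> /subspace_continuousP cf e0; have e20 : 0 < e / 2 by rewrite divr_gt0.
have /compact_near_coveringP/near_covering_withinP cK := @segment_compact R 0 T.
pose P (r : R) s := forall t, 0 <= t <= T -> `|s - t| <= r -> `|f s - f t| <= e.
have : \forall r \near (0 : R)^'+, `[0, T]%classic `<=` P r.
  apply: cK => s0 s0T.
  have : \forall t \near within `[0, T] (nbhs s0), `|f s0 - f t| < e / 2.
    by have /cvgrPdist_lt/(_ _ e20) := cf _ s0T.
  move=> /nbhs_ballP[r /= r0 H]; have r20 : 0 < r / 2 by rewrite divr_gt0.
  exists (ball s0 (r / 2), [set q | q < r / 2]) => /=.
    by split; [exact: nbhsx_ballx|exact: nbhs_right_lt].
  move=> [s q] /= [s0s qr] sT t tT st.
  have tb : ball s0 r t.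
    rewrite (splitr r); apply: ball_triangle s0s _.
    by rewrite -ball_normE /=; exact: le_lt_trans qr.
  have sb : ball s0 r s by apply: le_ball s0s; rewrite ler_pdivrMr// ler_peMr ?(ltW r0)// ler1n.
  rewrite -(subrK (f s0) (f s)) -addrA (le_trans (ler_normD _ _))// (splitr e) lerD//.
    by rewrite distrC ltW// H.
  by rewrite ltW// H//= in_itv.
move=> H.
have [r /= r0 {}H] : exists2 r : R, 0 < r & forall s : R, ball (0 : R) r s -> 0 < s -> `[0, T]%classic `<=` P s.
  by move: H; rewrite near_withinE => /nbhs_ballP[r r0 H]; exists r.
exists (r / 2) => [|q q0 qr s t sT tT st]; first by rewrite divr_gt0.
have sT' : `[0, T]%classic s by rewrite /= in_itv.
apply: (H q _ q0 s sT' t tT st).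
rewrite -ball_normE /= sub0r normrN gtr0_norm//.
by rewrite (le_lt_trans qr)// gtr_pMr// invf_lt1// ltr1n.
Qed.

(** Error of the right-endpoint rule, the quadrature that matches an implicit scheme. *)
Lemma Rintegral_increment (f : R -> R) (T e s t : R) : {within `[0, T], continuous f} ->
  0 <= s -> s <= t -> t <= T -> (forall u, s <= u -> u <= t -> `|f u - f t| <= e) ->
  `|(t - s) * f t - (\int[lebesgue_measure]_(u in `[0, t]) f u - \int[lebesgue_measure]_(u in `[0, s]) f u)|
    <= (t - s) * e.
Proof.
move=> cf s0 st tT fe.
have it : (@lebesgue_measure R).-integrable `[0, t] (EFin \o f).
  apply: continuous_compact_integrable; first exact: segment_compact.
  by apply: continuous_subspaceW cf => u /=; rewrite !in_itv /= => /andP[-> /le_trans]; exact.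
have := @Rintegral_itvB R f (BLeft 0) (BRight t) s it; rewrite !bnd_simp => /(_ s0 st) E.
rewrite [X in _ * _ - X]E.
have ist : (@lebesgue_measure R).-integrable `]s, t] (EFin \o f).
  apply: integrableS it => //.
  by move=> u /=; rewrite !in_itv /= => /andP[/ltW su ->]; rewrite (le_trans s0).
have mu : fine (@lebesgue_measure R `]s, t]) = t - s.
  rewrite lebesgue_measure_itv /= lte_fin; have [->|st'] := eqVneq s t; first by rewrite ltxx subrr.
  by rewrite lt_neqAle st' st.
have ic (c : R) : (@lebesgue_measure R).-integrable `]s, t] (EFin \o cst c).
  have i2 : (@lebesgue_measure R).-integrable `[s, t] (EFin \o cst c).
    apply: continuous_compact_integrable; first exact: segment_compact.
    exact/continuous_subspaceT/cst_continuous.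
  apply: integrableS i2 => //.
  by move=> u /=; rewrite !in_itv /= => /andP[/ltW -> ->].
have C (c : R) : \int[lebesgue_measure]_(u in `]s, t]) c = (t - s) * c.
  by rewrite Rintegral_cst// mulrC; congr (_ * _); exact: mu.
have U : \int[lebesgue_measure]_(u in `]s, t]) f u <= (t - s) * (f t + e).
  rewrite -C; apply: le_Rintegral => //; first exact: ic.
  move=> u /=; rewrite in_itv /= => /andP[/ltW su ut]; have := fe u su ut.
  by rewrite ler_distl => /andP[].
have Lw : (t - s) * (f t - e) <= \int[lebesgue_measure]_(u in `]s, t]) f u.
  rewrite -C; apply: le_Rintegral => //; first exact: ic.
  move=> u /=; rewrite in_itv /= => /andP[/ltW su ut]; have := fe u su ut.
  by rewrite ler_distl => /andP[].
by rewrite distrC ler_distl -mulrBr -mulrDr Lw U.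
Qed.

End path_error.

Section path_convergence.
Context {R : realType} {d : nat}.
Variable V : 'rV[R]_d -> R.
Hypothesis V1 : Ck 1 V.
Hypothesis Vconvex : convex_function [set: convex_lmodType 'rV[R]_d] V.

Lemma prox_unique h x z : 0 < h -> x + h *: gradient V x = z -> prox V h z = x.
Proof.
move=> h0 xz; have := proxE V1 Vconvex z h0; set p := prox V h z => pz.
have E : p - x = - (h *: (gradient V p - gradient V x)).
  by apply/eqP; rewrite -subr_eq0 opprK scalerBr addrACA -opprD pz xz subrr.
apply/eqP; rewrite -subr_eq0; apply/eqP/enorm_eq0.
have := gradient_monotone V1 Vconvex p x.
rewrite -(pmulr_rge0 _ h0) -dotZl -[h *: _]opprK -E dotNl dotvv oppr_ge0 => le0.
by apply/eqP; rewrite /enorm sqrtr_eq0.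
Qed.

Lemma gradient_path_continuous T (x : R -> 'rV[R]_d) i :
  {within `[0, +oo[, continuous x} -> {within `[0, T], continuous (fun s => gradient V (x s) 0 i)}.
Proof.
move=> cx.
have cp : continuous (partial i V) by exact: Ck_continuous (Ck_partial i V1).
have cx' : {within `[0, T], continuous x}.
  by apply: continuous_subspaceW cx => s /=; rewrite !in_itv /= andbT => /andP[].
rewrite (_ : (fun s => _) = partial i V \o x); last by apply/funext => s; rewrite /= mxE.
move/subspace_continuousP : cx' => cx'; apply/subspace_continuousP => s sT.
exact: (cvg_comp _ _ (cx' s sT) (cp (x s))).
Qed.

(** The exact path is itself a trajectory of the scheme, perturbed at each step by the quadrature
    error [rho]. The proximal map being a contraction, these errors merely add up: no Gronwall
    factor and no Lipschitz bound on the gradient. *)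
Lemma euler_path_error (T e : R) (b x : R -> 'rV[R]_d) : 0 < e -> langevin_path V b x ->
  exists2 del : R, 0 < del & forall eta n (S : nat -> 'rV[R]_d),
    (forall j, 0 < eta j) -> (forall j, eta j <= del) -> grid eta n <= T ->
    S 0 = x 0 ->
    (forall k, S k.+1 = prox V (eta k) (S k + Num.sqrt 2 *: (b (grid eta k.+1) - b (grid eta k)))) ->
    enorm (S n - x (grid eta n)) <= d%:R * (T * e).
Proof.
move=> e0 [cx xE].
have [del del0 Hdel] : exists2 r, 0 < r & forall (i : 'I_d) r', 0 < r' -> r' <= r -> forall s t,
    0 <= s <= T -> 0 <= t <= T -> `|s - t| <= r' -> `|gradient V (x s) 0 i - gradient V (x t) 0 i| <= e.
  have H (i : 'I_d) := segment_uniform_continuous (@gradient_path_continuous T x i cx) e0.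
  exact: (ord_common_radius H).
exists del => // eta n S eta0 etad gT S0 SE.
have claim k : (k <= n)%N -> enorm (S k - x (grid eta k)) <= d%:R * (grid eta k * e).
  elim: k => [_|k IH kn]; first by rewrite /grid big_ord0 S0 subrr enorm0 mul0r mulr0.
  have {}IH := IH (ltnW kn); set t := grid eta k in IH; set t' := grid eta k.+1; set h := eta k.
  have t0 : 0 <= t := grid_ge0 eta0 k.
  have t'E : t' = t + h by exact: gridS.
  have h0 : 0 < h := eta0 k.
  have tt' : t <= t' by rewrite t'E lerDl ltW.
  have t'T : t' <= T by rewrite (le_trans (grid_homo eta0 kn)).
  pose rho : 'rV[R]_d := \row_i (h * gradient V (x t') 0 i -
     (\int[lebesgue_measure]_(s in `[0, t']) gradient V (x s) 0 i -
      \int[lebesgue_measure]_(s in `[0, t]) gradient V (x s) 0 i)).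
  have rhoE : enorm rho <= d%:R * (h * e).
    apply: cube_enorm_le; first by rewrite mulr_ge0 ?(ltW h0) ?(ltW e0).
    move=> i; rewrite in_itv /= -ler_norml mxE.
    have hE : h = t' - t by rewrite t'E addrAC subrr add0r.
    rewrite hE; apply: (Rintegral_increment (@gradient_path_continuous T x i cx)) => // u tu ut'.
    apply: (Hdel i del) => //; rewrite ?lexx //.
    - by rewrite (le_trans t0 tu) (le_trans ut').
    - by rewrite (le_trans t0 tt').
    - rewrite distrC ger0_norm ?subr_ge0// (le_trans _ (etad k))// -/h hE.
      by rewrite lerD2l lerN2.
  (* Adding [h] times the gradient at the right endpoint to the integral equation turns it into the
     proximal equation. *)
  have xt' : x t' = prox V h (x t + Num.sqrt 2 *: (b t' - b t) + rho).
    apply/esym/(prox_unique h0); rewrite {1}(xE t' (le_trans t0 tt')) {1}(xE t t0).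
    by apply/rowP => i; rewrite !mxE; ring.
  have -> : S k.+1 - x t' = prox V h (S k + Num.sqrt 2 *: (b t' - b t)) -
     prox V h (x t + Num.sqrt 2 *: (b t' - b t) + rho) by rewrite SE -xt'.
  rewrite (le_trans (prox_contract V1 Vconvex _ _ h0))//.
  have -> : S k + Num.sqrt 2 *: (b t' - b t) - (x t + Num.sqrt 2 *: (b t' - b t) + rho) = (S k - x t) - rho.
    by apply/rowP => i; rewrite !mxE; ring.
  rewrite (le_trans (enormB _ _))// (le_trans (lerD IH rhoE))//.
  by rewrite t'E mulrDl mulrDr.
rewrite (le_trans (claim n (leqnn n)))//; apply: ler_wpM2l => //.
by apply: ler_wpM2r => //; exact: ltW.
Qed.

End path_convergence.

Section process_limit.
Context {R : realType} {d : nat}.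
Variables (V : 'rV[R]_d -> R) (mu0 : probability (Rd R d) R).
Hypothesis V1 : Ck 1 V.
Hypothesis Vconvex : convex_function [set: convex_lmodType 'rV[R]_d] V.
Context {dO : measure_display} {Omega : measurableType dO}.
Variables (P : probability Omega R) (B X : R -> Omega -> 'rV[R]_d).
Hypothesis hX : langevin_dynamics P V mu0 B X.

Let mX t : 0 <= t -> measurable_fun setT (X t : Omega -> Rd R d).
Proof. by case: hX => _ _ + _ _; exact. Qed.

Let S eta := euler V eta (X 0) (incr eta B).

Lemma euler_expectation eta n L f : (forall j, 0 < eta j) -> 0 <= L -> BL L f ->
  Ex P (fun w => f (S eta n w)) = Ex mu0 (Qgrid V eta n f).
Proof.
move=> eta0 L0 fL; case: hX => hB ind _ law _.
by apply: euler_law fL => //; exact: mX.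
Qed.

Lemma measurable_scheme eta n : (forall j, 0 < eta j) ->
  measurable_fun setT (S eta n : Omega -> Rd R d).
Proof. by move=> eta0; case: hX => hB _ _ _ _; exact: (measurable_chain V1 Vconvex eta0 hB (mX (lexx 0))). Qed.

(** The pathwise mesh is random, while [del] must serve all grids and all [f]. By contradiction: a
    sequence of bad grids with mesh at most [1 / (m + 1)] converges along almost every path, and
    dominated convergence refutes the fixed gap [kappa]. *)
Lemma process_limit T L kappa : 0 <= T -> 0 <= L -> 0 < kappa -> exists2 del : R, 0 < del &
  forall eta n f, (forall j, 0 < eta j) -> (forall j, eta j <= del) -> grid eta n = T -> BL L f ->
    `|Ex P (fun w => f (X T w)) - Ex mu0 (Qgrid V eta n f)| <= kappa.
Proof.
move=> T0 L0 k0; apply: contrapT => H.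
have {}H m : exists q : (nat -> R) * nat * ('rV[R]_d -> R),
    [/\ forall j, 0 < q.1.1 j, forall j, q.1.1 j <= m.+1%:R^-1, grid q.1.1 q.1.2 = T, BL L q.2 &
        kappa < `|Ex P (fun w => q.2 (X T w)) - Ex mu0 (Qgrid V q.1.1 q.1.2 q.2)|].
  apply: contrapT => Hm; apply: H; exists m.+1%:R^-1; first by rewrite invr_gt0.
  move=> eta n f eta0 etad gT fL; rewrite leNgt; apply/negP => kf; apply: Hm.
  by exists (eta, n, f).
have {H}[q Hq] := choice H.
pose eta m := (q m).1.1; pose n m := (q m).1.2; pose f m := (q m).2.
pose D m w := `|f m (X T w) - f m (S (eta m) (n m) w)|.
have fL m : BL L (f m) by case: (Hq m).
have eta0 m j : 0 < eta m j by have [H _ _ _ _] := Hq m; exact: H.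
have mf m : measurable_fun setT (fun w => f m (X T w)).
  by apply: (measurableT_comp (BL_meas (fL m))); exact: mX.
have mg m : measurable_fun setT (fun w => f m (S (eta m) (n m) w)).
  by apply: (measurableT_comp (BL_meas (fL m))); exact: measurable_scheme.
have mD m : measurable_fun setT (D m).
  by apply: measurableT_comp => //; exact: measurable_funB.
have D1 m w : `|D m w| <= 1 by rewrite /D normr_id; exact: BL_osc (fL m).
have Dk m : kappa < Ex P (D m).
  have [_ _ _ _ /lt_le_trans] := Hq m; apply.
  have b1 : itg P (fun w => f m (X T w)).
    by apply: bdm_itg; split => //; exists 1 => w; exact: BL_norm (fL m).
  have b2 : itg P (fun w => f m (S (eta m) (n m) w)).
    by apply: bdm_itg; split => //; exists 1 => w; exact: BL_norm (fL m).
  rewrite -(euler_expectation _ (eta0 m) L0 (fL m)) -ExB//.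
  exact: Ex_norm (itgB b1 b2).
have cv : {ae P, forall w, setT w -> (D m w)%:E @[m --> \oo] --> 0%E}.
  case: hX => _ _ _ _; apply: filterS => w Lw _.
  apply/fine_cvgP; split; first exact: nearW.
  apply/cvgrPdist_le => e e0.
  pose K := L * (d%:R * T) + 1; have K0 : 0 < K by rewrite ltr_wpDl// !mulr_ge0.
  have eK : 0 < e / K by rewrite divr_gt0.
  have [del del0 Hd] := euler_path_error V1 Vconvex T eK Lw.
  pose M := (Num.truncn del^-1).+1.
  exists M => // m /= Mm; rewrite sub0r normrN /= normr_id; have [_ _ gT _ _] := Hq m.
  have [_ /(_ (S (eta m) (n m) w) (X T w))] := fL m; rewrite distrC => fl.
  rewrite (le_trans fl)//.
  have := Hd (eta m) (n m) (fun k => S (eta m) k w) (eta0 m).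
  rewrite gT => err.
  apply: (@le_trans _ _ (L * (d%:R * (T * (e / K))))).
    apply: ler_wpM2l => //; apply: err => // j.
    have [_ + _ _ _] := Hq m => /(_ j) /le_trans; apply.
    rewrite invf_ple ?posrE//; apply: (@le_trans _ _ M%:R); last by rewrite ler_nat (leq_trans Mm).
    by rewrite ltW// truncnS_gt.
  rewrite (_ : L * _ = (K - 1) * (e / K)); last by rewrite /K; ring.
  rewrite -[leRHS](divfK (lt0r_neq0 K0)) [leRHS]mulrC; apply: ler_wpM2r; first exact: ltW.
  by rewrite gerBl.
have i1 : P.-integrable setT (EFin \o (fun=> 1%R) : Omega -> \bar R) by exact: itg_cst.
have m0 : measurable_fun setT (cst 0%E : Omega -> \bar R) by exact: measurable_cst.
have mDE m : measurable_fun setT (EFin \o D m) by exact/measurable_EFinP.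
have dom : {ae P, forall w m, setT w -> (`|(EFin \o D m) w| <= (EFin \o (fun=> 1%R)) w)%E}.
  by apply: aeW => w m _; rewrite /= lee_fin.
have [_ _] := dominated_convergence measurableT mDE m0 cv i1 dom.
rewrite integral0 => /fine_cvgP[_ /cvgrPdist_lt/(_ _ k0)[N _ /(_ N (leqnn N))]].
rewrite sub0r normrN /= => HN; have := Dk N.
by rewrite ltNge (le_trans (ler_norm _))// ltW.
Qed.

End process_limit.

(** * The mixing window *)

Section events.
Context dT (T : measurableType dT) (R : realType) (m : probability T R).

Lemma measurable_ge (f : T -> R) (a : R) : measurable_fun setT f -> measurable [set x | a <= f x].
Proof.
move=> mf; rewrite (_ : mkset _ = setT `&` f @^-1` `[a, +oo[); first exact: mf.
by rewrite setTI; apply/seteqP; split => x /=; rewrite in_itv /= andbT.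
Qed.

Lemma markov_event (f : T -> R) (a : R) : measurable_fun setT f -> (forall x, 0 <= f x <= 1) ->
  a * fine (m [set x | a <= f x]) <= Ex m f.
Proof.
move=> mf f01; have [i1 <-] := Ex_indic m (measurable_ge a mf).
have fi : itg m f by apply: bdm_itg; split => //; exists 1 => x; rewrite ger0_norm; have /andP[] := f01 x.
rewrite -ExZ//; apply: Ex_le => //; first exact: itgZ.
move=> x; rewrite indicE; case: (boolP (_ \in _)) => [/set_mem /= ax|_]; rewrite ?mulr1 ?mulr0//.
by have /andP[] := f01 x.
Qed.

Lemma reverse_markov (f : T -> R) (a : R) : 0 <= a -> measurable_fun setT f -> (forall x, 0 <= f x <= 1) ->
  Ex m f - a <= fine (m [set x | a <= f x]).
Proof.
move=> a0 mf f01; have [i1 <-] := Ex_indic m (measurable_ge a mf).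
have fi : itg m f by apply: bdm_itg; split => //; exists 1 => x; rewrite ger0_norm; have /andP[] := f01 x.
rewrite -[X in _ - X](Ex_cst m) -ExB//; last exact: itg_cst.
apply: Ex_le => //; first by apply: itgB => //; exact: itg_cst.
move=> x /=; have /andP[f0 f1] := f01 x; rewrite indicE; case: (boolP (_ \in _)) => [_|/negP H] /=; first lra.
have : f x < a by rewrite ltNge; apply/negP => af; apply: H; exact/mem_set.
by rewrite /=; lra.
Qed.

(** Whatever the mean [c], [c^2 + (1 - c)^2 >= 1/2], and each square carries a mass at least [p]. *)
Lemma two_point_variance (D : T -> R) (S Z : set T) (p : R) : measurable_fun setT D ->
  (forall x, 0 <= D x <= 1) -> measurable S -> measurable Z ->
  (forall x, S x -> D x = 0) -> (forall x, Z x -> D x = 1) -> 0 <= p ->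
  p <= fine (m S) -> p <= fine (m Z) -> p / 2 <= Var m D.
Proof.
move=> mD D01 mS mZ DS DZ p0 pS pZ.
have iD : itg m D by apply: bdm_itg; split => //; exists 1 => x; rewrite ger0_norm; have /andP[] := D01 x.
have iD2 : itg m (fun x => D x ^+ 2).
  apply: bdm_itg; split; first exact: measurable_funX.
  by exists 1 => x; have /andP[a b] := D01 x; rewrite ger0_norm ?exprn_ge0// exprn_ile1.
have [iS eS] := Ex_indic m mS; have [iZ eZ] := Ex_indic m mZ.
set c := Ex m D.
have VE : Var m D = Ex m (fun x => (D x - c) ^+ 2).
  by rewrite (VarE c iD iD2) subrr expr0n addr0.
have le : Ex m (fun x => c ^+ 2 * \1_S x + (1 - c) ^+ 2 * \1_Z x) <= Var m D.
  rewrite VE; apply: Ex_le; first by apply: itgD; exact: itgZ.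
    rewrite (_ : (fun x => _) = fun x => D x ^+ 2 - 2 * c * D x + c ^+ 2); last by apply/funext => x; ring.
    by apply: itgD; [apply: itgB => //; exact: itgZ|exact: itg_cst].
  move=> x; rewrite !indicE.
  case: (boolP (x \in S)) => [/set_mem Sx|_]; case: (boolP (x \in Z)) => [/set_mem Zx|_] /=.
  - by have := DS x Sx; rewrite DZ// => /eqP; rewrite oner_eq0.
  - by rewrite DS// sub0r sqrrN mulr1 mulr0 addr0.
  - by rewrite DZ// mulr0 mulr1 add0r.
  - by rewrite !mulr0 addr0 sqr_ge0.
apply: le_trans le; rewrite ExD; [|exact: itgZ|exact: itgZ].
rewrite !ExZ// eS eZ.
have h1 := ler_wpM2l (sqr_ge0 c) pS; have h2 := ler_wpM2l (sqr_ge0 (1 - c)) pZ.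
have h3 : p / 2 <= (c ^+ 2 + (1 - c) ^+ 2) * p.
  rewrite [leRHS]mulrC; apply: ler_wpM2l => //.
  by have := sqr_ge0 (c - 2^-1); rewrite !sqrrB; lra.
by move: h1 h2 h3; rewrite mulrDl; lra.
Qed.

End events.

Section separation.
Context {R : realType} {d : nat}.
Implicit Types (x y z : 'rV[R]_d).

Definition edist (S : set 'rV[R]_d) y : R := inf [set enorm (y - x) | x in S].

Lemma edist_le S x y : S x -> edist S y <= enorm (y - x).
Proof.
move=> Sx; apply: ge_inf; last by exists x.
by exists 0 => _ [z _ <-]; exact: enorm_ge0.
Qed.

Lemma le_edist S y (a : R) : S !=set0 -> (forall x, S x -> a <= enorm (y - x)) -> a <= edist S y.
Proof.
move=> [x Sx] H; apply: lb_le_inf; first by exists (enorm (y - x)), x.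
by move=> _ [z Sz <-]; exact: H.
Qed.

Lemma edist_elip S : S !=set0 -> elip 1 (edist S).
Proof.
move=> S0; have H y z : edist S y - edist S z <= enorm (y - z).
  rewrite lerBlDr -lerBlDl; apply: le_edist => // x Sx.
  by rewrite lerBlDl (le_trans (edist_le y Sx))// (enorm_tri z).
move=> y z; rewrite mul1r ler_norml H andbT lerNl opprB.
by rewrite (le_trans (H z y))// enormC.
Qed.

(* A bounded function satisfying a Harnack inequality cannot drop from [theta] to [tau]
   within distance [rho], so its high and low level sets are separated by a Lipschitz function. *)
Lemma harnack_separation (v : 'rV[R]_d -> R) (s theta tau rho : R) : 0 < s -> 0 < theta -> 0 < rho ->
  (forall x y, v x ^+ 2 <= v y * expR (sqnorm (x - y) / (2 * s))) ->
  tau = theta ^+ 2 * expR (- (rho ^+ 2 / (2 * s))) ->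
  (exists x, theta <= v x) ->
  exists D, [/\ BL rho^-1 D, forall x, theta <= v x -> D x = 0 & forall y, v y < tau -> D y = 1].
Proof.
move=> s0 th0 rho0 H tauE ne; pose S := [set x | theta <= v x].
have S0 : S !=set0 by case: ne => x; exists x.
exists (fun y => clamp01 (rho^-1 * edist S y)); split.
- apply: clamp01_BL => x y; rewrite -mulrBr normrM gtr0_norm ?invr_gt0//.
  apply: ler_wpM2l; first by rewrite invr_ge0 ltW.
  by have := edist_elip S0 x y; rewrite mul1r.
- move=> x vx; have : edist S x <= 0 by have := @edist_le S x x vx; rewrite subrr enorm0.
  move=> d0; rewrite /clamp01; apply/max_idPl; rewrite ge_min; apply/orP; right.
  by rewrite pmulr_rle0 ?invr_gt0.
- move=> y vy; have rd : rho <= edist S y.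
    apply: le_edist => // x vx; rewrite leNgt; apply/negP => yx.
    (* At distance less than [rho], Harnack would give [v x ^+ 2 < tau * exp (rho^2 / (2 s)) =
       theta^2], against [theta <= v x]. *)
    have := H x y; apply/negP; rewrite -ltNge.
    have sq : sqnorm (x - y) <= rho ^+ 2.
      by rewrite -enorm_sqr lerXn2r ?nnegrE ?enorm_ge0 ?(ltW rho0)// enormC ltW.
    have e1 : expR (sqnorm (x - y) / (2 * s)) <= expR (rho ^+ 2 / (2 * s)).
      by rewrite ler_expR; apply: ler_wpM2r => //; rewrite invr_ge0 mulr_ge0// ltW.
    apply: (@lt_le_trans _ _ (tau * expR (sqnorm (x - y) / (2 * s)))).
      by rewrite ltr_pM2r// expR_gt0.
    apply: (@le_trans _ _ (theta ^+ 2)).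
      rewrite -[leRHS]mulr1 tauE -mulrA; apply: ler_wpM2l; first exact: sqr_ge0.
      by rewrite -expRD -[leRHS]expR0 ler_expR addrC subr_le0 -ler_expR.
    by rewrite lerXn2r ?nnegrE ?(ltW th0)// (le_trans (ltW th0)).
  rewrite /clamp01; have -> : Num.min 1 (rho^-1 * edist S y) = 1.
    by apply/min_idPl; rewrite mulrC ler_pdivlMr// mul1r.
  by apply/max_idPr.
Qed.

End separation.

Section grid_segments.
Context {R : realType} {d : nat}.
Variable V : 'rV[R]_d -> R.
Implicit Types (eta : nat -> R) (f : 'rV[R]_d -> R) (h : R).

Lemma Qgrid_add eta a b f :
  Qgrid V eta (a + b) f = Qgrid V eta a (Qgrid V (fun j => eta (a + j)%N) b f).
Proof. by elim: b f => [|b IH] f; rewrite ?addn0// addnS /= IH. Qed.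

Lemma eq_Qgrid eta eta' k f : (forall j, (j < k)%N -> eta j = eta' j) ->
  Qgrid V eta k f = Qgrid V eta' k f.
Proof.
elim: k f => [f _|k IH f H]; first reflexivity.
rewrite /= (IH _ (fun j jk => H j (leqW jk))) (H k (leqnn _)).
reflexivity.
Qed.

Lemma Qgrid_cst h k f : Qgrid V (fun=> h) k f = Qn V h k f.
Proof.
elim: k f => [f|k IH f]; first reflexivity.
by rewrite /Qn iterSr; exact: IH.
Qed.

Lemma grid_cst h k : grid (fun=> h) k = k%:R * h.
Proof. by rewrite /grid sumr_const card_ord mulr_natl. Qed.

Definition steps3 k0 k1 h0 h1 h2 : nat -> R := fun j =>
  if (j < k0)%N then h0 else if (j < k0 + k1)%N then h1 else h2.

Lemma Qgrid_steps3 k0 k1 k2 h0 h1 h2 f :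
  Qgrid V (steps3 k0 k1 h0 h1 h2) (k0 + k1 + k2) f = Qn V h0 k0 (Qn V h1 k1 (Qn V h2 k2 f)).
Proof.
rewrite Qgrid_add Qgrid_add.
rewrite (@eq_Qgrid _ (fun=> h0)) => [|j jk]; last by rewrite /steps3 jk.
rewrite (@eq_Qgrid _ (fun=> h1) k1) => [|j jk]; last first.
  by rewrite /steps3 ltnNge leq_addr /= ltn_add2l jk.
rewrite (@eq_Qgrid _ (fun=> h2) k2) => [|j jk]; last first.
  by rewrite /steps3 -addnA ltnNge leq_addr /= ltn_add2l ltnNge leq_addr.
by rewrite !Qgrid_cst.
Qed.

Lemma grid_steps3 k0 k1 k2 h0 h1 h2 :
  grid (steps3 k0 k1 h0 h1 h2) (k0 + k1 + k2) = k0%:R * h0 + k1%:R * h1 + k2%:R * h2.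
Proof.
rewrite /grid !big_split_ord /= !mulr_natl; congr (_ + _ + _).
- rewrite (eq_bigr (fun=> h0)) ?sumr_const ?card_ord// => i _.
  by rewrite /steps3 ltn_ord.
- rewrite (eq_bigr (fun=> h1)) ?sumr_const ?card_ord// => i _.
  by rewrite /steps3 /= ltnNge leq_addr /= ltn_add2l ltn_ord.
- rewrite (eq_bigr (fun=> h2)) ?sumr_const ?card_ord// => i _.
  by rewrite /steps3 /= -addnA ltnNge leq_addr /= ltn_add2l ltnNge leq_addr.
Qed.

End grid_segments.

Section quantitative.
Context {R : realType}.

(** With [z = 1 / e], the fourth power of [2 z <= exp z]. *)
Lemma expRN_le_pow4 (e : R) : 0 < e -> expR (- (4 / e)) <= e ^+ 4 / 16.
Proof.
move=> e0; pose z := e^-1; have z0 : 0 < z by rewrite invr_gt0.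
have H : 2 * z <= expR z.
  by have := expR_ge_quadratic (ltW z0); have := sqr_ge0 (z - 1); rewrite sqrrB; lra.
have H4 : (2 * z) ^+ 4 <= expR z ^+ 4.
  by rewrite lerXn2r// nnegrE ?expR_ge0// mulr_ge0// ltW.
have -> : expR (- (4 / e)) = (expR z ^+ 4)^-1.
  by rewrite expRN -expRM_natl mulr_natl -mulr_natl.
have -> : e ^+ 4 / 16 = ((2 * z) ^+ 4)^-1 by rewrite /z; field; rewrite gt_eqF.
by rewrite lef_pV2// posrE exprn_gt0 ?expR_gt0// mulr_gt0.
Qed.

(* The relaxation over time [2(C+A)/e] beats the Harnack factor [exp(rho^2/2s)]. *)
Lemma relaxation_beats_harnack (C K0 t0 e A s r rho2 : R) :
  0 < C -> 0 < K0 -> 0 <= t0 -> 0 < e -> e <= 2^-1 ->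
  A = Num.sqrt (C * K0) + Num.sqrt (C * t0) ->
  s = (C + A) / e -> r = 2 * ((C + A) / e) -> rho2 = 8 * (K0 + 2 * t0) / e ->
  expR (- (2 / C * r)) / (4 * e) <= e * ((e / 4) ^+ 2 * expR (- (rho2 / (2 * s)))) / 2.
Proof.
move=> C0 K00 t00 e0 e2 AE sE rE rhoE.
have A0 : 0 <= A by rewrite AE addr_ge0// sqrtr_ge0.
have CA : 0 < C + A by lra.
have KA : C * (K0 + 2 * t0) <= 2 * A ^+ 2.
  have a2 : Num.sqrt (C * K0) ^+ 2 = C * K0 by rewrite sqr_sqrtr// mulr_ge0 ?ltW.
  have b2 : Num.sqrt (C * t0) ^+ 2 = C * t0 by rewrite sqr_sqrtr// mulr_ge0 ?(ltW C0).
  have ab : 0 <= Num.sqrt (C * K0) * Num.sqrt (C * t0) by rewrite mulr_ge0 ?sqrtr_ge0.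
  have ck : 0 <= C * K0 by rewrite mulr_ge0 ?(ltW C0) ?(ltW K00).
  by rewrite AE sqrrD a2 b2; lra.
have s0 : 0 < s by rewrite sE divr_gt0.
have rs : rho2 / (2 * s) = 4 * (K0 + 2 * t0) / (C + A).
  by rewrite rhoE sE; field; rewrite !gt_eqF.
(* [2 r / C] is [4 / e + 4 A / (C e)]. The Harnack exponent is at most
   [8 A^2 / (C (C + A)) <= 8 A / C], hence at most [4 A / (C e)] as [e <= 1/2]; the remaining
   [4 / e] pays for the prefactors. *)
have E1 : rho2 / (2 * s) + 4 / e <= 2 / C * r.
  have h1 : 4 * (K0 + 2 * t0) / (C + A) <= 8 * A / C.
    rewrite ler_pdivrMr// -(ler_pM2l C0) [leRHS](_ : _ = 8 * A * (C + A)); last by field; rewrite gt_eqF.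
    have : 0 <= A * C by rewrite mulr_ge0 ?(ltW C0).
    by rewrite expr2 in KA; lra.
  have h2 : 2 / C * r = 4 / e + 4 * (A / C) / e by rewrite rE; field; rewrite !gt_eqF.
  have h3 : 8 * A / C <= 4 * (A / C) / e.
    rewrite ler_pdivlMr//; have : A / C * e <= A / C * 2^-1.
      by apply: ler_wpM2l => //; rewrite divr_ge0 ?(ltW C0).
    lra.
  by rewrite rs h2; lra.
have E2 : expR (- (2 / C * r)) <= expR (- (4 / e)) * expR (- (rho2 / (2 * s))).
  by rewrite -expRD ler_expR; lra.
have E3 := ler_wpM2r (expR_ge0 (- (rho2 / (2 * s)))) (expRN_le_pow4 e0).
have g0 := expR_ge0 (- (rho2 / (2 * s))).
rewrite ler_pdivrMr ?mulr_gt0//.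
have e40 : 0 <= e ^+ 4 * expR (- (rho2 / (2 * s))) by rewrite mulr_ge0// exprn_ge0// ltW.
rewrite [leRHS](_ : _ = e ^+ 4 * expR (- (rho2 / (2 * s))) / 8); last by field.
by move: E2 E3 e40; lra.
Qed.

End quantitative.

Section mixing.
Context {R : realType} {d : nat}.
Variables (V : 'rV[R]_d -> R) (pi mu0 : probability (Rd R d) R) (C K0 : R).
Hypothesis V1 : Ck 1 V.
Hypothesis Vconvex : convex_function [set: convex_lmodType 'rV[R]_d] V.
Hypothesis piE : forall A : set (Rd R d), measurable A ->
  pi A = (\int[lebesgue_Rd d]_(x in A) (expR (- V x))%:E)%E.
Hypothesis C0 : 0 < C.
Hypothesis piC : poincare_ineq pi C.
Hypothesis K00 : 0 < K0.
Hypothesis muK : poincare_ineq mu0 K0.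
Context {dO : measure_display} {Omega : measurableType dO}.
Variables (P : probability Omega R) (B X : R -> Omega -> 'rV[R]_d).
Hypothesis hX : langevin_dynamics P V mu0 B X.
Implicit Types (h L r : R) (x y z : 'rV[R]_d) (f g u v : 'rV[R]_d -> R).

(** Positivity and preservation of constants, with [c] kept apart because [c + v] may leave
    [0, 1]. *)
Lemma Qn_le_add h n L u v (c : R) : 0 < h -> 0 <= L -> BL L u -> BL L v ->
  (forall x, u x <= c + v x) -> forall x, Qn V h n u x <= c + Qn V h n v x.
Proof.
move=> h0 L0 uL vL uv; elim: n => // n IH x.
have qu := BL_shift x (prox_BL V1 Vconvex h0 L0 (Qn_BL V1 Vconvex n h0 L0 uL)).
have qv := BL_shift x (prox_BL V1 Vconvex h0 L0 (Qn_BL V1 Vconvex n h0 L0 vL)).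
rewrite /Qn /= {1 3}/Qstep /heat -(Ex_cst (noise d h) c) -ExD; [|exact: itg_cst|exact: BL_itg qv].
apply: Ex_le; [exact: BL_itg qu|by apply: itgD; [exact: itg_cst|exact: BL_itg qv]|].
by move=> y; exact: IH.
Qed.

(** All estimates must hold for one and the same discretisation: the four thresholds are replaced by
    their minimum, and one number of steps makes the three meshes finer than it. *)
Lemma three_stage_approximation t0 s r Lam L' kappa kappa' : 0 <= t0 -> 0 < s -> 0 < r ->
  0 <= Lam -> 0 <= L' -> 0 < kappa -> 0 < kappa' ->
  exists n k0 (h0 : R), let h1 := s / n.+1%:R in let h2 := r / n.+1%:R in
  [/\ 0 < h0, k0%:R * h0 = t0,
    forall f, BL Lam f -> `|Ex P (fun w => f (X (t0 + s + r) w)) -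
       Ex mu0 (Qn V h0 k0 (Qn V h1 n.+1 (Qn V h2 n.+1 f)))| <= kappa,
    forall f, BL L' f -> `|Ex P (fun w => f (X t0 w)) - Ex mu0 (Qn V h0 k0 f)| <= kappa &
    forall f, BL Lam f ->
      `|Ex pi (Qn V h1 n.+1 f) - Ex pi f| <= kappa /\
      Ex pi (fun x => (Qn V h2 n.+1 f x - Ex pi f) ^+ 2) <= expR (- (2 / C * r)) / 4 + kappa'].
Proof.
move=> t00 s0 r0 Lam0 L'0 k0 k'0.
have T0 : 0 <= t0 + s + r by rewrite !addr_ge0 ?(ltW s0) ?(ltW r0).
have [d1 d10 H1] := process_limit V1 Vconvex hX T0 Lam0 k0.
have [d2 d20 H2] := process_limit V1 Vconvex hX t00 L'0 k0.
have [d3 d30 H3] := Qn_invariance V1 Vconvex piE Lam0 (ltW s0) k0.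
have [d4 d40 H4] := Qn_decay V1 Vconvex piE C0 piC Lam0 (ltW r0) k'0.
pose del := Num.min (Num.min d1 d2) (Num.min d3 d4).
have del0 : 0 < del by rewrite !lt_min d10 d20 d30.
have [D1 D2 D3 D4] : [/\ del <= d1, del <= d2, del <= d3 & del <= d4].
  by rewrite !ge_min !lexx !orbT.
pose n := Num.truncn ((t0 + s + r) / del).
have small (a : R) : a <= t0 + s + r -> a / n.+1%:R <= del.
  move=> aT; rewrite ler_pdivrMr// mulrC -ler_pdivrMr//.
  rewrite (@le_trans _ _ ((t0 + s + r) / del))//; last by rewrite ltW// truncnS_gt.
  by apply: ler_wpM2r => //; rewrite invr_ge0 ltW.
(* When [t0 = 0] the first stage has no step, but its step size must still be positive; [s] provides
   one. *)
pose t1 := if t0 == 0 then s else t0.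
have t10 : 0 < t1 by rewrite /t1; case: eqVneq => // t0n; rewrite lt_def t0n t00.
pose h0 := t1 / n.+1%:R; pose h1 := s / n.+1%:R; pose h2 := r / n.+1%:R.
pose m := if t0 == 0 then 0%N else n.+1.
have h00 : 0 < h0 by rewrite divr_gt0.
have h10 : 0 < h1 by rewrite divr_gt0.
have h20 : 0 < h2 by rewrite divr_gt0.
have h0d : h0 <= del.
  by apply: small; rewrite /t1; case: eqP => [->|_]; lra.
have h1d : h1 <= del by apply: small; lra.
have h2d : h2 <= del by apply: small; lra.
have mt : m%:R * h0 = t0.
  by rewrite /m /h0 /t1; case: eqP => [->|_]; rewrite ?mul0r// mulrC divfK// pnatr_eq0.
have n1 : n.+1%:R * h1 = s by rewrite mulrC divfK// pnatr_eq0.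
have n2 : n.+1%:R * h2 = r by rewrite mulrC divfK// pnatr_eq0.
exists n, m, h0; split => // f fL.
- rewrite -Qgrid_steps3; apply: H1 => //; last by rewrite grid_steps3 mt n1 n2.
    by move=> j; rewrite /steps3; case: ifP => // _; case: ifP.
  by move=> j; rewrite /steps3; case: ifP => _; last case: ifP => _; exact: le_trans D1.
- rewrite -Qgrid_cst; apply: H2 => //; last by rewrite grid_cst.
  by move=> j; exact: le_trans D2.
- split; first by apply: H3 => //; [exact: le_trans D3|rewrite n1].
  by have := H4 h2 n.+1 f h20 (le_trans h2d D4); rewrite n2; apply.
Qed.

Lemma measurable_process t : 0 <= t -> measurable_fun setT (X t : Omega -> Rd R d).
Proof. by case: hX => _ _ + _ _; exact. Qed.

(** From [(x - 2 a)^2 >= 0]. It turns a bound on the variance into a bound on the mean of the part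
    above a threshold. *)
Lemma clamp01_le_sqr (a x : R) : 0 < a -> clamp01 (x - a) <= x ^+ 2 / (4 * a).
Proof.
move=> a0; have x20 : 0 <= x ^+ 2 / (4 * a) by rewrite divr_ge0 ?sqr_ge0// mulr_ge0// ltW.
have xa : x - a <= x ^+ 2 / (4 * a).
  by rewrite ler_pdivlMr ?mulr_gt0//; have := sqr_ge0 (x - 2 * a); rewrite sqrrB; lra.
by case: (clamp01P (x - a)) => -[c ->] //; exact: le_trans xa.
Qed.

Lemma le_clamp01_add (c x : R) : x <= 1 -> 0 <= c -> x <= c + clamp01 (x - c).
Proof. by move=> x1 c0; case: (clamp01P (x - c)) => -[c1 ->]; lra. Qed.

(** The conclusion is free of the Lipschitz constant [Lam], which only affects how fine the
    discretisation must be; hence indicators can be reached afterwards. *)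
Lemma mixing_BL (t0 e A s r Lam : R) (phi : 'rV[R]_d -> R) (mXt : measurable_fun setT (X t0 : Omega -> Rd R d)) :
  0 <= t0 -> 0 < e -> e <= 2^-1 ->
  A = Num.sqrt (C * K0) + Num.sqrt (C * t0) -> s = (C + A) / e -> r = 2 * ((C + A) / e) ->
  (forall Z : set (Rd R d), measurable Z -> fine (pi Z) - (1 - e) <= fine (image_prob mXt P Z)) ->
  0 <= Lam -> BL Lam phi ->
  Ex P (fun w => phi (X (t0 + s + r) w)) <= Ex pi phi + e.
Proof.
move=> t00 e0 e2 AE sE rE tv Lam0 pL; rewrite leNgt; apply/negP => gap.
set nu := image_prob mXt P; set m := Ex pi phi in gap.
have A0 : 0 <= A by rewrite AE addr_ge0// sqrtr_ge0.
have s0 : 0 < s by rewrite sE divr_gt0// ltr_wpDr.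
have r0 : 0 < r by rewrite rE mulr_gt0// divr_gt0// ltr_wpDr.
pose K := K0 + 2 * t0; have K_gt0 : 0 < K by rewrite ltr_wpDr// mulr_ge0.
(* Chosen so that the Poincare bound [K / rho^2] equals [e / 8]. *)
pose rho2 := 8 * K / e; have rho20 : 0 < rho2 by rewrite divr_gt0// mulr_gt0.
pose rho := Num.sqrt rho2; have rho0 : 0 < rho by rewrite sqrtr_gt0.
have rhoE : rho ^+ 2 = rho2 by rewrite sqr_sqrtr// ltW.
pose theta := e / 4; have th0 : 0 < theta by rewrite divr_gt0.
pose tau := theta ^+ 2 * expR (- (rho ^+ 2 / (2 * s))).
have tau0 : 0 < tau by rewrite mulr_gt0 ?expR_gt0// exprn_gt0.
have et0 : 0 < e * tau by rewrite mulr_gt0.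
have relax : expR (- (2 / C * r)) / (4 * e) <= e * tau / 2.
  by rewrite /tau rhoE; exact: (relaxation_beats_harnack C0 K00 t00 e0 e2 AE sE rE).
(* Discretisation errors must be small against [e] for the masses and the variance, and against
   [e tau] for the mean of [v] under [pi]. *)
pose kappa := Num.min (e / 100) (e * tau / 16).
have k0 : 0 < kappa by rewrite lt_min !divr_gt0.
have [k1 k2] : kappa <= e / 100 /\ kappa <= e * tau / 16 by rewrite !ge_min !lexx orbT.
pose kappa' := e * (e * tau / 16); have k'0 : 0 < kappa' by rewrite mulr_gt0// divr_gt0.
(* At time [t0] the approximation is applied to [v], to the separating function and to its square,
   which is [2 / rho]-Lipschitz. *)
pose L' := Num.max Lam (2 * rho^-1).
have LL' : Lam <= L' by rewrite le_max lexx.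
have rL' : 2 * rho^-1 <= L' by rewrite le_max lexx orbT.
have rV0 : 0 < rho^-1 by rewrite invr_gt0.
have L'0 : 0 <= L' by exact: le_trans LL'.
have [n [j0 [h0 /= [h00 jt Happ1 Happ2 Hpi]]]] :=
  three_stage_approximation t00 s0 r0 Lam0 L'0 k0 k'0.
set h1 := s / n.+1%:R in Happ1 Hpi; set h2 := r / n.+1%:R in Happ1 Hpi.
have h10 : 0 < h1 by rewrite divr_gt0.
have h20 : 0 < h2 by rewrite divr_gt0.
have n1 : n.+1%:R * h1 = s by rewrite mulrC divfK// pnatr_eq0.
pose u := Qn V h2 n.+1 phi; pose psi x := clamp01 (u x - m - theta); pose v := Qn V h1 n.+1 psi.
have uL : BL Lam u by exact: Qn_BL.
have psiL : BL Lam psi.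
  by apply: clamp01_BL => x y; rewrite (_ : _ - _ = u x - u y); [exact: uL.2|ring].
have vL : BL Lam v by exact: Qn_BL.
have /andP[m0 m1] : 0 <= m <= 1 by exact: BL_mean pL.
have mth : 0 <= m + theta by rewrite addr_ge0// ltW.
have upsi x : u x <= m + theta + psi x.
  by rewrite /psi -[u x - m - theta]addrA -opprD; apply: le_clamp01_add => //; have /andP[] := uL.1 x.
have F1 : Ex mu0 (Qn V h0 j0 (Qn V h1 n.+1 u)) <= m + theta + Ex mu0 (Qn V h0 j0 v).
  have QuL := Qn_BL V1 Vconvex n.+1 h10 Lam0 uL.
  rewrite -(Ex_cst mu0 (m + theta)) -ExD; [|exact: itg_cst|exact: BL_itg (Qn_BL V1 Vconvex j0 h00 Lam0 vL)].
  apply: Ex_le; [exact: BL_itg (Qn_BL V1 Vconvex j0 h00 Lam0 QuL)| |].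
    by apply: itgD; [exact: itg_cst|exact: BL_itg (Qn_BL V1 Vconvex j0 h00 Lam0 vL)].
  apply: (Qn_le_add j0 h00 Lam0 QuL vL); exact: (Qn_le_add n.+1 h10 Lam0 uL psiL upsi).
have nuE f : BL L' f -> Ex nu f = Ex P (fun w => f (X t0 w)).
  by move=> fL; exact: Ex_image (BL_meas fL) (image_itg (BL_meas fL) (BL_itg nu fL)).
have Ev : e - theta - 2 * kappa <= Ex nu v.
  have H1 := Happ1 _ pL; have H2 := Happ2 _ (BL_le LL' vL); rewrite (nuE _ (BL_le LL' vL)).
  rewrite ler_distl in H1; rewrite ler_distl in H2.
  have [/andP[_ g1] /andP[g2 _]] := (H1, H2).
  move: g1 g2 F1 gap; rewrite -/u -/m; set E1 := Ex mu0 _; set E2 := Ex mu0 _; set E3 := Ex P _; set E4 := Ex P _.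
  by clear; lra.
have v01 := vL.1; have mv := BL_meas vL.
(* The mean of [v] is at least [e - e / 4 - 2 kappa]; reverse Markov at [theta = e / 4] loses
   another [e / 4]. *)
have p0 : 3 * e / 8 <= fine (nu [set x | theta <= v x]).
  apply: le_trans (reverse_markov nu (ltW th0) mv v01); move: Ev k1 e0; rewrite /theta; clear; lra.
have ne : exists x, theta <= v x.
  apply: contrapT => H; move: p0; rewrite (_ : mkset _ = set0).
    have -> : nu set0 = 0%E by exact: measure0.
    by rewrite /= leNgt divr_gt0// mulr_gt0.
  by apply/seteqP; split => // x /= vx; apply: H; exists x.
have Epsi : Ex pi psi <= e * tau / 2 + e * tau / 16.
  have [_ dec] := Hpi _ pL; rewrite -/m in dec.
  have i2 : itg pi (fun x => (Qn V h2 n.+1 phi x - m) ^+ 2).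
    rewrite (_ : (fun x => _) = fun x => u x ^+ 2 - 2 * m * u x + m ^+ 2); last by apply/funext => x; rewrite /u; ring.
    apply: itgD; last exact: itg_cst.
    by apply: itgB; [exact: BL_itg_sqr uL|apply: itgZ; exact: BL_itg uL].
  apply: (@le_trans _ _ (e^-1 * Ex pi (fun x => (Qn V h2 n.+1 phi x - m) ^+ 2))).
    rewrite -ExZ//; apply: Ex_le; [exact: BL_itg psiL|exact: itgZ|].
    move=> x; rewrite /psi mulrC; have := @clamp01_le_sqr theta (u x - m) th0.
    by rewrite (_ : 4 * theta = e)// /theta; field.
  apply: (@le_trans _ _ (e^-1 * (expR (- (2 / C * r)) / 4 + kappa'))).
    by apply: ler_wpM2l => //; rewrite invr_ge0 ltW.
  rewrite mulrDr /kappa' mulKf ?gt_eqF// lerD2r (le_trans _ relax)//.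
  by rewrite [leLHS](_ : _ = expR (- (2 / C * r)) / (4 * e))//; field; rewrite gt_eqF.
have Epv : Ex pi v <= e * tau * (5 / 8).
  have [inv _] := Hpi _ psiL; move: inv Epsi k2 et0; rewrite ler_norml => /andP[_]; rewrite -/v; clear; lra.
(* The mean of [v] is at most [(1/2 + 1/16 + 1/16) e tau]. So [Z] misses at most [5 e / 8] of [pi],
   and the total variation bound leaves it [3 e / 8] of the law at time [t0]. *)
have pZ : fine (pi [set x | tau <= v x]) <= 5 * e / 8.
  rewrite -(ler_pM2l tau0) (le_trans (markov_event pi tau mv v01))// (le_trans Epv)//.
  by rewrite (_ : tau * (5 * e / 8) = e * tau * (5 / 8))//; field.
pose Z : set (Rd R d) := ~` [set x | tau <= v x].
have mT := measurable_ge tau mv.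
have mZ : measurable Z by exact: measurableC.
have p1 : 3 * e / 8 <= fine (nu Z).
  apply: le_trans (tv _ mZ).
  have -> : fine (pi Z) = 1 - fine (pi [set x | tau <= v x]).
    have H := probability_setC pi mT; rewrite [X in fine X](H : pi Z = _).
    by rewrite fineB// fin_num_measure.
  move: pZ; clear; lra.
have harn x y : v x ^+ 2 <= v y * expR (sqnorm (x - y) / (2 * s)).
  by rewrite -n1; exact: (Qn_harnack V1 Vconvex n x y h10 Lam0 psiL).
have [D [DL D0 D1]] := harnack_separation s0 th0 rho0 harn erefl ne.
have D2L : BL L' (fun x => D x ^+ 2) by exact: BL_le rL' (BL_sqr DL).
have D1L : BL L' D.
  by apply: BL_le DL; rewrite (le_trans _ rL')// ler_peMl ?(ltW rV0)// ler1n.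
have e8 : 0 <= 3 * e / 8 by rewrite divr_ge0// mulr_ge0// ltW.
have D1' y : Z y -> D y = 1 by move=> Zy; apply: D1; rewrite ltNge; exact/negP.
(* Lower bound [3 e / 16] against upper bound [e / 8] for the same variance: the gap [e / 16]
   exceeds the discretisation error [3 kappa]. *)
have low := two_point_variance (BL_meas DL) DL.1 (measurable_ge theta mv) mZ D0 D1' e8 p0 p1.
have up := Qn_Var V1 Vconvex j0 muK (ltW K00) h00 (ltW rV0) DL.
have rK : (K0 + j0%:R * (2 * h0)) * rho^-1 ^+ 2 = e / 8.
  have -> : j0%:R * (2 * h0) = 2 * t0 by rewrite mulrCA jt.
  by rewrite exprVn rhoE /rho2 -/K; field; rewrite !gt_eqF.
rewrite rK in up.
have b1 := Happ2 _ D2L; have b2 := Happ2 _ D1L; rewrite -(nuE _ D2L) in b1; rewrite -(nuE _ D1L) in b2.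
have QD := Qn_BL V1 Vconvex j0 h00 (ltW rV0) DL.
have /andP[c0 c1] := BL_mean nu DL; have /andP[c2 c3] := BL_mean mu0 QD.
move: low up b1 b2 c0 c1 c2 c3; rewrite /Var.
set a := Ex nu D; set b := Ex mu0 (Qn V h0 j0 D); set a2 := Ex nu _; set b2 := Ex mu0 _.
rewrite !ler_norml => low up /andP[_ b1] /andP[b3 _] c0 c1 c2 c3.
have : b ^+ 2 <= a ^+ 2 + 2 * kappa.
  by apply: sqr_le_add; [exact/andP|exact/andP|exact: ltW|rewrite -opprB lerNl].
move: low up b1 k1 e0; clear; lra.
Qed.

End mixing.

(** * Total variation from Lipschitz test functions *)

Section total_variation_test.
Context {R : realType} {d : nat}.
Variables (mu : bool -> probability (Rd R d) R).
Implicit Types (A : set (Rd R d)) (f : 'rV[R]_d -> R).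

(** One [f] must approximate the indicator under both measures at once, hence the family indexed by
    [bool]. *)
Definition approx A := measurable A /\ forall k : R, 0 < k -> exists L f,
  [/\ 0 <= L, BL L f & forall b, Ex (mu b) (fun x => `|f x - \1_A x|) <= k].

Lemma indic_sub A1 A2 x : A1 `<=` A2 -> \1_A1 x <= \1_A2 x :> R.
Proof.
move=> A12; rewrite !indicE; case: (boolP (x \in A1)) => [/set_mem/A12/mem_set -> //|_].
by case: (_ \in _).
Qed.

Let itg_err b A L f : measurable A -> BL L f -> itg (mu b) (fun x => `|f x - \1_A x|).
Proof.
move=> mA fL; apply: integrable_norm; apply: itgB; first exact: BL_itg fL.
exact: (Ex_indic (mu b) mA).1.
Qed.

Lemma approxC A : approx A -> approx (~` A).
Proof.
move=> [mA H]; split; first exact: measurableC.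
move=> k /H[L [f [L0 fL fk]]]; exists L, (fun x => 1 - f x); split => //; first exact: BL_compl.
move=> b; rewrite (le_trans _ (fk b))//; apply: Ex_le.
- by apply: itg_err; [exact: measurableC|exact: BL_compl fL].
- exact: itg_err fL.
- move=> x; have -> : \1_(~` A) x = 1 - \1_A x :> R by rewrite indicE in_setC indicE; case: (_ \in _); rewrite ?subrr ?subr0.
  by rewrite (_ : 1 - f x - (1 - \1_A x) = - (f x - \1_A x)) ?normrN//; ring.
Qed.

Lemma approxI A1 A2 : approx A1 -> approx A2 -> approx (A1 `&` A2).
Proof.
move=> [mA1 H1] [mA2 H2]; have mA := measurableI _ _ mA1 mA2; split => // k k0.
have k20 : 0 < k / 2 by rewrite divr_gt0.
have [L1 [f1 [L10 f1L E1]]] := H1 _ k20; have [L2 [f2 [L20 f2L E2]]] := H2 _ k20.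
exists (L1 + L2), (fun x => f1 x * f2 x); split; [exact: addr_ge0|exact: BL_M|move=> b].
rewrite [leRHS]splitr.
apply: le_trans (lerD (E1 b) (E2 b)).
have i1 := itg_err b mA1 f1L; have i2 := itg_err b mA2 f2L.
rewrite -ExD//; apply: Ex_le; [exact: itg_err (BL_M f1L f2L)|exact: itgD|].
move=> x; rewrite indicI.
have -> : f1 x * f2 x - \1_A1 x * \1_A2 x = (f1 x - \1_A1 x) * f2 x + \1_A1 x * (f2 x - \1_A2 x) by ring.
rewrite (le_trans (ler_normD _ _))// !normrM lerD//.
  by apply: ler_piMr => //; exact: BL_norm f2L.
by apply: ler_piMl => //; rewrite indicE; case: (_ \in _); rewrite ?normr1 ?normr0.
Qed.

Lemma approxU A1 A2 : approx A1 -> approx A2 -> approx (A1 `|` A2).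
Proof. by move=> H1 H2; rewrite -[A1 `|` A2]setCK setCU; apply/approxC/approxI; exact: approxC. Qed.

Lemma approx_set0 : approx set0.
Proof.
split => // k k0; exists 0, (fun=> 0); split => //; first by apply: BL_cst; rewrite ?lexx ?ler01.
move=> b; rewrite (@Ex_eq _ (Rd R d) R _ _ (fun=> 0)) ?Ex_cst ?(ltW k0)//.
by move=> x; rewrite indic0 subrr normr0.
Qed.

Lemma inner_measure_limit (F : nat -> set (Rd R d)) (k : R) : (forall n, measurable (F n)) ->
  nondecreasing_seq F -> 0 < k -> exists n, forall b,
  fine (mu b (\bigcup_i F i)) - fine (mu b (F n)) <= k.
Proof.
move=> mF ndF k0; have mU := bigcupT_measurable _ mF.
have H b : exists n, forall j, (n <= j)%N -> fine (mu b (\bigcup_i F i)) - fine (mu b (F j)) <= k.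
  have := nondecreasing_cvg_mu mF mU ndF (mu := mu b).
  have fU : mu b (\bigcup_i F i) = (fine (mu b (\bigcup_i F i)))%:E by rewrite fineK// fin_num_measure.
  rewrite [X in _ --> X]fU => /fine_cvgP[_ /cvgrPdist_le/(_ _ k0)[n _ Hn]].
  by exists n => j nj; exact: le_trans (ler_norm _) (Hn j nj).
have [n1 H1] := H true; have [n2 H2] := H false.
by exists (maxn n1 n2) => -[]; [exact: H1 (leq_maxl _ _)|exact: H2 (leq_maxr _ _)].
Qed.

Lemma Ex_indicB b A1 A2 : measurable A1 -> measurable A2 ->
  itg (mu b) (fun x => \1_A1 x - \1_A2 x) /\
  Ex (mu b) (fun x => \1_A1 x - \1_A2 x) = fine (mu b A1) - fine (mu b A2).
Proof.
move=> m1 m2; have [i1 <-] := Ex_indic (mu b) m1; have [i2 <-] := Ex_indic (mu b) m2.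
by split; [exact: itgB|exact: ExB].
Qed.

Lemma approx_bigcup (F : nat -> set (Rd R d)) : (forall n, approx (F n)) -> approx (\bigcup_n F n).
Proof.
move=> aF; pose G n := \big[setU/set0]_(i < n.+1) F i.
have aG n : approx (G n).
  rewrite /G; elim: n.+1 => [|k IH]; first by rewrite big_ord0; exact: approx_set0.
  by rewrite big_ord_recr; exact: approxU.
have GE : \bigcup_n F n = \bigcup_n G n by apply/esym/bigcup_bigsetU_bigcup.
have ndG : nondecreasing_seq G.
  by move=> i j ij; apply/subsetPset; exact: subset_bigsetU.
have mG n : measurable (G n) := (aG n).1.
rewrite GE; have mU := bigcupT_measurable _ mG; split => // k k0.
have k20 : 0 < k / 2 by rewrite divr_gt0.
have [n Hn] := inner_measure_limit mG ndG k20.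
have [L [f [L0 fL E]]] := (aG n).2 _ k20; exists L, f; split => // b.
rewrite [leRHS]splitr.
apply: le_trans (lerD (E b) (Hn b)).
have [i1 <-] := Ex_indicB b mU (mG n).
rewrite -ExD//; last exact: itg_err fL.
apply: Ex_le; [exact: itg_err fL|by apply: itgD => //; exact: itg_err fL|].
move=> x; rewrite -[f x - _](subrKA (\1_(G n) x)) (le_trans (ler_normD _ _))// lerD// distrC ger0_norm// subr_ge0.
by apply: indic_sub => y Gy; exists n.
Qed.

(** A large multiple of the distance to the complement, clipped to [0, 1], differs from the
    indicator only on a thin layer inside [A], whose mass vanishes because [A] is open. *)
Lemma approx_open (A : set 'rV[R]_d) : open A -> approx (A : set (Rd R d)).
Proof.
move=> oA; have mA := open_Rd_measurable oA; split => // k k0.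
have [AT|NA] : A = setT \/ (~` A) !=set0.
  by have [/eqP|/set0P] := boolP (~` A == set0); [rewrite -setCT => /setC_inj; left|right].
  exists 0, (fun=> 1); split => //; first by apply: BL_cst; rewrite ?lexx ?ler01.
  move=> b; rewrite (@Ex_eq _ (Rd R d) R _ _ (fun=> 0)) ?Ex_cst ?(ltW k0)//.
  by move=> x; rewrite AT indicT subrr normr0.
pose D := edist (~` A).
have D0 x : 0 <= D x by apply: le_edist => // y _; exact: enorm_ge0.
have mD : measurable_fun setT (D : Rd R d -> R).
  by apply: continuous_measurable_Rd; exact: elip_continuous (edist_elip NA).
have DA x : ~ A x -> D x = 0.
  by move=> xA; apply/le_anti; rewrite D0 andbT; have := @edist_le R d (~` A) x x xA; rewrite subrr enorm0.
pose F n : set (Rd R d) := [set x : Rd R d | 1 <= n.+1%:R * D x].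
have mF n : measurable (F n) by apply: measurable_ge; exact: measurable_funM.
have ndF : nondecreasing_seq F.
  move=> i j ij; apply/subsetPset => x; rewrite /F /= => /le_trans; apply.
  by apply: ler_wpM2r => //; rewrite ler_nat.
have FE : \bigcup_n F n = A.
  apply/seteqP; split => x; first by move=> [n _]; apply: contraPP => /DA; rewrite /F /= => ->; rewrite mulr0 ler10.
  move=> Ax; have /nbhs_ballP[e /= e0 eA] : nbhs (x : 'rV[R]_d) A by exact: open_nbhs_nbhs.
  have eD : e <= D x.
    apply: le_edist => // y yA; rewrite leNgt; apply/negP => xy; apply: yA; apply: eA.
    exact: enorm_ball.
  exists (Num.truncn e^-1) => //; rewrite /F /=.
  apply: (@le_trans _ _ ((Num.truncn e^-1).+1%:R * e)); last exact: ler_wpM2l.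
  by rewrite -ler_pdivrMr// mul1r ltW// truncnS_gt.
have [n Hn] := inner_measure_limit mF ndF k0; rewrite FE in Hn.
have fL : BL n.+1%:R (fun x => clamp01 (n.+1%:R * D x)).
  apply: clamp01_BL => x y; rewrite -mulrBr normrM ger0_norm//.
  by apply: ler_wpM2l => //; have := edist_elip NA x y; rewrite mul1r.
exists n.+1%:R, (fun x => clamp01 (n.+1%:R * D x)); split => // b.
apply: le_trans (Hn b); have [i1 <-] := Ex_indicB b mA (mF n).
apply: Ex_le => //; first exact: itg_err fL.
move=> x; rewrite !indicE; case: (boolP (x \in F n)) => [xF|_].
  have /set_mem xF' := xF; rewrite mem_set; last by rewrite -FE; exists n.
  have -> : clamp01 (n.+1%:R * D x) = 1.
    by case: (clamp01P (n.+1%:R * D x)) => -[c ->] //; move: xF' c; rewrite /F /=; lra.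
  by rewrite !subrr normr0.
rewrite subr0; case: (boolP (x \in A)) => [_|/negP xA] /=.
  by have /andP[c0 c1] := fL.1 x; rewrite ler_norml; apply/andP; split; lra.
rewrite DA; last by move=> Ax; apply: xA; exact/mem_set.
by rewrite mulr0 /clamp01 (_ : Num.min 1 0 = 0) ?maxxx ?subrr ?normr0//; apply/min_idPr.
Qed.

(** The approximable sets form a sigma-algebra containing the open sets. *)
Lemma approx_measurable A : measurable A -> approx A.
Proof.
suff : @measurable _ (Rd R d) `<=` approx by exact.
apply: smallest_sub; last exact: approx_open.
split; first exact: approx_set0.
- by move=> B aB; rewrite setTD; exact: approxC.
- exact: approx_bigcup.
Qed.

End total_variation_test.

(** A one-sided bound suffices: the opposite inequality comes from the complementary set. *)
Lemma total_variation_le {R : realType} {d : nat} (mu nu : probability (Rd R d) R) (e : R) :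
  (forall L f, 0 <= L -> BL L f -> Ex mu f <= Ex nu f + e) -> (Defs.total_variation mu nu <= e%:E)%E.
Proof.
move=> H; pose ms (b : bool) : probability (Rd R d) R := if b then mu else nu.
have one A : measurable A -> fine (mu A) - fine (nu A) <= e.
  move=> mA; apply: (@le_small_slope _ _ _ 2) => t t0 _.
  have [_ /(_ t t0)[L [f [L0 fL E]]]] := approx_measurable ms mA.
  have err b : `|Ex (ms b) f - fine (ms b A)| <= t.
    have [i1 <-] := Ex_indic (ms b) mA; have i2 := BL_itg (ms b) fL.
    by rewrite -ExB// (le_trans (Ex_norm (itgB i2 i1)))//; exact: E.
  have := err true; have := err false; have := H L f L0 fL; rewrite /ms !ler_distl; clear.
  by move=> ? /andP[? ?] /andP[? ?]; lra.
apply: ge_ereal_sup => _ [A mA <-].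
have fE (m : probability (Rd R d) R) : m A = (fine (m A))%:E by rewrite fineK// fin_num_measure.
rewrite (fE mu) (fE nu) /= lee_fin ler_norml (one A mA) andbT.
have c (m : probability (Rd R d) R) : fine (m (~` A)) = 1 - fine (m A).
  have E := probability_setC m mA; rewrite [X in fine X](E : m (~` A) = _).
  by rewrite fineB// fin_num_measure.
by have := one _ (measurableC mA); rewrite !c; lra.
Qed.

(** * Poincare constants and degenerate cases *)

Section poincare_constants.
Context {R : realType} {d : nat}.
Implicit Types (m : probability (Rd R d) R) (C : R).

Lemma poincare_constant_ge0 m : (0 <= poincare_constant m)%E.
Proof. by apply: le_ereal_inf_tmp => _ [C [C0 _] <-]; rewrite lee_fin. Qed.

Lemma poincare_constant_lt m C : (poincare_constant m < C%:E)%E -> poincare_ineq m C.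
Proof.
move=> /ereal_inf_lt[_ [C' [C'0 H] <-]]; rewrite lte_fin => CC' f sf.
apply: (le_trans (H f sf)); apply: lee_wpmul2r; last by rewrite lee_fin ltW.
by apply: integral_ge0 => x _; rewrite lee_fin sqnorm_ge0.
Qed.

(** A zero constant would make a coordinate almost surely constant, whereas hyperplanes are null for
    a measure with a density. This excludes the product of zero with an infinite constant of
    [mu0]. *)
Lemma poincare_constant_gt0 (V : 'rV[R]_d -> R) (pi : probability (Rd R d) R) :
  Ck 1 V -> (0 < d)%N ->
  (forall A : set (Rd R d), measurable A -> pi A = (\int[lebesgue_Rd d]_(x in A) (expR (- V x))%:E)%E) ->
  (0 < poincare_constant pi)%E.
Proof.
move=> V1 d0 piE; rewrite ltNge; apply/negP => C0.
pose i := Ordinal d0; pose f (x : 'rV[R]_d) := x 0 i.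
have sf : smooth f by move=> k; exact: Ck_coord.
have gf x : sqnorm (gradient f x) = 1.
  rewrite (_ : gradient f x = delta_mx 0 i) ?sqnorm_delta//; apply/rowP => j; rewrite mxE /partial.
  by rewrite (coord_derive x i j).2 !mxE eqxx /= eq_sym.
have V0 : ('V_pi[f : Rd R d -> R] <= 0)%E.
  apply/lee_addgt0Pr => C Cp; rewrite add0e.
  have := @poincare_constant_lt pi C (le_lt_trans C0 _) f sf; rewrite lte_fin => /(_ Cp).
  have -> : (\int[pi]_x (sqnorm (gradient f x))%:E = 1)%E.
    under eq_integral do rewrite gf.
    by rewrite integral_cst// mul1e; exact: probability_setT.
  by rewrite mule1.
pose c := Ex pi f.
have mf : measurable_fun setT (f : Rd R d -> R) := measurable_coord i.
pose g (x : Rd R d) : \bar R := ((f x - c) * (f x - c))%:E.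
have mg : measurable_fun setT g.
  by apply/measurable_EFinP; apply: measurable_funM; exact: measurable_funB.
have I0 : (\int[pi]_x `|g x|)%E = 0%E.
  apply/le_anti; rewrite integral_ge0// andbT.
  rewrite (_ : (\int[pi]_x `|g x|)%E = 'V_pi[f : Rd R d -> R])//.
  rewrite /variance covariance.unlock [in RHS]expectation.unlock.
  by apply: eq_integral => x _; rewrite gee0_abs; [by []|by rewrite lee_fin -expr2 sqr_ge0].
pose A : set (Rd R d) := [set x | f x = c].
pose S (j : 'I_d) : set R := if j == i then [set c] else setT.
have mS j : measurable (S j) by rewrite /S; case: ifP.
have AE : A = [set x : Rd R d | forall j : 'I_d, S j ((x : 'rV[R]_d) 0 j)].
  apply/seteqP; split => x; first by move=> Ax j; rewrite /S; case: eqP => // ->.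
  by move=> /(_ i); rewrite /S eqxx.
have mA : measurable A by rewrite AE; exact: measurable_Rd_box.
have lamA : lebesgue_Rd d A = 0%E.
  rewrite AE lebesgue_Rd_box// (bigD1 i)//= {1}/S eqxx lebesgue_measure_set1.
  by rewrite mul0e.
have piA : pi A = 0%E.
  rewrite piE//; apply: null_set_integral => //.
  apply: measurable_funTS; apply/measurable_EFinP.
  apply: measurableT_comp => //; apply: measurable_funN.
  by apply: continuous_measurable_Rd; exact: Ck_continuous V1.
have [+ _] := ae_eq_integral_abs pi measurableT mg; move=> /(_ I0) /negligibleP.
have NA : ~` [set x | setT x -> g x = cst 0%E x] = ~` A.
  congr (~` _); apply/seteqP; split => x /=.
    by move=> /(_ I)[] /eqP; rewrite mulf_eq0 orbb subr_eq0 => /eqP.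
  by rewrite /A /g /= => -> _; rewrite subrr mul0r.
rewrite NA => /(_ (measurableC mA)) p0; have p1 := probability_setC pi mA.
rewrite piA sube0 in p1; have /eqP := etrans (esym p1) p0.
by rewrite onee_eq0.
Qed.

Lemma total_variation_dim0 (m1 m2 : probability (Rd R d) R) : d = 0%N -> (Defs.total_variation m1 m2 <= 0)%E.
Proof.
move=> d0; apply: ge_ereal_sup => _ [A mA <-].
suff -> : m1 A = m2 A by rewrite subee ?fin_num_measure// abse0.
have [[x Ax]|A0] := pselect (A !=set0).
  have -> : A = setT by apply/seteqP; split => // y _; rewrite (_ : y = x)//; apply/rowP => i; have := ltn_ord i; rewrite {2}d0.
  have H1 := @probability_setT _ _ _ m1; have H2 := @probability_setT _ _ _ m2.
  exact: (etrans H1 (esym H2)).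
have -> : A = set0 by apply/seteqP; split => // y Ay; apply: A0; exists y.
have H1 := measure0 m1; have H2 := measure0 m2; exact: (etrans H1 (esym H2)).
Qed.

End poincare_constants.

(** Perturbing by [s^2] instead of [s] keeps the effect on the square root linear in [s], even where
    [a b = 0]. *)
Lemma sqrtr_perturb {R : realType} (a b s : R) : 0 <= a -> 0 <= b -> 0 <= s -> s <= 1 ->
  Num.sqrt ((a + s ^+ 2) * (b + s ^+ 2)) <= Num.sqrt (a * b) + s * Num.sqrt (a + b + 1).
Proof.
move=> a0 b0 s0 s1; have ab : 0 <= a * b by rewrite mulr_ge0.
have ab1 : 0 <= a + b + 1 by rewrite !addr_ge0.
have r0 : 0 <= Num.sqrt (a * b) + s * Num.sqrt (a + b + 1) by rewrite addr_ge0 ?mulr_ge0 ?sqrtr_ge0.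
rewrite -(ger0_norm r0) -sqrtr_sqr ler_wsqrtr// sqrrD exprMn !sqr_sqrtr//.
have c0 : 0 <= Num.sqrt (a * b) * (s * Num.sqrt (a + b + 1)) by rewrite !mulr_ge0 ?sqrtr_ge0.
have s2 : 0 <= s ^+ 2 by rewrite sqr_ge0.
have s4 : s ^+ 2 * s ^+ 2 <= s ^+ 2 by rewrite ler_piMr// expr_le1.
lra.
Qed.

(** * From one mixing time to the other *)

Section mixing_window_bound.
Context {R : realType} {d : nat}.
Variables (V : 'rV[R]_d -> R) (pi mu0 : probability (Rd R d) R).
Hypothesis V1 : Ck 1 V.
Hypothesis Vconvex : convex_function [set: convex_lmodType 'rV[R]_d] V.
Hypothesis piE : forall A : set (Rd R d), measurable A ->
  pi A = (\int[lebesgue_Rd d]_(x in A) (expR (- V x))%:E)%E.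
Context {dO : measure_display} {Omega : measurableType dO}.
Variables (P : probability Omega R) (B X : R -> Omega -> 'rV[R]_d).
Hypothesis hX : langevin_dynamics P V mu0 B X.
Variable e : R.
Hypothesis e0 : 0 < e.
Hypothesis e2 : e <= 2^-1.

Let law t := pushforward P (X t : Omega -> Rd R d).

Lemma mixing_time_le (C K0 t0 : R) : 0 < C -> 0 < K0 -> 0 <= t0 ->
  poincare_ineq pi C -> poincare_ineq mu0 K0 ->
  (Defs.total_variation (law t0) pi <= (1 - e)%:E)%E ->
  (mixing_time law pi e <= (t0 + 3 / e * (C + Num.sqrt (C * K0) + Num.sqrt (C * t0)))%:E)%E.
Proof.
move=> C0 K00 t00 piC muK tv.
pose A := Num.sqrt (C * K0) + Num.sqrt (C * t0); pose w := (C + A) / e.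
have A0 : 0 <= A by rewrite addr_ge0// sqrtr_ge0.
have w0 : 0 <= w by rewrite divr_ge0 ?addr_ge0 ?(ltW C0) ?(ltW e0).
have T0 : 0 <= t0 + w + 2 * w by rewrite !addr_ge0// mulr_ge0.
have -> : t0 + 3 / e * (C + Num.sqrt (C * K0) + Num.sqrt (C * t0)) = t0 + w + 2 * w.
  by rewrite -(addrA C) -/A /w; ring.
apply: ereal_inf_lbound; exists (t0 + w + 2 * w) => //; split => //.
have mXt := measurable_process hX t00; have mXT := measurable_process hX T0.
apply: (@total_variation_le R d (image_prob mXT P) pi e) => L f L0 fL.
have E := Ex_image mXT (BL_meas fL) (image_itg (BL_meas fL) (BL_itg (image_prob mXT P) fL)).
rewrite E; apply: (@mixing_BL R d V pi mu0 C K0 V1 Vconvex piE C0 piC K00 muK _ _ P B X hX t0 e A w (2 * w) L f mXt) => // Z mZ.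
have : (`|image_prob mXt P Z - pi Z| <= (1 - e)%:E)%E.
  by apply: le_trans tv; apply: ereal_sup_ubound; exists Z.
have fE (m : probability (Rd R d) R) : m Z = (fine (m Z))%:E by rewrite fineK// fin_num_measure.
rewrite (fE (image_prob mXt P)) (fE pi) /= lee_fin ler_norml => /andP[+ _]; lra.
Qed.

(** The three infima need not be attained and may vanish, so [c], [k] and [t] are all enlarged by
    [s^2]; the resulting error is of first order in [s]. *)
Lemma mixing_time_gap (c k t : R) : 0 <= c -> 0 <= k -> 0 <= t ->
  poincare_constant pi = c%:E -> poincare_constant mu0 = k%:E ->
  mixing_time law pi (1 - e) = t%:E ->
  (mixing_time law pi e <= (t + 3 / e * (c + Num.sqrt (c * k) + Num.sqrt (c * t)))%:E)%E.
Proof.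
move=> c0 k0 t0 cE kE tE.
pose M := 1 + 3 / e * (1 + Num.sqrt (c + k + 1) + Num.sqrt (c + t + 1)).
have H s : 0 < s -> s <= 1 -> (mixing_time law pi e <=
    (t + 3 / e * (c + Num.sqrt (c * k) + Num.sqrt (c * t)) + M * s)%:E)%E.
  move=> s0 s1; have s20 : 0 < s ^+ 2 by rewrite exprn_gt0.
  have s2s : s ^+ 2 <= s by rewrite expr2 ler_piMr// ltW.
  have pC : poincare_ineq pi (c + s ^+ 2).
    by apply: poincare_constant_lt; rewrite cE lte_fin ltrDl.
  have pK : poincare_ineq mu0 (k + s ^+ 2).
    by apply: poincare_constant_lt; rewrite kE lte_fin ltrDl.
  have : (mixing_time law pi (1 - e) < (t + s ^+ 2)%:E)%E by rewrite tE lte_fin ltrDl.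
  move=> /ereal_inf_lt[_ [t1 [t10 tv] <-]]; rewrite lte_fin => t1s.
  have Cp : 0 < c + s ^+ 2 by rewrite ltr_wpDl.
  have Kp : 0 < k + s ^+ 2 by rewrite ltr_wpDl.
  apply: (le_trans (mixing_time_le Cp Kp t10 pC pK tv)); rewrite lee_fin.
  have h1 := sqrtr_perturb c0 k0 (ltW s0) s1.
  have h2 : Num.sqrt ((c + s ^+ 2) * t1) <= Num.sqrt (c * t) + s * Num.sqrt (c + t + 1).
    apply: le_trans (sqrtr_perturb c0 t0 (ltW s0) s1); apply: ler_wsqrtr.
    by apply: ler_wpM2l; exact: ltW.
  have h3 : 0 <= 3 / e by rewrite divr_ge0// ltW.
  have := ler_wpM2l h3 (lerD (lerD s2s h1) h2); move: t1s s2s; rewrite /M.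
  set q := 3 / e; lra.
have te0 : (0 <= mixing_time law pi e)%E.
  by apply: le_ereal_inf_tmp => _ [u [u0 _] <-]; rewrite lee_fin.
(* The case [s = 1] already shows that the mixing time is finite. *)
have := H 1 ltr01 (lexx 1); move: te0 H; case: (mixing_time law pi e) => [u| |] // _ H _.
by rewrite lee_fin; apply: (@le_small_slope _ _ _ M) => s s0 s1; have := H s s0 s1; rewrite lee_fin.
Qed.

End mixing_window_bound.

Theorem theorem1p1 (R : realType) (d : nat)
  (V : 'rV[R]_d -> R) (pi mu0 : probability (Rd R d) R)
  (hpi : log_concave_with_potential pi V)
  (dO : measure_display) (Omega : measurableType dO) (P : probability Omega R)
  (B X : R -> Omega -> 'rV[R]_d)
  (hX : langevin_dynamics P V mu0 B X)
  (e : R) (he : 0 < e < 2^-1) :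
  let mu := fun t : R => pushforward P (X t : Omega -> Rd R d) in
  (mixing_window mu pi e <=
   (3 / e)%:E *
   (poincare_constant pi
    + sqrte (poincare_constant pi * poincare_constant mu0)
    + sqrte (poincare_constant pi * mixing_time mu pi (1 - e)%R)))%E.

Proof.
lazy zeta; set mu := (fun t : R => pushforward P _).
case: hpi => V2 Vconvex piE; have V1 := CkW V2.
case/andP: he => e0 e2'; have e2 := ltW e2'.
have k0 := poincare_constant_ge0 mu0.
have tm0 : (0 <= mixing_time mu pi (1 - e))%E.
  by apply: le_ereal_inf_tmp => _ [u [u0 _] <-]; rewrite lee_fin.
have e30 : (0 < (3 / e)%:E)%E by rewrite lte_fin divr_gt0.
have ny (x : \bar R) : (0 <= x)%E -> x != -oo%E by move=> x0; rewrite -ltNye (lt_le_trans _ x0).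
have sny (x : \bar R) : sqrte x != -oo%E by exact/ny/sqrte_ge0.
(* In dimension zero all laws coincide and the mixing time at level [e] is 0; otherwise the constant
   of [pi] is positive. *)
have [d0|d0] := posnP d.
  apply: (@le_trans _ _ 0%E).
    rewrite /mixing_window -[leRHS]adde0; apply: leeD; last by rewrite oppe_le0.
    apply: ereal_inf_lbound; exists 0 => //; split => //.
    apply: (@le_trans _ _ 0%E); last by rewrite lee_fin ltW.
    exact: (total_variation_dim0 (image_prob (measurable_process hX (lexx 0)) P) pi d0).
  by rewrite mule_ge0 ?(ltW e30)// !adde_ge0 ?sqrte_ge0 ?poincare_constant_ge0.
have cp := poincare_constant_gt0 V1 d0 piE.
have gap := mixing_time_gap V1 Vconvex piE hX e0 e2; rewrite -/mu in gap.
rewrite /mixing_window; move: cp; case cE : (poincare_constant pi) => [c| |] // cp; last first.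
  by rewrite [leRHS](_ : _ = +oo%E) ?leey// !addye ?gt0_muley.
(* If level [1 - e] is never reached, the extended difference defining the window is [-oo]. *)
move: tm0; case tE : (mixing_time mu pi (1 - e)) => [t| |] // t0; last by rewrite addeNy leNye.
(* Positivity of the constant of [pi] makes its product with an infinite constant of [mu0]
   infinite. *)
move: k0; case kE : (poincare_constant mu0) => [k| |] // k0; last first.
  rewrite [leRHS](_ : _ = +oo%E) ?leey// gt0_muley//= addey// addye ?gt0_muley//.
rewrite leeBlDr// addeC; rewrite !lee_fin in k0 t0; rewrite lte_fin in cp.
exact: gap (ltW cp) k0 t0 cE kE tE.
Qed.
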